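(* Let $K$ be an algebraically closed field of characteristic $2$ and let $X = \{F = 0\} \subset \mathbb{P}^3_K$ be a normal quartic surface (hence $\mathrm{Sing}(X)$ is a finite set). If $X$ has a double point $P$ such that the projection with centre $P$ is an inseparable double cover of $\mathbb{P}^2$, i.e. $G \equiv 0$ in the Taylor development of $F$ at $P$, then $|\mathrm{Sing}(X)| \leq 16$. Moreover, there exists such a surface $X$ with $|\mathrm{Sing}(X)| = 14$.
   Context: $\mathrm{Sing}(X)$ is the set of singular points of $X$, i.e. the points where $F$ and all its partial derivatives vanish. A double point is a point of multiplicity $2$. Taylor development: if $P$ is a double point of $X$, choose homogeneous coordinates $(x_1,x_2,x_3,z)$ on $\mathbb{P}^3$ with $P = \{x_1=x_2=x_3=0,\ z=1\}$ and write $$F(x_1,x_2,x_3,z) = z^2 Q(x) + z\,G(x) + B(x), \qquad x = (x_1,x_2,x_3),$$ with $Q, G, B$ homogeneous of degrees $2,3,4$ respectively and $Q \neq 0$. The projection with centre $P$ is $\pi_P : X \setminus \{P\} \to \mathbb{P}^2$, $(x,z) \mapsto x$. *)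

(* Defs.v *)
From HB Require Import structures.
From mathcomp Require Import all_boot all_order all_algebra.
From mathcomp.classical Require Import boolp.
From mathcomp Require Import mpoly.

Set Implicit Arguments.
Unset Strict Implicit.
Unset Printing Implicit Defensive.
Import GRing.Theory.
Local Open Scope ring_scope.

(* A point of P^n is a line through the origin of K^(n+1). *)
Definition proj_space (K : fieldType) (n : nat) :=
  {L : {vspace 'rV[K]_n.+1} | \dim L == 1%N}.

(* Homogeneous coordinates of a point, i.e. a chosen nonzero vector of the
   line.  They are only ever fed to homogeneous polynomials, to test whether
   these vanish; the outcome does not depend on the choice. *)
Definition coords (K : fieldType) (n : nat) (P : proj_space K n) :
  'rV[K]_n.+1 := vpick (val P).

Definition vanishes (K : fieldType) (n : nat) (p : {mpoly K[n.+1]})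
  (P : proj_space K n) : bool := p.@[coords P 0] == 0.

Definition singular_point (K : fieldType) (n : nat) (F : {mpoly K[n.+1]})
  (P : proj_space K n) : bool :=
  vanishes F P && [forall i, vanishes F^`M(i) P].

(* The local ring of P^n at P: the fractions a / b in K(x_0, ..., x_n) with
   a and b homogeneous of the same degree and b(P) <> 0. *)
Definition is_regular (K : fieldType) (n : nat) (P : proj_space K n)
  (u : {fraction {mpoly K[n.+1]}}) : bool :=
  `[< exists (d : nat) (a b : {mpoly K[n.+1]}),
      [/\ a \is d.-homog, b \is d.-homog, ~~ vanishes b P &
          u = FracField.tofrac a / FracField.tofrac b] >].

Fact is_regular_subring (K : fieldType) (n : nat) (P : proj_space K n) :
  subring_closed (is_regular P).
Proof.
have nz (b : {mpoly K[n.+1]}) : ~~ vanishes b P -> FracField.tofrac b != 0.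
  by apply: contraNneq => /eqP; rewrite tofrac_eq0 => /eqP->;
     rewrite /vanishes meval0.
have nvM (b b' : {mpoly K[n.+1]}) :
    ~~ vanishes b P -> ~~ vanishes b' P -> ~~ vanishes (b * b') P.
  by rewrite /vanishes mevalM mulf_eq0 negb_or => -> ->.
split.
- apply/asboolP; exists 0%N, 1, 1.
  by split; rewrite ?dhomog1 // ?divr1 ?tofrac1 ?invr1 ?mulr1 //;
     rewrite /vanishes meval1 oner_eq0.
- move=> u v /asboolP[d [a [b [ha hb nb ->]]]] /asboolP[e [a' [b' [ha' hb' nb' ->]]]].
  apply/asboolP; exists (d + e)%N, (a * b' - a' * b), (b * b'); split.
  + apply: rpredB; first exact: dhomogM.
    by rewrite addnC; apply: dhomogM.
  + exact: dhomogM.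
  + exact: nvM.
  + by rewrite -mulNr addf_div ?nz // tofracB !tofracM mulNr.
- move=> u v /asboolP[d [a [b [ha hb nb ->]]]] /asboolP[e [a' [b' [ha' hb' nb' ->]]]].
  apply/asboolP; exists (d + e)%N, (a * a'), (b * b'); split.
  + exact: dhomogM.
  + exact: dhomogM.
  + exact: nvM.
  + by rewrite !tofracM mulf_div.
Qed.

HB.instance Definition _ (K : fieldType) (n : nat) (P : proj_space K n) :=
  GRing.isSubringClosed.Build {fraction {mpoly K[n.+1]}} (is_regular P)
    (is_regular_subring P).

Definition local_ring (K : fieldType) (n : nat) (P : proj_space K n) :=
  {u : {fraction {mpoly K[n.+1]}} | is_regular P u}.

HB.instance Definition _ (K : fieldType) (n : nat) (P : proj_space K n) :=
  SubType.on (local_ring P).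
HB.instance Definition _ (K : fieldType) (n : nat) (P : proj_space K n) :=
  Choice.on (local_ring P).
HB.instance Definition _ (K : fieldType) (n : nat) (P : proj_space K n) :=
  [SubChoice_isSubComNzRing of local_ring P by <:].

(* The ideal of {F = 0} in the local ring of P^n at P, F being homogeneous of
   degree d: the fractions F c / b of degree 0 with b(P) <> 0. *)
Definition in_local_ideal (K : fieldType) (n d : nat) (F : {mpoly K[n.+1]})
  (P : proj_space K n) (u : local_ring P) : Prop :=
  exists (e : nat) (c b : {mpoly K[n.+1]}),
    [/\ c \is e.-homog, b \is (d + e).-homog, ~~ vanishes b P &
        val u = FracField.tofrac (F * c) / FracField.tofrac b].

Definition integrally_closed (A : idomainType) : Prop :=
  forall u : {fraction A}, integralOver (@FracField.tofrac A) u ->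
  exists a : A, u = FracField.tofrac a.

(* The local ring of X = {F = 0} at P is the quotient of local_ring P by the
   ideal of X, described here as a surjective morphism with that kernel; X is
   normal at P when this quotient is an integrally closed domain. *)
Definition normal_at (K : fieldType) (n d : nat) (F : {mpoly K[n.+1]})
  (P : proj_space K n) : Prop :=
  exists (A : idomainType) (pi : {rmorphism local_ring P -> A}),
    [/\ forall a : A, exists u, pi u = a,
        forall u, pi u = 0 <-> in_local_ideal d F u &
        integrally_closed A].

Definition hypersurface (K : fieldType) (n d : nat) (F : {mpoly K[n.+1]}) :
  Prop := F != 0 /\ F \is d.-homog.

Definition normal_hypersurface (K : fieldType) (n d : nat)
  (F : {mpoly K[n.+1]}) : Prop :=
  hypersurface d F /\
  forall P : proj_space K n, vanishes F P -> normal_at d F P.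

(* M is a linear change of coordinates x = x' M in which P has coordinates
   x' = (0, ..., 0, 1). *)
Definition centred (K : fieldType) (n : nat) (P : proj_space K n)
  (M : 'M[K]_n.+1) : Prop :=
  M \in unitmx /\ val P = <[row ord_max M]>%VS.

(* F in the coordinates x', i.e. F(x' M). *)
Definition change_coords (K : fieldType) (n : nat) (M : 'M[K]_n.+1)
  (F : {mpoly K[n.+1]}) : {mpoly K[n.+1]} :=
  F \mPo [tuple \sum_(j < n.+1) M j i *: 'X_j | i < n.+1].

(* Setting the last coordinate to 1. *)
Definition dehomogenize (K : fieldType) (n : nat) (p : {mpoly K[n.+1]}) :
  {mpoly K[n]} :=
  p \mPo [tuple if unlift ord_max i is Some j then 'X_j else 1 | i < n.+1].

Definition order_at_origin (K : fieldType) (n : nat) (f : {mpoly K[n]})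
  (m : nat) : Prop :=
  (exists2 t, t \in msupp f & mdeg t = m) /\
  (forall t, t \in msupp f -> (m <= mdeg t)%N).

Definition multiplicity_at (K : fieldType) (n : nat) (F : {mpoly K[n.+1]})
  (P : proj_space K n) (m : nat) : Prop :=
  exists M : 'M[K]_n.+1,
    centred P M /\ order_at_origin (dehomogenize (change_coords M F)) m.

Definition double_point (K : fieldType) (n : nat) (F : {mpoly K[n.+1]})
  (P : proj_space K n) : Prop := multiplicity_at F P 2.

(* F = z^2 Q(x) + z G(x) + B(x) in coordinates (x, z) centred at P;
   mwiden views a polynomial in x as a polynomial in (x, z). *)
Definition taylor_development (K : fieldType) (F : {mpoly K[4]})
  (P : proj_space K 3) (Q G B : {mpoly K[3]}) : Prop :=
  [/\ Q \is 2.-homog, Q != 0, G \is 3.-homog, B \is 4.-homog &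
      exists M : 'M[K]_4, centred P M /\
        change_coords M F =
          'X_ord_max ^+ 2 * mwiden Q + 'X_ord_max * mwiden G + mwiden B].

(* The projection X \ {P} -> P^2, (x, z) |-> x, is an inseparable double
   cover, i.e. G = 0. *)
Definition inseparable_projection (K : fieldType) (F : {mpoly K[4]})
  (P : proj_space K 3) : Prop :=
  exists Q B : {mpoly K[3]}, taylor_development F P Q 0 B.

Definition has_card (T : eqType) (S : pred T) (m : nat) : Prop :=
  exists s : seq T, [/\ uniq s, size s = m & s =i S].

(* Main.v *)
From Stdlib Require Import ZArith Ring_polynom.
From HB Require Import structures.
Require Import Defs.
From mathcomp Require Import all_boot all_order all_algebra separable.
From mathcomp Require Import boolp.
From mathcomp.zify Require Import ssrZ zify.
From mathcomp.algebra_tactics Require Import common.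
From mathcomp Require Import ring mpoly.

(** The bound.  Write F = z^2 Q + B in coordinates centred at P.  A linear
    change of x1, x2, x3 brings the conic Q to one of the three shapes
    x1 x2 + x3^2, x1 x2, x1^2 (normal_presentation_exists).  The z-derivative
    of F vanishes identically, and the other partial derivatives together with
    F = 0 determine z^2 at a singular point, so the singular points other than
    P are counted by their images in the plane.  Eliminating z^2 leaves two
    equations there: the derivative along x3, which with t = x2 / x1 and
    v = x3 / x1 reads v^2 b1(t) + b3(t) = 0 because a derivative along x3 has
    only even powers of x3, and a second one of the form u(t, v^2) +
    v w(t, v^2) = 0.  The first gives v^2 = b3 / b1; squaring the second and
    substituting yields a polynomial of degree at most 13 in t alone
    (coprime_cover).  Together with at most one point on the line x1 = 0 and
    with P itself this makes at most 15 points.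

    The count fails when the polynomials degenerate: b1 and b3 may have a
    common factor or vanish, or the eliminant may be zero.  Then either a
    direct count is even better, or the coefficients of F satisfy explicit
    relations under which X is not normal.  Non-normality is detected in three
    ways: F splits into factors with a common zero (not_product); F is a
    quadratic form in two linear forms u, v with quadratic coefficients, so
    that X is singular along a line where its branches separate
    (not_double_plane); or Q B = m^2 + k^2 d with a point off Q = 0 on k = 0
    (not_square_mod_square), where (z Q + m) / k is a square root of d,
    integral over the local ring, without being regular.

    The example.  Take Q = x1 x2 + x3^2 and B = x1 x3^3 + x2^3 x3 + x1^4.  Its
    singular points are P and the points (1 : s^2 : s^3 : z) with z^2 = s^7,
    for the thirteen roots s of the separable polynomial s^13 + s^9 + 1.

    Normality of the example is proved by a parametrization.  Since X is
    purely inseparable over the plane, its function field lies in that of the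
    plane with coordinates s_i = sqrt x_i: the substitution phi sends x_i to
    s_i^2 Q(s) and z to B(s), it kills F, and on forms its kernel is exactly
    the ideal of F (phi_kernel).  The local ring of X at a point is thereby the
    ring of the quotients phi a / phi b.  An element integral over it becomes,
    after multiplication by a form of even degree 2 D that does not vanish at
    the point, almost integral over the homogeneous coordinate ring, and it
    remains to show that such an element E is the image of a form
    (almost_integral_form).  As K[s] is completely integrally closed, E is a
    polynomial in s.  The second derivatives of Q B, namely s1^4 and
    (s2 + s3)^4, have no common factor, whence E = r^2 + t^2 Q B with
    polynomials r and t (squares_cofactor).  This settles the matter up to a
    power of Q in the denominator.  To remove that power one looks near the
    eight lines of X on the cone Q = 0, which lie over the roots of g(v) on the
    conic (v^2 : 1 : v): in the coordinates of psi both Q and B are divisible by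
    g, hence so are E, r and t to the powers that their degrees suggest, and a
    form divisible by such a power of g can be expanded in powers of B and Q
    with forms as coefficients (image_level). *)

Set Implicit Arguments.
Unset Strict Implicit.
Unset Printing Implicit Defensive.
Import GRing.Theory.
Import ring.Internals.
Local Open Scope ring_scope.

(** * Arithmetic in characteristic two *)

(** The reflexive decision procedure behind ring compares normal forms whose
    coefficients are integers; comparing these modulo 2 decides identities in
    rings where 2 = 0. *)
Definition eqb_mod2 (x y : Z) := Z.even (Z.sub x y).

Lemma morph_mod2 (R : comPzRingType) : 2%:R = 0 :> R ->
  ring_morph 0 1 +%R *%R (fun x y : R => x - y) -%R eq
    Z0 (Zpos xH) Z.add Z.mul Z.sub Z.opp eqb_mod2 (fun n : Z => (int_of_Z n)%:~R).
Proof.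
move=> two0; have := RZ R.
case=> m0 m1 mD mB mM mN _; split=> // x y /Z.even_spec[z xyE].
have -> : x = Z.add y (Z.mul (Zpos (xO xH)) z) by lia.
by rewrite (mD y (Z.mul (Zpos (xO xH)) z)) (mM (Zpos (xO xH)) z) (_ : (int_of_Z (Zpos (xO xH)))%:~R = 2%:R :> R) //
  two0 mul0r addr0.
Qed.

Lemma ring_correct_mod2 (R : ring.Internals.target_comRing)
    (two0 : 2%:R = 0 :> ring.Internals.target_comRingType R) (n : nat)
    (l : seq (ring.Internals.target_comRingType R))
    (lpe : seq (RExpr (ring.Internals.target_comRingType R) *
                RExpr (ring.Internals.target_comRingType R) *
                PExpr Z * PExpr Z))
    (re1 re2 : RExpr (ring.Internals.target_comRingType R))
    (pe1 pe2 : PExpr Z) :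
  (forall R_of_Z zero opp add sub one mul exp,
      Ring.Rnorm R_of_Z zero add opp sub one mul exp
        (@target_comRingMorph R) re1 ::
      Ring.Rnorm R_of_Z zero add opp sub one mul exp
        (@target_comRingMorph R) re2 ::
      Rnorm_list R_of_Z zero add opp sub one mul exp lpe =
      PEeval zero one add mul sub opp R_of_Z id exp l pe1 ::
      PEeval zero one add mul sub opp R_of_Z id exp l pe2 ::
      PEeval_list R_of_Z zero opp add sub one mul exp l lpe) ->
  (let norm2 := norm_subst Z0 (Zpos xH) Z.add Z.mul Z.sub Z.opp eqb_mod2
                  (triv_div Z0 (Zpos xH) eqb_mod2) n [::] in
   Ring_polynom.Peq eqb_mod2 (norm2 pe1) (norm2 pe2)) ->
  Reval re1 = Reval re2.
Proof.
case: R two0 l lpe re1 re2 => [|| R] //= two0 l lpe re1 re2.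
move=> /(_ (fun n => (int_of_Z n)%:~R) 0%R -%R +%R (fun x y => x - y)).
move=> /(_ 1%R *%R (fun x n => x ^+ nat_of_N n)) /=.
rewrite -!Ring.Rnorm_correct => -[-> -> _].
have RE := Eq_ext (@GRing.add R) *%R -%R.
have RZ2 := morph_mod2 two0.
exact: (Ring_polynom.ring_correct (Eqsth R) RE
  (Rth_ARth (Eqsth R) RE (RR R)) RZ2 (PN R)
  (triv_div_th (Eqsth R) RE (Rth_ARth (Eqsth R) RE (RR R)) RZ2) n l [::] pe1
  pe2 I).
Qed.

(** The first hypothesis given to ring is taken to be the equation 2 = 0, so that
    ring: h decides identities modulo 2. *)
Ltac ring_reflection_mod2 R VarMap Lpe RE1 RE2 PE1 PE2 LpeProofs :=
  exact (@ring_correct_mod2 R (proj1 LpeProofs) 100%N VarMap Lpe RE1 RE2 PE1 PE2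
    ltac:(reflexivity) ltac:(vm_compute; reflexivity)).

Ltac ring_reflection ::= fun Lem R VarMap Lpe RE1 RE2 PE1 PE2 LpeProofs =>
  first [ ring_reflection_mod2 R VarMap Lpe RE1 RE2 PE1 PE2 LpeProofs
        | ring_reflection_check Lem R VarMap Lpe RE1 RE2 PE1 PE2 LpeProofs ].

Section Char2.
Variables (R : nzRingType) (two0 : 2%:R = 0 :> R).

Lemma opp2 (x : R) : - x = x.
Proof.
by apply/eqP; rewrite eq_sym -subr_eq0 opprK -mulr2n -mulr_natl two0 mul0r.
Qed.

Lemma add2_eq0 (x y : R) : (x + y == 0) = (x == y).
Proof. by rewrite -{1}[y]opp2 subr_eq0. Qed.

Lemma two0_poly : 2%:R = 0 :> {poly R}.
Proof. by rewrite -polyC_natr two0 polyC0. Qed.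

Lemma two0_mpoly n : 2%:R = 0 :> {mpoly R[n]}.
Proof. by rewrite -mpolyC_nat two0 mpolyC0. Qed.
End Char2.

(** x^2 + y^2 = (x + y)^2. *)
Lemma sqr_inj2 (R : idomainType) : 2%:R = 0 :> R -> injective (fun x : R => x ^+ 2).
Proof.
move=> two0 x y /eqP; rewrite -add2_eq0 // => /eqP e.
apply/eqP; rewrite -add2_eq0 // -sqrf_eq0; apply/eqP.
rewrite -[RHS]e; ring: two0.
Qed.

Section Sqrt.
Variable K : closedFieldType.

Fact sqrt_exists (c : K) : exists x, x ^+ 2 == c.
Proof.
have [x] := @solve_monicpoly K 2 (fun i => if i is 0%N then c else 0) isT.
rewrite !big_ord_recl big_ord0 /= mulr1 mul0r !addr0 => <-; by exists x.
Qed.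

Definition sq (c : K) := xchoose (sqrt_exists c).

Lemma sqK c : sq c ^+ 2 = c.
Proof. exact: eqP (xchooseP (sqrt_exists c)). Qed.

Lemma root_list (p : {poly K}) (n : nat) : p != 0 -> (size p <= n.+1)%N ->
  exists2 L : seq K, (size L <= n)%N & forall t, p.[t] = 0 -> t \in L.
Proof.
move=> p0 sp; have [L pE] := closed_field_poly_normal p.
exists L.
  have := congr1 (fun q : {poly K} => size q) pE.
  by rewrite size_scale ?lead_coef_eq0 // size_prod_XsubC => e; move: sp; rewrite e.
move=> t /eqP; rewrite pE hornerZ mulf_eq0 lead_coef_eq0 (negbTE p0) /=.
by rewrite -/(root _ _) root_prod_XsubC.
Qed.

End Sqrt.

(** * Homogeneous polynomials and points *)

Section Homog.
Variables (R : comNzRingType) (n : nat).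
Implicit Types p q : {mpoly R[n]}.

Lemma homogM d e f p q : p \is d.-homog -> q \is e.-homog -> (d + e)%N = f ->
  p * q \is f.-homog.
Proof. by move=> hp hq <-; apply: dhomogM. Qed.

Lemma homogX d e k p : p \is d.-homog -> (d * k)%N = e -> p ^+ k \is e.-homog.
Proof. by move=> hp <-; apply: dhomogMn. Qed.

Lemma meval_homog d p (c : R) (v : 'I_n -> R) : p \is d.-homog ->
  p.@[fun i => c * v i] = c ^+ d * p.@[v].
Proof.
move=> /dhomogP hp; rewrite !mevalE mulr_sumr.
rewrite big_seq [RHS]big_seq; apply: eq_bigr => m /hp <-.
rewrite mulrCA; congr (_ * _).
under eq_bigr do rewrite exprMn.
by rewrite big_split /= -expr_sum mdegE.
Qed.

Lemma mevalXn (v : 'I_n -> R) p k : (p ^+ k).@[v] = p.@[v] ^+ k.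
Proof. exact: rmorphXn. Qed.

(** The derivative along a fixed vector; only such derivatives commute with
    linear changes of coordinates, which is how they will be used. *)
Definition ddir (w : 'I_n -> R) p : {mpoly R[n]} := \sum_i w i *: p^`M(i).

Lemma ddirD w p q : ddir w (p + q) = ddir w p + ddir w q.
Proof.
by rewrite /ddir -big_split /=; apply: eq_bigr => i _; rewrite mderivD scalerDr.
Qed.

Lemma ddirM w p q : ddir w (p * q) = ddir w p * q + p * ddir w q.
Proof.
rewrite /ddir mulr_suml mulr_sumr -big_split /=; apply: eq_bigr => i _.
by rewrite mderivM scalerDr scalerAl scalerAr.
Qed.

Lemma ddirZ w c p : ddir w (c *: p) = c *: ddir w p.
Proof.
rewrite /ddir scaler_sumr; apply: eq_bigr => i _.
by rewrite mderivZ !scalerA mulrC.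
Qed.

Lemma ddirC w c : ddir w c%:MP = 0.
Proof.
by rewrite /ddir big1 // => i _; rewrite -[c%:MP]mulr1 mderiv_mulC
  -[1]mpolyX0 mderivX mnm0E scale0r mulr0 scaler0.
Qed.

Lemma ddirX w p k : ddir w (p ^+ k) = k%:R *: (p ^+ k.-1 * ddir w p).
Proof.
elim: k => [|k IH]; first by rewrite expr0 scale0r -mpolyC1 ddirC.
rewrite exprS ddirM IH /= -scalerAr mulrA.
have -> : k%:R *: (p * p ^+ k.-1 * ddir w p) = k%:R *: (p ^+ k * ddir w p).
  by case: k {IH} => [|k]; rewrite ?scale0r //= -exprS.
by rewrite -[k.+1]add1n natrD scalerDl scale1r mulrC.
Qed.

Lemma ddirXi w i : ddir w 'X_i = (w i)%:MP.
Proof.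
rewrite /ddir (bigD1 i) //= big1 => [|j ji].
  rewrite addr0 mderivX mnm1E eqxx scale1r (_ : (_ - _)%MM = 0%MM).
    by rewrite mpolyX0 -mul_mpolyC mulr1.
  by apply/mnmP => k; rewrite mnmBE subnn mnm0E.
by rewrite mderivX mnm1E eq_sym (negbTE ji) scale0r scaler0.
Qed.

Lemma ddir_linear w p : p \is 1.-homog -> ddir w p = (p.@[w])%:MP.
Proof.
move=> /dhomogP hp; rewrite [in LHS](mpolyE p) mevalE [in RHS]raddf_sum /=.
have ddir_sum (s : seq 'X_{1..n}) F :
    ddir w (\sum_(m <- s) F m) = \sum_(m <- s) ddir w (F m).
  by apply: (big_morph _ (ddirD w)); rewrite -mpolyC0 ddirC.
rewrite ddir_sum big_seq [RHS]big_seq; apply: eq_bigr => m /hp /eqP/mdeg1P[i /eqP->].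
rewrite ddirZ ddirXi mpolyCM mul_mpolyC (bigD1 i) //= big1 => [|j ji].
  by rewrite mnm1E eqxx expr1 mulr1.
by rewrite mnm1E eq_sym (negbTE ji).
Qed.

End Homog.

Section Points.
Variables (K : fieldType) (n : nat).
Implicit Types (P : proj_space K n) (p : {mpoly K[n.+1]}).

Lemma coords_neq0 P : coords P != 0.
Proof.
case: P => L /= dL; rewrite /coords /= vpick0.
by apply: contraTneq dL => ->; rewrite dimv0.
Qed.

Lemma val_coords P : val P = <[coords P]>%VS.
Proof.
have := coords_neq0 P; case: P => L /= dL; rewrite /coords /= => v0.
apply/eqP; rewrite eq_sym eqEdim -memvE memv_pick /= dim_vline v0.
by rewrite (eqP dL).
Qed.

Lemma point_exists (v : 'rV[K]_n.+1) : v != 0 ->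
  exists P, exists2 c, c != 0 & coords P = c *: v.
Proof.
move=> v0; have dv : \dim <[v]>%VS == 1%N by rewrite dim_vline v0.
pose P : proj_space K n :=
  @exist {vspace 'rV[K]_n.+1} (fun L => \dim L == 1%N) <[v]>%VS dv.
exists P.
have : coords P \in <[v]>%VS by apply: memv_pick.
case/vlineP => c cE; exists c => //; apply: contra_neq (coords_neq0 P) => c0.
by rewrite cE c0 scale0r.
Qed.

Lemma eq_point P1 P2 c : c != 0 -> coords P1 = c *: coords P2 -> P1 = P2.
Proof.
move=> c0 e; apply/val_inj; rewrite !val_coords e.
apply/eqP; rewrite eqEsubv -!memvE; apply/andP; split.
  by apply/memvZ/memv_line.
by rewrite -[X in X \in _](scalerK c0) memvZ ?memv_line.
Qed.

Lemma vanishes_scale d p P (v : 'rV_n.+1) c : p \is d.-homog -> c != 0 ->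
  coords P = c *: v -> vanishes p P = (p.@[v 0] == 0).
Proof.
move=> hp c0 e; rewrite /vanishes e.
rewrite (_ : p.@[_] = p.@[fun i => c * v 0 i]).
  by rewrite (meval_homog _ _ hp) mulf_eq0 expf_eq0 (negbTE c0) andbF.
by apply: meval_eq => i; rewrite mxE.
Qed.

End Points.

Lemma tofrac_inj (R : idomainType) : injective (@FracField.tofrac R).
Proof. by move=> x y /eqP; rewrite tofrac_eq => /eqP. Qed.

Section Normal.
Variables (K : fieldType) (n d : nat) (F : {mpoly K[n.+1]}).
Variables (P : proj_space K n).
Hypothesis normP : normal_at d F P.
Local Notation tofrac := (@FracField.tofrac {mpoly K[n.+1]}).

(** Powers of this form serve as denominators, to turn forms into elements of
    the local ring. *)
Lemma nonvanishing_linear :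
  exists2 l : {mpoly K[n.+1]}, l \is 1.-homog & ~~ vanishes l P.
Proof.
have /rV0Pn[i ci] := coords_neq0 P.
exists 'X_i; first by rewrite dhomogX; apply/eqP; apply: mdeg1.
by rewrite /vanishes mevalXU.
Qed.

Lemma local_fraction e (a b : {mpoly K[n.+1]}) : a \is e.-homog ->
  b \is e.-homog -> ~~ vanishes b P ->
  exists u : local_ring P, val u = tofrac a / tofrac b.
Proof.
move=> ha hb nb.
have H : is_regular P (tofrac a / tofrac b) by apply/asboolP; exists e, a, b.
by exists (Sub _ H); rewrite SubK.
Qed.

Lemma nvanM p q : ~~ vanishes p P -> ~~ vanishes q P -> ~~ vanishes (p * q) P.
Proof. by rewrite /vanishes mevalM mulf_eq0 negb_or => -> ->. Qed.

Lemma nvanX p k : ~~ vanishes p P -> ~~ vanishes (p ^+ k) P.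
Proof. by rewrite /vanishes rmorphXn /=; apply: expf_neq0. Qed.

Lemma nvan_tofrac p : ~~ vanishes p P -> tofrac p != 0.
Proof.
by apply: contraNneq => /eqP; rewrite tofrac_eq0 => /eqP->; rewrite /vanishes meval0.
Qed.

Lemma frac_eq (a b a' b' : {mpoly K[n.+1]}) : ~~ vanishes b P -> ~~ vanishes b' P ->
  tofrac a / tofrac b = tofrac a' / tofrac b' -> a * b' = a' * b.
Proof.
move=> /nvan_tofrac nb /nvan_tofrac nb' /eqP; rewrite (eqr_div _ _ nb nb') => /eqP.
rewrite -(tofracM a b') -(tofracM a' b); exact: tofrac_inj.
Qed.

(** Membership of a fraction in the ideal of the hypersurface, stated without
    degrees: a factor that is a unit at P can be spared. *)
Lemma ideal_divides (u : local_ring P) a b : ~~ vanishes b P ->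
  val u = tofrac a / tofrac b -> in_local_ideal d F u ->
  exists S c, ~~ vanishes S P /\ S * a = F * c.
Proof.
move=> nb uE [e [c [b' [hc hb' nb']]]]; rewrite uE => /(frac_eq nb nb') E.
by exists b', (c * b); split=> //; rewrite mulrC E mulrA.
Qed.

Lemma quadratic_over_power (L : fieldType) (n' k b g t : L) (j c : nat) : t != 0 ->
  (n' / t ^+ (j + c)) ^+ 2 + b / t ^+ c * (n' / t ^+ (j + c)) * (k / t ^+ j) +
    g / t ^+ (2 * c) * (k / t ^+ j) ^+ 2 =
  (n' ^+ 2 + b * n' * k + g * k ^+ 2) / t ^+ (2 * (j + c)).
Proof.
move=> t0; rewrite !mul2n -!addnn !exprD.
have : t ^+ j != 0 by rewrite expf_neq0.
have : t ^+ c != 0 by rewrite expf_neq0.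
move: (t ^+ j) (t ^+ c) => x y x0 y0.
by field; rewrite x0 y0.
Qed.

Lemma quotient_root (L : fieldType) (x y z t : L) : y != 0 ->
  x ^+ 2 + z * x * y + t * y ^+ 2 = 0 -> (x / y) ^+ 2 + z * (x / y) + t = 0.
Proof.
move=> y0 e.
have -> : (x / y) ^+ 2 + z * (x / y) + t = (x ^+ 2 + z * x * y + t * y ^+ 2) / y ^+ 2.
  by field.
by rewrite e mul0r.
Qed.

Lemma sub_fractions (L : fieldType) (x y z t x' z' : L) :
  y != 0 -> t != 0 -> z' != 0 ->
  x / y - x' / z' * (z / t) = (x * (z' * t) - x' * z * y) / (y * (z' * t)).
Proof. by move=> y0 t0 z0; field; rewrite ?y0 ?t0 ?z0. Qed.

(** The quotient N / k is integral over the local ring of the hypersurface,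
    since it is a root of a monic quadratic polynomial; by normality it is an
    element al / S of that ring. *)
Lemma normal_quadratic i j e (N k beta gamma delta : {mpoly K[n.+1]}) :
  (j <= i)%N -> N \is i.-homog -> k \is j.-homog -> beta \is (i - j).-homog ->
  gamma \is (2 * (i - j)).-homog -> delta \is e.-homog -> (d + e = 2 * i)%N ->
  N ^+ 2 + beta * N * k + gamma * k ^+ 2 = F * delta ->
  exists S al c, ~~ vanishes S P /\ S * N = al * k + F * c.
Proof.
case: normP => A [pi [surj ker closed]] leba hN hk hb hg hd dE E.
have [l hl nl] := nonvanishing_linear.
have hlX m : l ^+ m \is m.-homog by apply: (homogX hl); rewrite mul1n.
have nlX m : ~~ vanishes (l ^+ m) P by apply: nvanX.
have [uN uNE] := local_fraction hN (hlX i) (nlX i).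
have [uk ukE] := local_fraction hk (hlX j) (nlX j).
have [ub ubE] := local_fraction hb (hlX _) (nlX (i - j)%N).
have [ug ugE] := local_fraction hg (hlX _) (nlX (2 * (i - j))%N).
have tl0 m : tofrac (l ^+ m) != 0 by apply: nvan_tofrac.
have piE : pi uN ^+ 2 + pi ub * pi uN * pi uk + pi ug * pi uk ^+ 2 = 0.
  rewrite -!(rmorphM, rmorphXn, rmorphD); apply/ker.
  exists e, delta, (l ^+ (2 * i)); split=> //; first by rewrite dE.
  rewrite -E !(rmorphM, rmorphXn, rmorphD) /= uNE ukE ubE ugE.
  rewrite !(rmorphM, rmorphXn) /=.
  have -> : i = (j + (i - j))%N by rewrite subnKC.
  move: (i - j)%N => c; have t0 : tofrac l != 0 by rewrite -[l]expr1.
  rewrite addKn; exact: quadratic_over_power.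
have [k0|k0] := eqVneq (pi uk) 0.
  have N0 : pi uN = 0.
    by move: piE; rewrite k0 expr0n /= !mulr0 !addr0 => /eqP; rewrite sqrf_eq0 => /eqP.
  have /ker/(ideal_divides (nlX i) uNE)[S [c [nS SE]]] := N0.
  by exists S, 0, c; rewrite mul0r add0r.
have tk0 : FracField.tofrac (pi uk) != 0 by rewrite tofrac_eq0.
have [|q qE] := closed (FracField.tofrac (pi uN) / FracField.tofrac (pi uk)).
  exists ('X^2 + (pi ub) *: 'X + (pi ug)%:P).
    rewrite monicE lead_coefDl ?size_polyC.
      rewrite lead_coefDl ?lead_coefXn // size_polyXn.
      by rewrite (leq_ltn_trans (size_scale_leq _ _)) ?size_polyX.
    rewrite size_polyDl size_polyXn.
      by case: (_ != 0).
    by rewrite (leq_ltn_trans (size_scale_leq _ _)) ?size_polyX.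
  rewrite rootE !rmorphD /= !hornerD map_polyXn hornerXn map_polyZ hornerZ.
  rewrite map_polyX hornerX map_polyC hornerC /=.
  apply/eqP/(quotient_root tk0).
  by rewrite -(tofracXn 2 (pi uN)) -(tofracXn 2 (pi uk)) -!tofracM -!tofracD piE tofrac0.
have [w qw] := surj q; have := valP w => /asboolP[f [al [be [hal hbe nbe wE]]]].
have : pi (uN - w * uk) = 0.
  apply/eqP; rewrite rmorphB rmorphM subr_eq0 qw -(inj_eq (@tofrac_inj _)).
  by rewrite rmorphM /= -qE divfK.
move/ker; have vE : val (uN - w * uk) =
    tofrac (N * (be * l ^+ j) - al * k * l ^+ i) / tofrac (l ^+ i * (be * l ^+ j)).
  rewrite rmorphB rmorphM /= uNE ukE wE.
  rewrite (tofracB, tofracM) !tofracM.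
  by apply: sub_fractions; rewrite ?tl0 ?nvan_tofrac.
move/(ideal_divides _ vE); case; first by rewrite !nvanM.
move=> S [c [nS SE]]; exists (S * (be * l ^+ j)), (S * al * l ^+ i), c; split.
  by rewrite !nvanM.
by rewrite -SE; ring.
Qed.

(** The local ring at a normal point is a domain, so one of two factors of F
    vanishes in it. *)
Lemma normal_product g h (G H : {mpoly K[n.+1]}) :
  G \is g.-homog -> H \is h.-homog -> (g + h)%N = d -> F = G * H ->
  exists S c, ~~ vanishes S P /\ (S * G = F * c \/ S * H = F * c).
Proof.
case: normP => A [pi [surj ker closed]] hG hH dE FE.
have [l hl nl] := nonvanishing_linear.
have hlX i : l ^+ i \is i.-homog by apply: (homogX hl); rewrite mul1n.
have nlX i : ~~ vanishes (l ^+ i) P by apply: nvanX.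
have [uG uGE] := local_fraction hG (hlX g) (nlX g).
have [uH uHE] := local_fraction hH (hlX h) (nlX h).
have /eqP : pi (uG * uH) = 0.
  apply/ker; exists 0%N, 1, (l ^+ d); split=> //; rewrite ?dhomog1 ?addn0 //.
  by rewrite rmorphM /= uGE uHE FE mulr1 -dE exprD !tofracM mulf_div.
rewrite rmorphM mulf_eq0 => /orP[] /eqP/ker.
  by move/(ideal_divides (nlX g) uGE) => [S [c [nS SE]]]; exists S, c; split; [|left].
by move/(ideal_divides (nlX h) uHE) => [S [c [nS SE]]]; exists S, c; split; [|right].
Qed.

End Normal.

(** * Forms in three coordinates *)

Lemma big_ord3 (T : Type) (idx : T) (op : Monoid.law idx) (f : 'I_3 -> T) :
  \big[op/idx]_(i < 3) f i = op (op (f 0%R) (f 1%R)) (f 2%:R).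
Proof.
rewrite !big_ord_recl big_ord0 Monoid.mulm1 Monoid.mulmA.
by congr (op (op (f _) (f _)) (f _)); apply: val_inj.
Qed.

Section Forms.
Variables (R : comNzRingType) (n : nat).
Implicit Types X : 3.-tuple {mpoly R[n]}.

(** Forms of degree d in the linear forms X, which need not be the coordinates
    of the ambient space. *)
Definition isform X (d : nat) (f : {mpoly R[n]}) :=
  exists2 p : {mpoly R[3]}, p \is d.-homog & f = p \mPo X.

Lemma isformD X d f g : isform X d f -> isform X d g -> isform X d (f + g).
Proof. by move=> [p hp ->] [q hq ->]; exists (p + q); rewrite ?rpredD ?rmorphD. Qed.

Lemma isformM X d e k f g : isform X d f -> isform X e g -> (d + e)%N = k ->
  isform X k (f * g).
Proof.
by move=> [p hp ->] [q hq ->] <-; exists (p * q); rewrite ?rmorphM ?dhomogM.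
Qed.

Lemma isformX X d e k f : isform X d f -> (d * e)%N = k -> isform X k (f ^+ e).
Proof. by move=> [p hp ->] <-; exists (p ^+ e); rewrite ?rmorphXn ?dhomogMn. Qed.

Lemma isformC X c : isform X 0 c%:MP.
Proof. by exists c%:MP; rewrite ?comp_mpolyC // -[c%:MP]mulr1 mul_mpolyC rpredZ ?dhomog1. Qed.

Lemma isform_coord X (i : 'I_3) : isform X 1 (tnth X i).
Proof.
exists 'X_i; first by rewrite dhomogX; apply/eqP/mdeg1.
by rewrite comp_mpolyXU (tnth_nth 0).
Qed.

Lemma comp_homogM e d m (k : nat) (p : {mpoly R[m]}) (l : m.-tuple {mpoly R[k]}) :
  (forall i, tnth l i \is e.-homog) -> p \is d.-homog -> p \mPo l \is (e * d).-homog.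
Proof.
move=> hl /dhomogP hp; rewrite comp_mpolyEX big_seq; apply: rpred_sum => t /hp dt.
apply: rpredZ; rewrite comp_mpolyX; move: dt; rewrite /= mdegE => <-.
rewrite big_distrr /=; elim/big_rec2: _ => [|i f g _ hf]; first exact: dhomog1.
by apply: dhomogM => //; apply: (homogX (hl i)).
Qed.

Lemma comp_homog d m (k : nat) (p : {mpoly R[m]}) (l : m.-tuple {mpoly R[k]}) :
  (forall i, tnth l i \is 1.-homog) -> p \is d.-homog -> p \mPo l \is d.-homog.
Proof. by move=> hl hp; have := comp_homogM hl hp; rewrite mul1n. Qed.

Lemma comp_mpolyA m k l (p : {mpoly R[m]}) (s : m.-tuple {mpoly R[k]})
    (t : k.-tuple {mpoly R[l]}) :
  (p \mPo s) \mPo t = p \mPo [tuple tnth s i \mPo t | i < m].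
Proof.
rewrite (comp_mpolyEX p s) (comp_mpolyEX p) raddf_sum /=; apply: eq_bigr => u _.
rewrite comp_mpolyZ !comp_mpolyX rmorph_prod; congr (_ *: _).
by apply: eq_bigr => i _; rewrite rmorphXn /= tnth_mktuple.
Qed.

Lemma isform_homog X d f : (forall i, tnth X i \is 1.-homog) -> isform X d f ->
  f \is d.-homog.
Proof. by move=> hX [p hp ->]; apply: comp_homog. Qed.

Lemma isform_change X Y d f : (forall i, isform Y 1 (tnth X i)) -> isform X d f ->
  isform Y d f.
Proof.
move=> hXY [p hp ->].
have [l0 hl0] : exists l0 : 'I_3 -> {mpoly R[3]}, forall i,
    l0 i \is 1.-homog /\ tnth X i = l0 i \mPo Y.
  have /fin_all_exists[l hl] i : exists l, l \is 1.-homog /\ tnth X i = l \mPo Y.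
    by have [l hl e] := hXY i; exists l.
  by exists l.
exists (p \mPo [tuple l0 i | i < 3]).
  by apply: comp_homog => // i; rewrite tnth_mktuple; case: (hl0 i).
rewrite comp_mpolyA; congr (_ \mPo _); apply: eq_from_tnth => i.
by rewrite !tnth_mktuple; case: (hl0 i).
Qed.

(** Along a direction in which all the linear forms X vanish, a form in X is
    constant. *)
Lemma ddir_form X d f w : (forall i, tnth X i \is 1.-homog) ->
  (forall i, (tnth X i).@[w] = 0) -> isform X d f -> ddir w f = 0.
Proof.
move=> hX wX [p _ ->].
have ddir_sum (s : seq 'X_{1..3}) G :
    ddir w (\sum_(t <- s) G t) = \sum_(t <- s) ddir w (G t).
  by apply: (big_morph _ (ddirD w)); rewrite -mpolyC0 ddirC.
rewrite comp_mpolyEX ddir_sum big1 // => t _; rewrite ddirZ comp_mpolyX.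
suff -> : ddir w (\prod_i tnth X i ^+ t i) = 0 by rewrite scaler0.
elim/big_ind: _ => [|x y hx hy|i _]; first by rewrite -mpolyC1 ddirC.
  by rewrite ddirM hx hy mulr0 mul0r addr0.
by rewrite ddirX ddir_linear // wX mpolyC0 mulr0 scaler0.
Qed.

Lemma isform_sum X d f : isform X d f -> exists c : nat -> nat -> R,
  f = \sum_(i < d.+1) \sum_(j < d.+1 | (i + j <= d)%N)
    (c i j)%:MP * tnth X 0 ^+ i * tnth X 1 ^+ j * tnth X 2%:R ^+ (d - i - j).
Proof.
move=> [p /dhomogP hp ->]; rewrite comp_mpolyEX big_seq.
elim/big_ind: _ => [|f1 f2 [c1 ->] [c2 ->]|t /hp dt].
- exists (fun _ _ => 0); rewrite big1 // => i _; rewrite big1 // => j _.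
  by rewrite mpolyC0 !mul0r.
- exists (fun i j => c1 i j + c2 i j); rewrite -big_split; apply: eq_bigr => i _.
  rewrite -big_split /=; apply: eq_bigr => j _.
  by rewrite mpolyCD !mulrDl.
exists (fun i j => if (i == t 0%R :> nat) && (j == t 1%R :> nat) then p@_t else 0).
have dE : (t 0%R + t 1%R + t 2%:R%R)%N = d.
  by move: dt; rewrite /= mdegE big_ord3.
have t0 : (t 0%R < d.+1)%N by rewrite ltnS -dE -addnA leq_addr.
have t1 : (t 1%R < d.+1)%N by rewrite ltnS -dE addnAC leq_addl.
rewrite (bigD1 (Ordinal t0)) //= (bigD1 (Ordinal t1)) /=; last first.
  by rewrite -dE leq_addr.
rewrite !eqxx /= big1 => [|j /andP[_ jt]]; last first.
  by rewrite (_ : (j == t 1%R :> nat) = false) ?mpolyC0 ?mul0r //; apply: negbTE jt.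
rewrite big1 => [|i it]; last first.
  rewrite big1 // => j _.
  by rewrite (_ : (i == t 0%R :> nat) = false) ?mpolyC0 ?mul0r //; apply: negbTE it.
rewrite !addr0 comp_mpolyX big_ord3 /= -!mulrA mul_mpolyC.
congr (_ *: (_ * (_ * _ ^+ _))).
by rewrite -dE -addnA addKn addKn.
Qed.

End Forms.

(** The fifteen coefficients are indexed by the exponents of x1 and x2, and
    the terms are grouped by powers of x3. *)
Definition quartic (R : nzSemiRingType) (c : nat -> nat -> R) (x1 x2 x3 : R) : R :=
  c 0 0 * x3 ^+ 4 + (c 1 0 * x1 + c 0 1 * x2) * x3 ^+ 3 +
  (c 2 0 * x1 ^+ 2 + c 1 1 * x1 * x2 + c 0 2 * x2 ^+ 2) * x3 ^+ 2 +
  (c 3 0 * x1 ^+ 3 + c 2 1 * x1 ^+ 2 * x2 + c 1 2 * x1 * x2 ^+ 2 +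
     c 0 3 * x2 ^+ 3) * x3 +
  (c 4 0 * x1 ^+ 4 + c 3 1 * x1 ^+ 3 * x2 + c 2 2 * x1 ^+ 2 * x2 ^+ 2 +
     c 1 3 * x1 * x2 ^+ 3 + c 0 4 * x2 ^+ 4).

Lemma quartic_morph (R S : nzSemiRingType) (f : {rmorphism R -> S}) c x1 x2 x3 :
  f (quartic c x1 x2 x3) = quartic (fun i j => f (c i j)) (f x1) (f x2) (f x3).
Proof. by rewrite /quartic !(rmorphD, rmorphM, rmorphXn). Qed.

Lemma mwiden_comp (R : comNzRingType) n k (p : {mpoly R[n]}) (L : n.+1.-tuple {mpoly R[k]}) :
  mwiden p \mPo L = p \mPo [tuple tnth L (widen_ord (leqnSn n) i) | i < n].
Proof.
rewrite [RHS]comp_mpolyEX {1}(mpolyE p) (big_morph _ (@mwidenD _ _) (@mwiden0 _ _)).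
rewrite raddf_sum /=; apply: eq_bigr => m _.
rewrite mwidenZ mwidenX !comp_mpolyZ !comp_mpolyX big_ord_recr /=.
rewrite mnmwiden_ordmax expr0 mulr1; congr (_ *: _); apply: eq_bigr => i _.
by rewrite mnmwiden_widen tnth_mktuple.
Qed.

Local Notation "f @* w" := (f.@[(w : 'rV_4) 0]) (at level 30).

Section Frames.
Variable K : fieldType.
Local Notation poly4 := {mpoly K[4]}.

Lemma tuple3P (P : poly4 -> Prop) x1 x2 x3 : P x1 -> P x2 -> P x3 ->
  forall i, P (tnth [tuple x1; x2; x3] i).
Proof.
by move=> h1 h2 h3 i; case: i => -[|[|[|]]] //= h; rewrite (tnth_nth 0).
Qed.

Lemma tnth3 (x1 x2 x3 : poly4) (X := [tuple x1; x2; x3]) :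
  (tnth X 0 = x1) * (tnth X 1 = x2) * (tnth X 2%:R = x3).
Proof. by rewrite !(tnth_nth 0). Qed.

Lemma meval_linear n (p : {mpoly K[n]}) v : p \is 1.-homog ->
  p.@[v] = \sum_j v j * p@_U_(j).
Proof.
move=> /dhomogP hp; rewrite [in LHS](mpolyE p) [in RHS](mpolyE p) raddf_sum /=.
under [RHS]eq_bigr do rewrite raddf_sum mulr_sumr /=.
rewrite exchange_big /= big_seq [RHS]big_seq.
apply: eq_bigr => m /hp /eqP/mdeg1P[i /eqP->].
rewrite mevalZ mevalXU (bigD1 i) //= big1 => [|j ji].
  by rewrite mcoeffZ mcoeffX eqxx mulr1 addr0 mulrC.
by rewrite mcoeffZ mcoeffXU eq_sym (negbTE ji) !mulr0.
Qed.

(** Linear forms X, Z that are coordinates of the space of dimension four,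
    expressed by their having no common zero. *)
Definition frame (X : 3.-tuple poly4) (Z : poly4) :=
  [/\ forall i, tnth X i \is 1.-homog, Z \is 1.-homog &
      forall w, (forall i, tnth X i @* w = 0) -> Z @* w = 0 -> w = 0].

Lemma frame_surj X Z : frame X Z -> forall x z,
  exists w, (forall i, tnth X i @* w = x i) /\ Z @* w = z.
Proof.
case=> hX hZ inj x z.
have sl (i : 'I_3) : split (lshift 1 i) = inl i by exact: (unsplitK (inl i)).
have sr (i : 'I_1) : split (rshift 3 i) = inr i by exact: (unsplitK (inr i)).
pose Y (i : 'I_(3 + 1)) := if split i is inl k then tnth X k else Z.
pose A : 'M[K]_4 := \matrix_(j, i) (Y i)@_U_(j).
have hY i : Y i \is 1.-homog by rewrite /Y; case: split.
have AE w i : (w *m A) 0 i = Y i @* w.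
  by rewrite meval_linear // mxE; apply: eq_bigr => j _; rewrite mxE.
have uA : A \in unitmx.
  rewrite -row_free_unit; apply/row_freeP; exists (pinvmx A).
  apply/eqP; rewrite -subr_eq0; apply/eqP/row_matrixP => k.
  rewrite row0; apply: inj => [i|].
    have := AE (row k (A *m pinvmx A - 1%:M)) (lshift 1 i).
    rewrite /Y sl => <-.
    by rewrite -row_mul mulmxBl mul1mx mulmxKpV ?subrr ?row0 ?mxE // submx_refl.
  have := AE (row k (A *m pinvmx A - 1%:M)) (rshift 3 0).
  rewrite /Y sr => <-.
  by rewrite -row_mul mulmxBl mul1mx mulmxKpV ?subrr ?row0 ?mxE // submx_refl.
pose y : 'rV[K]_4 := \row_i (if split (i : 'I_(3 + 1)) is inl k then x k else z).
exists (y *m invmx A); split=> [i|].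
  have := AE (y *m invmx A) (lshift 1 i).
  by rewrite mulmxKV // mxE /Y sl => <-.
have := AE (y *m invmx A) (rshift 3 0).
by rewrite mulmxKV // mxE /Y sr => <-.
Qed.

Lemma frame_comp_inj X Z : frame X Z ->
  injective (fun p : {mpoly K[3]} => p \mPo X).
Proof.
move=> fX; have [hX _ _] := fX.
have /fin_all_exists[w wE] (i : 'I_3) :
    exists w : 'rV[K]_4, forall k, tnth X k @* w = (i == k)%:R.
  by have [w [wE _]] := frame_surj fX (fun k => (i == k)%:R) 0; exists w.
pose W := [tuple \sum_(i < 3) w i 0 j *: ('X_i : {mpoly K[3]}) | j < 4].
apply: (can_inj (g := fun f => f \mPo W)) => p.
rewrite comp_mpolyA -[RHS]comp_mpoly_id; congr (_ \mPo _).
apply: eq_from_tnth => k; rewrite !tnth_mktuple.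
have /dhomogP hk := hX k.
transitivity (\sum_(i < 3) (tnth X k @* w i) *: ('X_i : {mpoly K[3]})).
  under [RHS]eq_bigr do rewrite mevalE scaler_suml.
  rewrite exchange_big /= comp_mpolyEX big_seq [RHS]big_seq.
  apply: eq_bigr => m /hk /eqP/mdeg1P[j /eqP->].
  rewrite comp_mpolyXU -tnth_nth tnth_mktuple scaler_sumr; apply: eq_bigr => i _.
  rewrite scalerA (bigD1 j) //= mnm1E eqxx expr1 big1 ?mulr1 // => l lj.
  by rewrite mnm1E eq_sym (negbTE lj).
rewrite (bigD1 k) //= wE eqxx scale1r big1 ?addr0 // => i ik.
by rewrite wE (negbTE ik) scale0r.
Qed.

Lemma frame_change X Y Z : frame X Z -> (forall i, tnth Y i \is 1.-homog) ->
  (forall i, isform Y 1 (tnth X i)) -> frame Y Z.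
Proof.
move=> [hX hZ inj] hY hXY; split=> // w wY wZ; apply: inj => // i.
have [p /dhomogP hp ->] := hXY i.
rewrite comp_mpoly_meval mevalE big_seq big1 // => m /hp /eqP/mdeg1P[j /eqP->].
by rewrite (bigD1 j) //= mnm1E eqxx wY mul0r mulr0.
Qed.

Lemma isform3 (Y1 Y2 Y3 : poly4) (Y := [tuple Y1; Y2; Y3]) :
  [/\ isform Y 1 Y1, isform Y 1 Y2 & isform Y 1 Y3].
Proof.
have := isform_coord Y; rewrite /Y => h.
by split; [have := h 0 | have := h 1 | have := h 2%:R]; rewrite (tnth_nth 0).
Qed.

Lemma form4_quartic (Y1 Y2 Y3 B : poly4) : isform [tuple Y1; Y2; Y3] 4 B ->
  exists c : nat -> nat -> K, B = quartic (fun i j => (c i j)%:MP) Y1 Y2 Y3.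
Proof.
case/isform_sum => c ->; exists c; rewrite !tnth3 /quartic.
under eq_bigr do rewrite big_mkcond.
by rewrite !(big_ord_recl, big_ord0) /= /bump /=; ring.
Qed.

Lemma form2_conic (Y1 Y2 Y3 Q : poly4) : isform [tuple Y1; Y2; Y3] 2 Q ->
  exists q1 q2 q3 q12 q13 q23 : K,
  Q = q1%:MP * Y1 ^+ 2 + q2%:MP * Y2 ^+ 2 + q3%:MP * Y3 ^+ 2 +
      q12%:MP * Y1 * Y2 + q13%:MP * Y1 * Y3 + q23%:MP * Y2 * Y3.
Proof.
case/isform_sum => c ->; rewrite !tnth3.
exists (c 2 0)%N, (c 0 2)%N, (c 0 0)%N, (c 1 1)%N, (c 1 0)%N, (c 0 1)%N.
under eq_bigr do rewrite big_mkcond.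
by rewrite !(big_ord_recl, big_ord0) /= /bump /=; ring.
Qed.

(** Coordinates centred at a point turn a Taylor development into an identity
    between polynomials in the original coordinates. *)
Lemma taylor_frame F P Q G B : taylor_development F P Q G B ->
  exists X Z, frame X Z /\
    F = Z ^+ 2 * (Q \mPo X) + Z * (G \mPo X) + (B \mPo X).
Proof.
case=> _ _ _ _ [M [[uM _] FE]].
pose L : 4.-tuple poly4 := [tuple \sum_(j < 4) (invmx M) j i *: 'X_j | i < 4].
have hL i : tnth L i \is 1.-homog.
  rewrite tnth_mktuple; apply: rpred_sum => j _; apply: rpredZ.
  by rewrite dhomogX; apply/eqP/mdeg1.
have LE i w : tnth L i @* w = (w *m invmx M) 0 i.
  rewrite tnth_mktuple raddf_sum /= mxE; apply: eq_bigr => j _.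
  by rewrite mevalZ mevalXU mulrC.
pose X := [tuple tnth L (widen_ord (leqnSn 3) i) | i < 3].
exists X, (tnth L ord_max); split.
  split=> [i||w wX wZ]; [|exact: hL|].
    have -> : tnth X i = tnth L (widen_ord (leqnSn 3) i) by rewrite tnth_mktuple.
    exact: hL.
  have : w *m invmx M = 0.
    apply/rowP => i; rewrite -LE [RHS]mxE.
    case: (unliftP ord_max i) => [j ->|->] //.
    have -> : lift ord_max j = widen_ord (leqnSn 3) j.
      by apply: val_inj; rewrite /= /bump leqNgt ltn_ord.
    by rewrite -(tnth_mktuple (fun i => tnth L (widen_ord (leqnSn 3) i))).
  by move/(congr1 (mulmx^~ M)); rewrite mulmxKV // mul0mx.
have -> : F = change_coords M F \mPo L.
  rewrite /change_coords comp_mpolyA -[LHS]comp_mpoly_id; congr (_ \mPo _).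
  apply: eq_from_tnth => i; rewrite !tnth_mktuple raddf_sum /=.
  transitivity (\sum_(k < 4) (invmx M *m M) k i *: 'X_k : poly4).
    rewrite mulVmx // (bigD1 i) //= mxE eqxx scale1r big1 ?addr0 // => k ki.
    by rewrite mxE (negbTE ki) scale0r.
  under [RHS]eq_bigr => j _ do
    rewrite comp_mpolyZ comp_mpolyXU -tnth_nth tnth_mktuple scaler_sumr.
  rewrite exchange_big /=; apply: eq_bigr => k _.
  by rewrite mxE scaler_suml; apply: eq_bigr => j _; rewrite scalerA mulrC.
rewrite FE !rmorphD /= [X in X + _ + _]rmorphM [X in X * _]rmorphXn /= rmorphM /=
  comp_mpolyXU -tnth_nth.
by rewrite !mwiden_comp.
Qed.

End Frames.

(** * Normal forms of the tangent cone *)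

Section NormalForm.
Variable K : closedFieldType.
Hypothesis two0 : 2%:R = 0 :> K.
Local Notation poly4 := {mpoly K[4]}.
Let mtwo0 : 2%:R = 0 :> poly4 := two0_mpoly two0 4.
Implicit Types (F Z Q : poly4).

(** The situation of an inseparable projection: F = Z^2 Q + B with B a quartic
    form in X1, X2, X3. *)
Definition cone_presentation F (X1 X2 X3 : poly4) Z Q :=
  frame [tuple X1; X2; X3] Z /\
  exists2 B, isform [tuple X1; X2; X3] 4 B & F = Z ^+ 2 * Q + B.

Lemma isform1 (X1 X2 X3 : poly4) (a b c : K) :
  isform [tuple X1; X2; X3] 1 (a%:MP * X1 + b%:MP * X2 + c%:MP * X3).
Proof.
have [h1 h2 h3] := isform3 X1 X2 X3.
by do !apply: isformD; apply: isformM (isformC _ _) _ (add0n 1).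
Qed.

Lemma presentation_change F (X1 X2 X3 : poly4) Z Q (Y1 Y2 Y3 : poly4) :
  isform [tuple X1; X2; X3] 1 Y1 -> isform [tuple X1; X2; X3] 1 Y2 ->
  isform [tuple X1; X2; X3] 1 Y3 ->
  isform [tuple Y1; Y2; Y3] 1 X1 -> isform [tuple Y1; Y2; Y3] 1 X2 ->
  isform [tuple Y1; Y2; Y3] 1 X3 ->
  cone_presentation F X1 X2 X3 Z Q -> cone_presentation F Y1 Y2 Y3 Z Q.
Proof.
move=> hY1 hY2 hY3 hX1 hX2 hX3 [fX [B hB FE]].
have hXY := tuple3P (P := isform [tuple Y1; Y2; Y3] 1) hX1 hX2 hX3.
have [hX _ _] := fX.
have hY := tuple3P (P := fun f => f \is 1.-homog)
  (isform_homog hX hY1) (isform_homog hX hY2) (isform_homog hX hY3).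
split; first exact: (frame_change fX hY hXY).
by exists B; [exact: (isform_change hXY hB) | exact: FE].
Qed.

(** One formula for the three normal forms of the tangent cone, so that the
    computations with them can be shared. *)
Definition normal_cone (k t e : K) (X1 X2 X3 : poly4) : poly4 :=
  k%:MP * X1 ^+ 2 + t%:MP * X1 * X2 + e%:MP * X3 ^+ 2.

Definition cone_type (k t e : K) :=
  [\/ [/\ k = 0, t = 1 & e = 1], [/\ k = 0, t = 1 & e = 0] |
      [/\ k = 1, t = 0 & e = 0]].

Definition normal_presentation F :=
  exists X1 X2 X3 Z k t e, cone_type k t e /\
    cone_presentation F X1 X2 X3 Z (normal_cone k t e X1 X2 X3).

(** Used to remove the square from x y + (A x + B y)^2, which after x -> x + r y
    has no y^2 left. *)
Lemma binary_root (A B : K) : exists r, A ^+ 2 * r ^+ 2 + r + B ^+ 2 = 0.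
Proof.
have [->|A0] := eqVneq A 0; first by exists (B ^+ 2); ring: two0.
have [r] := @solve_monicpoly K 2
  (fun i => if i is 0%N then (B / A) ^+ 2 else (A ^+ 2)^-1) isT.
rewrite !big_ord_recl big_ord0 /= expr0 expr1 mulr1 addr0 => rE.
exists r; rewrite rE mulrDr.
rewrite (_ : A ^+ 2 * (B / A) ^+ 2 = B ^+ 2); last by field.
rewrite mulrA divff ?mul1r; last by rewrite expf_neq0.
by ring: two0.
Qed.

Local Notation "c '·'" := (c%:MP) (at level 2, format "c '·'").

(** Completing Y1 Y2 leaves a sum of squares, which is the square of a linear
    form because every scalar has a square root.  If that form involves X3 it
    becomes the third coordinate; otherwise binary_root removes it. *)
Lemma normal_cross F (X1 X2 X3 : poly4) Z (q1 q2 q3 q12 q13 q23 : K) : q12 != 0 ->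
  cone_presentation F X1 X2 X3 Z
     (q1%:MP * X1 ^+ 2 + q2%:MP * X2 ^+ 2 + q3%:MP * X3 ^+ 2 +
      q12%:MP * X1 * X2 + q13%:MP * X1 * X3 + q23%:MP * X2 * X3) ->
  normal_presentation F.
Proof.
move=> n12.
set Q := (X in cone_presentation _ _ _ _ _ X) => pX.
pose u := q23 / q12; pose v := q13 / q12.
pose Y1 := q12%:MP * X1 + q23%:MP * X3; pose Y2 := X2 + v%:MP * X3.
have C1 (c : K) : (c%:MP : poly4) * (c^-1)%:MP = (c != 0)%:R%:MP.
  by rewrite -mpolyCM; have [->|/divff->] := eqVneq; rewrite ?mul0r.
pose A := sq q1 / q12; pose B := sq q2.
pose C := sq (q1 * u ^+ 2 + q2 * v ^+ 2 + q3 + q12 * u * v).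
have pY : cone_presentation F Y1 Y2 X3 Z
    (Y1 * Y2 + (A%:MP * Y1 + B%:MP * Y2 + C%:MP * X3) ^+ 2).
  have [h1 h2 h3] := isform3 X1 X2 X3; have [h1' h2' h3'] := isform3 Y1 Y2 X3.
  rewrite (_ : _ + _ ^+ 2 = Q).
    apply: (presentation_change _ _ h3 _ _ h3' pX).
    - by rewrite /Y1 -[X in X + _]addr0 -(mul0r X2) -mpolyC0; apply: isform1.
    - have -> : Y2 = 0%:MP * X1 + 1%:MP * X2 + v%:MP * X3 by rewrite /Y2; ring.
      exact: isform1.
    - have -> : X1 = (q12^-1)%:MP * Y1 + 0%:MP * Y2 + u%:MP * X3.
        rewrite /Y1 /u !mpolyCM; have := C1 q12; rewrite n12 mpolyC1 => e.
        have -> : (q12^-1)%:MP * (q12%:MP * X1 + q23%:MP * X3) =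
           q12%:MP * (q12^-1)%:MP * X1 + (q12^-1)%:MP * q23%:MP * X3 by ring.
        by rewrite e; ring: mtwo0.
      exact: isform1.
    - have -> : X2 = 0%:MP * Y1 + 1%:MP * Y2 + v%:MP * X3 by rewrite /Y2; ring: mtwo0.
      exact: isform1.
  rewrite /Q.
  have -> : (A%:MP * Y1 + B%:MP * Y2 + C%:MP * X3) ^+ 2 =
     (A ^+ 2)%:MP * Y1 ^+ 2 + (B ^+ 2)%:MP * Y2 ^+ 2 + (C ^+ 2)%:MP * X3 ^+ 2.
    by ring: mtwo0.
  rewrite /A /B /C exprMn !sqK /Y1 /Y2 /u /v.
  rewrite !(mpolyCM, mpolyCD, rmorphXn, rmorphM) /= ?exprVn ?rmorphXn /=.
  have := C1 q12; rewrite n12 mpolyC1; move: (q12^-1)%:MP => i /= e.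
  set q := q12%:MP.
  transitivity (q1%:MP * (q * i) ^+ 2 * X1 ^+ 2 + q2%:MP * X2 ^+ 2 +
    q3%:MP * X3 ^+ 2 + q * X1 * X2 + (q * i) * q13%:MP * X1 * X3 +
    q23%:MP * X2 * X3 + (q * i + 1) * (q23%:MP * q13%:MP * i) * X3 ^+ 2).
    by ring: mtwo0.
  by rewrite e; ring: mtwo0.
have [C0|C0] := eqVneq C 0; last first.
  pose Y3 := A%:MP * Y1 + B%:MP * Y2 + C%:MP * X3.
  exists Y1, Y2, Y3, Z, 0, 1, 1; split; first by constructor 1.
  rewrite /normal_cone (_ : _ + _ = Y1 * Y2 + Y3 ^+ 2); last by ring.
  have [h1 h2 h3] := isform3 Y1 Y2 X3; have [h1' h2' h3'] := isform3 Y1 Y2 Y3.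
  apply: (presentation_change h1 h2 _ h1' h2' _ pY); first exact: isform1.
  have -> : X3 = (C^-1 * A)%:MP * Y1 + (C^-1 * B)%:MP * Y2 + (C^-1)%:MP * Y3.
    transitivity ((C^-1 * C)%:MP * X3); first by rewrite mulVf // mpolyC1 mul1r.
    by rewrite /Y3; ring: mtwo0.
  exact: isform1.
have [r rE] := binary_root A B.
pose Y1' := Y1 + r%:MP * Y2; pose Y2' := (A ^+ 2)%:MP * Y1' + Y2.
exists Y1', Y2', X3, Z, 0, 1, 0; split; first by constructor 2.
rewrite /normal_cone (_ : _ + _ = Y1 * Y2 + (A%:MP * Y1 + B%:MP * Y2 + C%:MP * X3) ^+ 2).
  have [h1 h2 h3] := isform3 Y1 Y2 X3; have [h1' h2' h3'] := isform3 Y1' Y2' X3.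
  have Y2E : Y2 = (A ^+ 2)%:MP * Y1' + 1%:MP * Y2' + 0%:MP * X3.
    by rewrite /Y2'; ring: mtwo0.
  apply: (presentation_change _ _ h3 _ _ h3' pY).
  - have -> : Y1' = 1%:MP * Y1 + r%:MP * Y2 + 0%:MP * X3 by rewrite /Y1'; ring.
    exact: isform1.
  - have -> : Y2' = (A ^+ 2)%:MP * Y1 + (A ^+ 2 * r + 1)%:MP * Y2 + 0%:MP * X3.
      by rewrite /Y2' /Y1'; ring.
    exact: isform1.
  - have -> : Y1 = (1 + r * A ^+ 2)%:MP * Y1' + r%:MP * Y2' + 0%:MP * X3.
      by rewrite /Y2' /Y1'; ring: mtwo0.
    exact: isform1.
  - by rewrite Y2E; exact: isform1.
rewrite C0 /Y2' /Y1'.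
transitivity (Y1 * Y2 + (A%:MP * Y1 + B%:MP * Y2) ^+ 2 +
   (A ^+ 2 * r ^+ 2 + r + B ^+ 2)%:MP * Y2 ^+ 2).
  by ring: mtwo0.
by rewrite rE mpolyC0; ring.
Qed.

Lemma normal_square F (X1 X2 X3 : poly4) Z (q1 q2 q3 : K) : q1 != 0 ->
  cone_presentation F X1 X2 X3 Z
    ((q1%:MP * X1 + q2%:MP * X2 + q3%:MP * X3) ^+ 2) ->
  normal_presentation F.
Proof.
move=> n1 pX; pose Y1 := q1%:MP * X1 + q2%:MP * X2 + q3%:MP * X3.
exists Y1, X2, X3, Z, 1, 0, 0; split; first by constructor 3.
rewrite /normal_cone (_ : _ + _ = Y1 ^+ 2); last by ring.
have [h1 h2 h3] := isform3 X1 X2 X3; have [h1' h2' h3'] := isform3 Y1 X2 X3.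
apply: (presentation_change _ h2 h3 _ h2' h3' pX); first exact: isform1.
have -> : X1 = (q1^-1)%:MP * Y1 + (q1^-1 * q2)%:MP * X2 + (q1^-1 * q3)%:MP * X3.
  transitivity ((q1^-1 * q1)%:MP * X1); first by rewrite mulVf // mpolyC1 mul1r.
  by rewrite /Y1; ring: mtwo0.
exact: isform1.
Qed.

Lemma presentation_swap12 F (X1 X2 X3 : poly4) Z Q :
  cone_presentation F X1 X2 X3 Z Q -> cone_presentation F X2 X1 X3 Z Q.
Proof.
have [h1 h2 h3] := isform3 X1 X2 X3; have [h1' h2' h3'] := isform3 X2 X1 X3.
exact: (presentation_change h2 h1 h3 h2' h1' h3').
Qed.

Lemma presentation_swap23 F (X1 X2 X3 : poly4) Z Q :
  cone_presentation F X1 X2 X3 Z Q -> cone_presentation F X1 X3 X2 Z Q.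
Proof.
have [h1 h2 h3] := isform3 X1 X2 X3; have [h1' h2' h3'] := isform3 X1 X3 X2.
exact: (presentation_change h1 h3 h2 h1' h3' h2').
Qed.

(** Either some mixed product occurs in Q, and a permutation of the
    coordinates brings normal_cross to bear, or Q is a sum of squares, hence
    the square of a linear form. *)
Lemma normal_presentation_exists F P :
  inseparable_projection F P -> normal_presentation F.
Proof.
case=> Q [B T]; have [X [Z [fX FE]]] := taylor_frame T.
have [hQ nQ _ hB _] := T.
move: FE; rewrite comp_mpoly0 mulr0 addr0 => FE.
have XE : X = [tuple tnth X 0; tnth X 1; tnth X 2%:R].
  apply: eq_from_tnth => -[[|[|[|]]] //= h]; rewrite [RHS](tnth_nth 0) /=;
    by congr (tnth X _); apply: val_inj.
move: fX FE; rewrite XE; move: (tnth X 0) (tnth X 1) (tnth X 2%:R) => X1 X2 X3 fX FE.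
have pX : cone_presentation F X1 X2 X3 Z (Q \mPo [tuple X1; X2; X3]).
  by split=> //; exists (B \mPo [tuple X1; X2; X3]) => //; exists B.
have Q0 : Q \mPo [tuple X1; X2; X3] != 0.
  apply: contraNneq nQ => e; apply/eqP; apply: (frame_comp_inj fX).
  by rewrite /= e comp_mpoly0.
have [q1 [q2 [q3 [q12 [q13 [q23 QE]]]]]] :
  exists q1 q2 q3 q12 q13 q23 : K, Q \mPo [tuple X1; X2; X3] =
      q1%:MP * X1 ^+ 2 + q2%:MP * X2 ^+ 2 + q3%:MP * X3 ^+ 2 +
      q12%:MP * X1 * X2 + q13%:MP * X1 * X3 + q23%:MP * X2 * X3.
  by apply: form2_conic; exists Q.
rewrite {}QE in pX Q0; set Q' : poly4 := (X in cone_presentation _ _ _ _ _ X) in pX.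
rewrite -/Q' in Q0.
have [n12|n12] := eqVneq q12 0; last by apply: normal_cross n12 pX.
have [n13|n13] := eqVneq q13 0; last first.
  apply: (@normal_cross F X1 X3 X2 Z q1 q3 q2 q13 q12 q23 n13).
  apply: presentation_swap23.
  by rewrite [X in cone_presentation _ _ _ _ _ X](_ : _ = Q'); [exact: pX | rewrite /Q'; ring].
have [n23|n23] := eqVneq q23 0; last first.
  apply: (@normal_cross F X2 X3 X1 Z q2 q3 q1 q23 q12 q13 n23).
  apply: presentation_swap23; apply: presentation_swap12.
  by rewrite [X in cone_presentation _ _ _ _ _ X](_ : _ = Q'); [exact: pX | rewrite /Q'; ring].
have QE2 : Q' =
    ((sq q1)%:MP * X1 + (sq q2)%:MP * X2 + (sq q3)%:MP * X3) ^+ 2.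
  rewrite /Q' n12 n13 n23 -{1}(sqK q1) -{1}(sqK q2) -{1}(sqK q3).
  by ring: mtwo0.
rewrite {}QE2 in pX Q0; set L := (X in cone_presentation _ _ _ _ _ (X ^+ 2)) in pX.
rewrite -/L in Q0.
have [s1|s1] := eqVneq (sq q1) 0; last exact: (@normal_square F X1 X2 X3 Z (sq q1) (sq q2) (sq q3) s1 pX).
have [s2|s2] := eqVneq (sq q2) 0; last first.
  apply: (@normal_square F X2 X1 X3 Z (sq q2) (sq q1) (sq q3) s2).
  apply: presentation_swap12.
  by rewrite [X in cone_presentation _ _ _ _ _ X](_ : _ = L ^+ 2); [exact: pX | rewrite /L; ring].
have [s3|s3] := eqVneq (sq q3) 0; last first.
  apply: (@normal_square F X3 X1 X2 Z (sq q3) (sq q1) (sq q2) s3).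
  apply: presentation_swap12; apply: presentation_swap23.
  by rewrite [X in cone_presentation _ _ _ _ _ X](_ : _ = L ^+ 2); [exact: pX | rewrite /L; ring].
by move: Q0; rewrite /L s1 s2 s3 !mul0r !addr0 expr0n /= eqxx.
Qed.

End NormalForm.

(** * Non-normal quartics *)

Section Criteria.
Variable K : fieldType.
Hypothesis two0 : 2%:R = 0 :> K.
Local Notation poly4 := {mpoly K[4]}.
Let mtwo0 : 2%:R = 0 :> poly4 := two0_mpoly two0 4.
Variables (F : poly4) (normF : normal_hypersurface 4 F).

Let F0 : F != 0. Proof. by case: normF => -[]. Qed.
Let hF : F \is 4.-homog. Proof. by case: normF => -[]. Qed.

Lemma normal_at_point w : w != 0 -> F @* w = 0 ->
  exists P, normal_at 4 F P /\ forall d (p : poly4), p \is d.-homog ->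
    vanishes p P = (p @* w == 0).
Proof.
move=> w0 Fw; have [P [c c0 cP]] := point_exists w0; exists P.
have vP d (p : poly4) : p \is d.-homog -> vanishes p P = (p @* w == 0).
  by move=> hp; apply: (vanishes_scale hp c0 cP).
by split=> //; case: normF => _; apply; rewrite (vP _ _ hF) Fw.
Qed.

(** If S G = F c with S(w) <> 0, then S = H c vanishes at w; and likewise with
    G and H exchanged. *)
Lemma not_product (G H : poly4) g h w : G \is g.-homog -> H \is h.-homog ->
  (g + h)%N = 4 -> F = G * H -> w != 0 -> G @* w = 0 -> H @* w = 0 -> False.
Proof.
move=> hG hH gh FE w0 Gw Hw.
have Fw : F @* w = 0 by rewrite FE mevalM Gw mul0r.
have [P [nP vP]] := normal_at_point w0 Fw.
have [S [c [nS SE]]] := normal_product nP hG hH gh FE.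
have GH0 : G * H != 0 by rewrite -FE.
have [G0 H0] : G != 0 /\ H != 0 by apply/andP; rewrite -negb_or -mulf_eq0.
have GP : vanishes G P by rewrite (vP _ _ hG) Gw.
have HP : vanishes H P by rewrite (vP _ _ hH) Hw.
case: SE => SE; move/negP: nS; apply.
  have -> : S = H * c.
    by apply: (mulIf G0); rewrite SE FE; ring.
  by move: HP; rewrite /vanishes mevalM => /eqP->; rewrite mul0r.
have -> : S = G * c.
  by apply: (mulIf H0); rewrite SE FE; ring.
by move: GP; rewrite /vanishes mevalM => /eqP->; rewrite mul0r.
Qed.

(** Differentiating a relation at a common zero leaves only the derivatives of
    the vanishing terms. *)
Lemma ddir_relation (P : proj_space K 3) v (S N al k c : poly4) :
  S * N = al * k + F * c -> vanishes N P -> vanishes k P -> vanishes F P ->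
  vanishes (S * ddir v N) P = vanishes (al * ddir v k + c * ddir v F) P.
Proof.
move=> E /eqP NP /eqP kP /eqP FP; have := congr1 (ddir v) E.
rewrite ddirD !ddirM => /(congr1 (meval (coords P 0))).
rewrite !mevalD !mevalM NP kP FP !mulr0 !mul0r !add0r addr0 => e.
by rewrite /vanishes mevalD !mevalM e [(c.@[_]) * _]mulrC.
Qed.

(** The quotient al u / v is a root of T^2 + be T + al ga, hence regular at w
    if X is normal; but the derivative along e of the relation that expresses
    this, taken at w where X is singular, gives al(w) = 0. *)
Lemma not_double_plane (u v al be ga : poly4) w e :
  u \is 1.-homog -> v \is 1.-homog ->
  al \is 2.-homog -> be \is 2.-homog -> ga \is 2.-homog ->
  F = al * u ^+ 2 + be * u * v + ga * v ^+ 2 ->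
  w != 0 -> u @* w = 0 -> v @* w = 0 -> al @* w != 0 ->
  u @* e = 1 -> v @* e = 0 -> False.
Proof.
move=> hu hv hal hbe hga FE w0 uw vw alw ue ve.
have Fw : F @* w = 0.
  by rewrite FE !(mevalXn, mevalD, mevalM) uw vw !(expr0n, mulr0, mul0r, addr0).
have [P [nP vP]] := normal_at_point w0 Fw.
have hN : al * u \is 3.-homog by apply: (homogM hal hu).
have hg : al * ga \is (2 * (3 - 1)).-homog by apply: (homogM hal hga).
have rel : (al * u) ^+ 2 + be * (al * u) * v + al * ga * v ^+ 2 = F * al.
  by rewrite FE; ring.
have [S [a [c [nS SE]]]] :=
  @normal_quadratic K 3 4 F P nP 3 1 2 _ _ _ _ _ isT hN hv hbe hg hal erefl rel.
have uP : vanishes u P by rewrite (vP _ _ hu) uw.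
have vP' : vanishes v P by rewrite (vP _ _ hv) vw.
have FP : vanishes F P by rewrite (vP _ _ hF) Fw.
have auP : vanishes (al * u) P.
  by rewrite /vanishes mevalM (eqP uP) mulr0.
have := ddir_relation (e 0) SE auP vP' FP.
rewrite FE !(ddirX, ddirD, ddirM) !(ddir_linear _ hu, ddir_linear _ hv) ue ve.
rewrite /vanishes !(mevalXn, mevalD, mevalM, mevalZ) (eqP uP) (eqP vP').
rewrite !mevalC !(expr0n, mulr0, mul0r, addr0, add0r, mulr1) /= eqxx.
rewrite mulf_eq0 (negbTE (nS : S.@[coords P 0] != 0)) /=.
by move=> alP; move: alw; rewrite -(vP _ _ hal) /vanishes alP.
Qed.

Variables (X1 X2 X3 Z : poly4).
Local Notation X := [tuple X1; X2; X3].
Hypothesis fX : frame X Z.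

Lemma frame_point x1 x2 x3 z :
  exists w, [/\ X1 @* w = x1, X2 @* w = x2, X3 @* w = x3 & Z @* w = z].
Proof.
have [w [wX wZ]] := frame_surj fX (tnth [tuple x1; x2; x3]) z.
exists w; split=> //; first by have := wX 0; rewrite !(tnth_nth 0).
  by have := wX 1; rewrite !(tnth_nth 0).
by have := wX 2%:R; rewrite !(tnth_nth 0).
Qed.

Lemma isform_eval d f w w' : isform X d f ->
  X1 @* w = X1 @* w' -> X2 @* w = X2 @* w' -> X3 @* w = X3 @* w' ->
  f @* w = f @* w'.
Proof.
move=> [p _ ->] e1 e2 e3; rewrite !comp_mpoly_meval; apply: meval_eq.
exact: (tuple3P (P := fun f => f @* w = f @* w')).
Qed.

(** The quotient (Z Q + m) / k is a square root of c in characteristic two, so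
    it is regular wherever X is normal.  At the point over w where Z Q + m
    vanishes, differentiating along the direction of the centre, which F, m, k
    do not see, yields Q(w) = 0. *)
Lemma not_square_mod_square (Q B m k c : poly4) (j : nat) w :
  isform X 2 Q -> isform X 3 m -> isform X j k -> isform X (2 * (3 - j)) c ->
  (j <= 3)%N -> F = Z ^+ 2 * Q + B -> Q * B = m ^+ 2 + k ^+ 2 * c ->
  k @* w = 0 -> Q @* w != 0 -> False.
Proof.
move=> fQ fm fk fc j3 FE QB kw0 Qw0.
(* The last coordinate of w' is chosen so that Z Q + m vanishes. *)
have [w' [w1 w2 w3 wZ]] :=
  frame_point (X1 @* w) (X2 @* w) (X3 @* w) (m @* w / Q @* w).
have [hX hZ _] := fX.
have kw : k @* w' = 0 by rewrite (isform_eval fk w1 w2 w3).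
have Qw : Q @* w' != 0 by rewrite (isform_eval fQ w1 w2 w3).
have mw : m @* w' = m @* w by rewrite (isform_eval fm w1 w2 w3).
have Qww : Q @* w' = Q @* w by rewrite (isform_eval fQ w1 w2 w3).
have hQ := isform_homog hX fQ; have hm := isform_homog hX fm.
have hk := isform_homog hX fk; have hc := isform_homog hX fc.
have [N NE] : exists N, N = Z * Q + m by exists (Z * Q + m).
have hN : N \is 3.-homog by rewrite NE; apply: rpredD => //; apply: (homogM hZ hQ).
have Nw : N @* w' = 0.
  rewrite NE mevalD mevalM wZ mw Qww divfK //.
  by apply/eqP; rewrite add2_eq0.
have rel : N ^+ 2 + 0 * N * k + c * k ^+ 2 = F * Q.
  transitivity (Z ^+ 2 * Q ^+ 2 + (m ^+ 2 + k ^+ 2 * c)).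
    by rewrite NE; ring: mtwo0.
  by rewrite -QB FE; ring: mtwo0.
have w0 : w' != 0.
  apply: contraNneq Qw => ->; rewrite -[0 : 'rV_4](scale0r 0).
  have [p /dhomogP hp ->] := fQ; rewrite comp_mpoly_meval.
  rewrite mevalE big_seq big1 // => t /hp /= dt.
  have [i ti] : exists i, t i != 0%N.
    apply/existsP; apply: contraT; rewrite negb_exists => /forallP t0.
    move: dt; rewrite mdegE big1 // => i _; apply/eqP; by have := t0 i; rewrite negbK.
  rewrite (bigD1 i) //= (_ : (tnth X i).@[_] = 0) ?expr0n ?(negbTE ti) ?mul0r ?mulr0 //.
  by rewrite (meval_linear _ (hX i)) big1 // => l _; rewrite !mxE mul0r mul0r.
have Fw : F @* w' = 0.
  have := congr1 (fun f => f @* w') rel; rewrite !(mevalXn, mevalD, mevalM) Nw kw.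
  rewrite !(expr0n, mulr0, mul0r, addr0, add0r) /= => /esym/eqP.
  by rewrite mulf_eq0 (negbTE Qw) orbF => /eqP.
have [P [nP vP]] := normal_at_point w0 Fw.
have h0 : (0 : poly4) \is (3 - j).-homog by rewrite rpred0.
have [S [a [d [nS SE]]]] :=
  @normal_quadratic K 3 4 F P nP 3 j 2 _ _ _ _ _ j3 hN hk h0 hc hQ erefl rel.
have kP : vanishes k P by rewrite (vP _ _ hk) kw.
have NP : vanishes N P by rewrite (vP _ _ hN) Nw.
have FP : vanishes F P by rewrite (vP _ _ hF) Fw.
have [v [v1 v2 v3 vZ]] := frame_point 0 0 0 1.
have v0 : forall i, (tnth X i).@[v 0] = 0.
  exact: (tuple3P (P := fun f => f @* v = 0)).
have B4 : ddir (v 0) (Q * B) = 0.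
  rewrite QB ddirD ddirX ddirM ddirX (ddir_form hX v0 fm) (ddir_form hX v0 fk).
  by rewrite (ddir_form hX v0 fc) !(mulr0, scaler0, mul0r, addr0).
have Q0 : Q != 0 by apply: contraNneq Qw => ->; rewrite meval0.
have B0 : ddir (v 0) B = 0.
  apply: (mulfI Q0); rewrite mulr0.
  by move: B4; rewrite ddirM (ddir_form hX v0 fQ) mul0r add0r.
have := ddir_relation (v 0) SE NP kP FP.
have -> : ddir (v 0) F = 0.
  rewrite FE ddirD [X in X + _]ddirM B0 ddirX (ddir_form hX v0 fQ) mulr0 !addr0.
  by rewrite -mul_mpolyC two0 mpolyC0 !mul0r.
rewrite (ddir_form hX v0 fk) NE ddirD ddirM (ddir_linear _ hZ) vZ.
rewrite (ddir_form hX v0 fQ) (ddir_form hX v0 fm) !(mulr0, addr0) mpolyC1 mul1r.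
rewrite /vanishes meval0 eqxx mevalM mulf_eq0 (negbTE (nS : S.@[coords P 0] != 0)) /=.
by move/negP: Qw => Qw QP; apply: Qw; rewrite -(vP _ _ hQ) /vanishes QP.
Qed.

End Criteria.

(** * Solving the elimination equations *)

Section Degrees.
Variable R : idomainType.
Implicit Types p q : {poly R}.

(** A bound on the degree that also holds for the zero polynomial. *)
Definition degle n p := (size p <= n.+1)%N.

Lemma degleW m n p : degle m p -> (m <= n)%N -> degle n p.
Proof. by move=> hp mn; apply: leq_trans hp _. Qed.

Lemma degleD m n p q : degle m p -> degle n q -> degle (maxn m n) (p + q).
Proof.
move=> hp hq; apply: leq_trans (size_polyD _ _) _.
by rewrite geq_max -maxnSS (leq_trans hp) ?leq_maxl // (leq_trans hq) ?leq_maxr.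
Qed.

Lemma degleM m n p q : degle m p -> degle n q -> degle (m + n) (p * q).
Proof.
move=> hp hq; apply: leq_trans (size_polyMleq _ _) _.
by have := leq_add hp hq; rewrite addnS addSn; case: (_ + _)%N.
Qed.

Lemma degleX m n p : degle m p -> degle (m * n) (p ^+ n).
Proof.
move=> hp; elim: n => [|n IH]; first by rewrite expr0 /degle size_poly1.
by rewrite mulnS exprS; apply: degleM.
Qed.

Lemma degleC c : degle 0 c%:P.
Proof. exact: size_polyC_leq1. Qed.

Lemma degle_var : degle 1 ('X : {poly R}).
Proof. by rewrite /degle size_polyX. Qed.

End Degrees.

Ltac degle_rec := lazymatch goal with
  | h : is_true (degle _ ?x) |- is_true (degle _ ?x) => exact h
  | |- is_true (degle _ (_ + _)) => eapply degleD; degle_rec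
  | |- is_true (degle _ (_ ^+ _)) => eapply degleX; degle_rec
  | |- is_true (degle _ (_ * _)) => eapply degleM; degle_rec
  | |- is_true (degle _ (_%:P)) => exact: degleC
  | |- is_true (degle _ 'X) => exact: degle_var
  end.
Ltac degle_auto := eapply degleW; [degle_rec | by []].

Section Counting.
Variable K : closedFieldType.
Hypothesis two0 : 2%:R = 0 :> K.
Let ptwo0 : 2%:R = 0 :> {poly K} := two0_poly two0.
Variables kap tau eps b0 a0 a1 e0 e1 e2 d0 d1 d2 d3 c0 c1 c2 c3 c4 : K.

(** With x = (1, t, v): the derivative of B along x3. *)
Definition polar_eq (t v : K) :=
  v ^+ 2 * (a0 + a1 * t) + (d0 + d1 * t + d2 * t ^+ 2 + d3 * t ^+ 3).

(** With x = (1, t, v): Q B_2 + Q_2 B up to multiples of the polar equation,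
    that is, the elimination of z^2 from F = 0 and from the derivative of F
    along x2. *)
Definition gradient_eq (t v : K) :=
  (kap + tau * t + eps * v ^+ 2) *
    (v ^+ 2 * e1 + c1 + c3 * t ^+ 2 + v * (v ^+ 2 * a1 + d1 + d3 * t ^+ 2)) +
  tau * (v ^+ 4 * b0 + v ^+ 2 * (e0 + e1 * t + e2 * t ^+ 2) +
         (c0 + c1 * t + c2 * t ^+ 2 + c3 * t ^+ 3 + c4 * t ^+ 4)).

(** The resultant of a0 + a1 t and d0 + d1 t + d2 t^2 + d3 t^3. *)
Definition binary_resultant := d0 * a1 ^+ 3 + d1 * a0 * a1 ^+ 2 + d2 * a0 ^+ 2 * a1 +
  d3 * a0 ^+ 3.

Local Notation "[p x ]" := (x%:P : {poly K}) (format "[p  x ]").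
Let b1 := [p a0] + [p a1] * 'X.
Let b3 := [p d0] + [p d1] * 'X + [p d2] * 'X ^+ 2 + [p d3] * 'X ^+ 3.
Let b2 := [p e0] + [p e1] * 'X + [p e2] * 'X ^+ 2.
Let b4 := [p c0] + [p c1] * 'X + [p c2] * 'X ^+ 2 + [p c3] * 'X ^+ 3 + [p c4] * 'X ^+ 4.
Let W := [p a1 * d0 + a0 * d1] + [p a1 * d2 + a0 * d3] * 'X ^+ 2.
Let Qb := ([p kap] + [p tau] * 'X) * b1 + [p eps] * b3.
Let U := Qb * ([p e1] * b3 + ([p c1] + [p c3] * 'X ^+ 2) * b1) +
  [p tau] * ([p b0] * b3 ^+ 2 + b3 * b1 * b2 + b4 * b1 ^+ 2).
Let V := Qb * W.
Let R := b1 * U ^+ 2 + b3 * V ^+ 2.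

Let degR : degle 13 R.
Proof. by rewrite /R /V /U /Qb /W /b1 /b2 /b3 /b4; degle_auto. Qed.

Lemma deriv_sqr (p : {poly K}) : (p ^+ 2)^`() = 0.
Proof. by rewrite expr2 derivM mulrC -mulr2n -mulr_natl ptwo0 mul0r. Qed.

Let derivb1b3 : (b1 * b3)^`() = W.
Proof.
rewrite /b1 /b3 /W !(derivM, derivD, derivC, derivX, derivXn).
by rewrite /=; ring: ptwo0.
Qed.

Lemma cubic_eq0 (x y z u : K) : [p x] + [p y] * 'X + [p z] * 'X ^+ 2 +
  [p u] * 'X ^+ 3 = 0 -> [/\ x = 0, y = 0, z = 0 & u = 0].
Proof.
move/polyP => P; have := (P 0%N, P 1%N, P 2%N, P 3%N).
rewrite !(coefD, coefCM, coefC, coefX, coefXn, coef0) /=.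
by rewrite !(mulr0, mulr1, addr0, add0r) => -[[[-> ->] ->] ->].
Qed.

(** If the eliminant R is zero then b1 b3 V^2 is a square; its derivative
    W V^2 vanishes, and V = Qb W, so Qb or W is zero.  Either one makes the
    resultant vanish. *)
Lemma coprime_neq0 : cone_type kap tau eps -> binary_resultant != 0 -> R != 0.
Proof.
move=> ck; apply: contraNneq => R0.
have E : (b1 * U) ^+ 2 = b1 * b3 * V ^+ 2.
  have : b1 * R = 0 by rewrite R0 mulr0.
  rewrite /R => e; rewrite -[RHS]addr0 -e; ring: ptwo0.
have V0 : V = 0.
  have := congr1 (@deriv K) E; rewrite deriv_sqr derivM deriv_sqr mulr0 addr0 derivb1b3.
  move/esym/eqP; rewrite mulf_eq0 sqrf_eq0 => /orP[/eqP e|/eqP//].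
  by rewrite /V e mulr0.
apply/eqP; move/eqP: V0; rewrite /V mulf_eq0 => /orP[] /eqP e.
  have [|E0 E1 E2 E3] := @cubic_eq0 (kap * a0 + eps * d0)
    (kap * a1 + tau * a0 + eps * d1) (tau * a1 + eps * d2) (eps * d3).
    by rewrite -e /Qb /b1 /b3; ring.
  have [[k0 t1 ep]|[k0 t1 ep]|[k1 t0 ep]] := ck;
    move: E0 E1 E2 E3; rewrite /binary_resultant ?k0 ?k1 ?t0 ?t1 ep
      !(mul0r, mul1r, add0r, addr0).
  - move=> -> /eqP; rewrite add2_eq0 // => /eqP <- /eqP; rewrite add2_eq0 // => /eqP <- ->.
    by ring: two0.
  - by move=> _ -> -> _; ring.
  - by move=> -> -> _ _; ring.
have [|E0 E1 E2 E3] := @cubic_eq0 (a1 * d0 + a0 * d1) 0 (a1 * d2 + a0 * d3) 0.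
  by rewrite -e /W polyC0; ring.
transitivity (a1 ^+ 2 * (a1 * d0 + a0 * d1) + a0 ^+ 2 * (a1 * d2 + a0 * d3)).
  by rewrite /binary_resultant; ring.
by rewrite E0 E2 !mulr0 addr0.
Qed.

(** Substituting v^2 = b3 / b1 into the second equation and clearing
    denominators gives U + v V = 0, whose square is, up to the factor b1, a
    polynomial R of degree at most 13 in t alone. *)
Lemma coprime_cover : cone_type kap tau eps -> binary_resultant != 0 -> exists2 L : seq (K * K),
  (size L <= 13)%N & forall t v, polar_eq t v = 0 -> gradient_eq t v = 0 -> (t, v) \in L.
Proof.
move=> ck res; have [L sL LP] := root_list (coprime_neq0 ck res) degR.
exists [seq (t, sq (b3.[t] / b1.[t])) | t <- L]; first by rewrite size_map.
move=> t v f0 g0.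
have b1t : b1.[t] = a0 + a1 * t by rewrite /b1 !hornerE.
have b3t : b3.[t] = d0 + d1 * t + d2 * t ^+ 2 + d3 * t ^+ 3 by rewrite /b3 !hornerE.
have f1 : v ^+ 2 * b1.[t] = b3.[t].
  by apply/eqP; rewrite -add2_eq0 // b1t b3t; apply/eqP.
have b1n : b1.[t] != 0.
  apply: contra_neq res => b1t0; move: f1; rewrite b1t0 mulr0 => b3t0.
  rewrite b1t in b1t0; rewrite b3t in b3t0.
  have a0E : a0 = a1 * t by apply/eqP; rewrite -add2_eq0 // b1t0.
  transitivity (a1 ^+ 3 * (d0 + d1 * t + d2 * t ^+ 2 + d3 * t ^+ 3)).
    by rewrite /binary_resultant a0E; ring.
  by rewrite -b3t0 mulr0.
have v2 : v ^+ 2 = b3.[t] / b1.[t] by rewrite -f1 mulfK.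
have -> : v = sq (b3.[t] / b1.[t]) by apply: (sqr_inj2 two0); rewrite sqK.
apply: map_f; apply: LP.
set A := a0 + a1 * t in b1t; set D := d0 + d1 * t + d2 * t ^+ 2 + d3 * t ^+ 3 in b3t.
have f2 : D = v ^+ 2 * A by rewrite -b3t -b1t f1.
have horners := (hornerD, hornerM, horner_exp, hornerC, hornerX).
have Qbt : Qb.[t] = A * (kap + tau * t + eps * v ^+ 2).
  transitivity ((kap + tau * t) * A + eps * D); last by rewrite f2; ring.
  by rewrite /Qb /b1 /b3 !horners.
have Ut : U.[t] = Qb.[t] * (e1 * D + (c1 + c3 * t ^+ 2) * A) +
    tau * (b0 * D ^+ 2 + D * A * (e0 + e1 * t + e2 * t ^+ 2) +
    (c0 + c1 * t + c2 * t ^+ 2 + c3 * t ^+ 3 + c4 * t ^+ 4) * A ^+ 2).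
  by rewrite /U /b1 /b3 /b2 /b4 !horners.
have Vt : V.[t] = Qb.[t] * (a1 * D + A * (d1 + d3 * t ^+ 2)).
  by rewrite /V /W !horners /A /D; ring: two0.
have UV : U.[t] + v * V.[t] = 0.
  transitivity (A ^+ 2 * gradient_eq t v); last by rewrite g0 mulr0.
  rewrite Ut Vt Qbt f2 /gradient_eq; ring: two0.
have -> : R.[t] = b1.[t] * U.[t] ^+ 2 + b3.[t] * V.[t] ^+ 2.
  by rewrite -!horner_exp -!hornerM -hornerD.
rewrite b1t b3t f2.
transitivity (A * (U.[t] + v * V.[t]) ^+ 2); first by ring: two0.
by rewrite UV expr0n mulr0.
Qed.

Lemma common_factor : binary_resultant = 0 -> (a0 != 0) || (a1 != 0) ->
  exists q0 q1 q2, [/\ d0 = a0 * q0, d1 = a0 * q1 + a1 * q0,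
    d2 = a0 * q2 + a1 * q1 & d3 = a1 * q2].
Proof.
move=> res; have [A1|A1 _] := eqVneq a1 0.
  rewrite orbF => A0; exists (d0 / a0), (d1 / a0), (d2 / a0).
  rewrite A1 !mul0r !addr0 ![a0 * _]mulrC !divfK //; split=> //.
  apply: (mulIf (expf_neq0 3 A0)); rewrite mul0r -[RHS]res /binary_resultant A1; ring.
pose q2 := d3 / a1; pose q1 := (d2 + a0 * q2) / a1; pose q0 := (d1 + a0 * q1) / a1.
have E2 : a1 * q2 = d3 by rewrite /q2; field.
have E1 : a1 * q1 = d2 + a0 * q2 by rewrite mulrC divfK.
have E0 : a1 * q0 = d1 + a0 * q1 by rewrite mulrC divfK.
exists q0, q1, q2; rewrite E0 E1 E2; split=> //; last 2 first.
- by ring: two0.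
- by ring: two0.
apply: (mulfI (expf_neq0 3 A1)); apply/eqP; rewrite -add2_eq0 //; apply/eqP.
transitivity (binary_resultant + a0 * a1 ^+ 2 * (a1 * q0 + (d1 + a0 * q1)) +
  a0 ^+ 2 * a1 * (a1 * q1 + (d2 + a0 * q2)) + a0 ^+ 3 * (a1 * q2 + d3)).
  by rewrite /binary_resultant; ring: two0.
by rewrite res E0 E1 E2; ring: two0.
Qed.

Lemma quartic_eq0 (x y z u s : K) : [p x] + [p y] * 'X + [p z] * 'X ^+ 2 +
  [p u] * 'X ^+ 3 + [p s] * 'X ^+ 4 = 0 -> [/\ x = 0, y = 0, z = 0, u = 0 & s = 0].
Proof.
move/polyP => P; have := (P 0%N, P 1%N, P 2%N, P 3%N, P 4).
rewrite !(coefD, coefCM, coefC, coefX, coefXn, coef0) /=.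
by rewrite !(mulr0, mulr1, addr0, add0r) => -[[[[-> ->] ->] ->] ->].
Qed.

Section CommonFactor.
Variables q0 q1 q2 : K.
Hypotheses (D0 : d0 = a0 * q0) (D1 : d1 = a0 * q1 + a1 * q0)
  (D2 : d2 = a0 * q2 + a1 * q1) (D3 : d3 = a1 * q2).
Let q := [p q0] + [p q1] * 'X + [p q2] * 'X ^+ 2.
Let Qq := [p kap] + [p tau] * 'X + [p eps] * q.
Let Uq := Qq * ([p e1] * q + ([p c1] + [p c3] * 'X ^+ 2)) +
  [p tau] * ([p b0] * q ^+ 2 + q * b2 + b4).
Let Vq := Qq * b1 * [p q1].
Let Rq := Uq ^+ 2 + q * Vq ^+ 2.

Let degRq : degle 8 Rq.
Proof. by rewrite /Rq /Uq /Vq /Qq /q /b1 /b2 /b4; degle_auto. Qed.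

(** When b3 = b1 q, the points with b1 <> 0 satisfy v^2 = q(t), which leads to
    an eliminant of degree at most 8.  If it is zero, its derivative shows
    that q has no linear term or that Q vanishes on v^2 = q; the last two
    alternatives record what this means for the coefficients. *)
Lemma common_cover : cone_type kap tau eps -> (a0 != 0) || (a1 != 0) ->
  [\/ exists2 L : seq (K * K), (size L <= 8)%N & forall t v, polar_eq t v = 0 ->
        gradient_eq t v = 0 -> a0 + a1 * t != 0 -> (t, v) \in L,
      [/\ q1 = 0,
        (kap + eps * q0) * (e1 * q0 + c1) + tau * (b0 * q0 ^+ 2 + e0 * q0 + c0) = 0,
        (kap + eps * q0) * (e1 * q2 + c3) + tau * (e0 * q2 + e2 * q0 + c2) +
          eps * q2 * (e1 * q0 + c1) = 0 &
        tau * (b0 * q2 ^+ 2 + e2 * q2 + c4) + eps * q2 * (e1 * q2 + c3) = 0] |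
      [/\ kap = 0, tau = 1 & eps = 1] /\ [/\ q0 = 0, q1 = 1 & q2 = 0] /\
      [/\ c0 = 0, c1 = e0, c2 = b0 + e1, c3 = e2 & c4 = 0]].
Proof.
move=> ck a01; have [R0|R0] := eqVneq Rq 0; last first.
  have [L sL LP] := root_list R0 degRq.
  constructor 1; exists [seq (t, sq q.[t]) | t <- L]; first by rewrite size_map.
  move=> t v f0 g0 At; set A := a0 + a1 * t in At.
  have horners := (hornerD, hornerM, horner_exp, hornerC, hornerX).
  have qt : q.[t] = q0 + q1 * t + q2 * t ^+ 2 by rewrite /q !horners.
  have v2 : v ^+ 2 = q.[t].
    apply: (mulfI At); apply/eqP; rewrite -add2_eq0 // -f0 qt /polar_eq D0 D1 D2 D3 /A.
    by apply/eqP; ring.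
  have -> : v = sq q.[t] by apply: (sqr_inj2 two0); rewrite sqK.
  apply: map_f; apply: LP.
  have -> : Rq.[t] = Uq.[t] ^+ 2 + q.[t] * Vq.[t] ^+ 2.
    by rewrite -!horner_exp -!hornerM -hornerD.
  have Qt : Qq.[t] = kap + tau * t + eps * v ^+ 2.
    by rewrite v2 qt /Qq /q !horners.
  have Ut : Uq.[t] = (kap + tau * t + eps * v ^+ 2) * (e1 * v ^+ 2 + (c1 + c3 * t ^+ 2)) +
      tau * (b0 * v ^+ 4 + v ^+ 2 * (e0 + e1 * t + e2 * t ^+ 2) +
      (c0 + c1 * t + c2 * t ^+ 2 + c3 * t ^+ 3 + c4 * t ^+ 4)).
    rewrite (exprM v 2 2) v2 qt /Uq /Qq /q /b2 /b4 !horners; ring.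
  have Vt : Vq.[t] = (kap + tau * t + eps * v ^+ 2) * A * q1.
    by rewrite v2 qt /Vq /Qq /q /b1 !horners.
  rewrite -v2; transitivity ((Uq.[t] + v * Vq.[t]) ^+ 2); first by ring: two0.
  have -> : Uq.[t] + v * Vq.[t] = gradient_eq t v.
    rewrite Ut Vt /gradient_eq D1 D3 /A.
    transitivity ((kap + tau * t + eps * v ^+ 2) * (v ^+ 2 * e1 + c1 + c3 * t ^+ 2 +
      v * (a1 * (q0 + q1 * t + q2 * t ^+ 2) + (a0 * q1 + a1 * q0 + a1 * q2 * t ^+ 2))) +
      tau * (v ^+ 4 * b0 + v ^+ 2 * (e0 + e1 * t + e2 * t ^+ 2) +
         (c0 + c1 * t + c2 * t ^+ 2 + c3 * t ^+ 3 + c4 * t ^+ 4))).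
      by ring: two0.
    by rewrite -qt -v2; ring.
  by rewrite g0 expr0n.
have dq : q^`() = [p q1].
  by rewrite /q !(derivM, derivD, derivC, derivX, derivXn) /=; ring: ptwo0.
have b1n : b1 != 0.
  apply: contraTneq a01 => e; have [|-> -> _ _] := @cubic_eq0 a0 a1 0 0.
    by rewrite -e /b1 polyC0; ring.
  by rewrite eqxx.
have V0 : Vq = 0.
  have := congr1 (@deriv K) R0; rewrite /Rq derivD deriv_sqr derivM deriv_sqr dq deriv0.
  rewrite mulr0 addr0 add0r => /eqP; rewrite mulf_eq0 sqrf_eq0 => /orP[/eqP e|/eqP//].
  by rewrite /Vq e mulr0.
have U0 : Uq = 0.
  by move: R0; rewrite /Rq V0 expr0n /= mulr0 addr0 => /eqP; rewrite sqrf_eq0 => /eqP.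
move/eqP: V0; rewrite /Vq !mulf_eq0 (negbTE b1n) orbF => /orP[/eqP Q0|].
  have [|k0 t1 z2 _] := @cubic_eq0 (kap + eps * q0) (tau + eps * q1) (eps * q2) 0.
    by rewrite -Q0 /Qq /q polyC0; ring.
  case: ck => -[k t ep]; move: k0 t1 z2; rewrite k t ep.
  - rewrite add0r !mul1r => Z0 /eqP; rewrite add2_eq0 // => /eqP Z1 Z2.
    constructor 3; do 2!split=> //.
    have [|C0 C1 C2 C3 C4] := @quartic_eq0 c0 (c1 + e0) (c2 + (b0 + e1)) (c3 + e2) c4.
      rewrite -U0 /Uq Q0 mul0r t /q Z0 -Z1 Z2 /b2 /b4; ring.
    by move: C1 C2 C3 => /eqP; rewrite add2_eq0 // => /eqP -> /eqP; rewrite add2_eq0 // => /eqP -> /eqP; rewrite add2_eq0 // => /eqP ->.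
  - by rewrite !mul0r !addr0 => _ /eqP; rewrite oner_eq0.
  - by rewrite !mul0r !addr0 => /eqP; rewrite oner_eq0.
rewrite polyC_eq0 => /eqP Z1; constructor 2.
set h1 := _ + _; set h3 := (X in [/\ _, _, X = 0 & _]); set h5 := (X in [/\ _, _, _ & X = 0]).
have [|H1 _ H3 _ H5] := @quartic_eq0 h1 0 h3 0 h5; last by [].
by rewrite -U0 /Uq /Qq /q /b2 /b4 /h1 /h3 /h5 Z1; ring: ptwo0.
Qed.

End CommonFactor.

(** The second equation on the line x2 = t x1, for a t where the first one is
    satisfied by every v. *)
Definition line_poly (t : K) := let s := kap + tau * t in
  let g := c1 + c3 * t ^+ 2 in let h := d1 + d3 * t ^+ 2 in
  [p s * g + tau * (c0 + c1 * t + c2 * t ^+ 2 + c3 * t ^+ 3 + c4 * t ^+ 4)] +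
  [p s * h] * 'X +
  [p s * e1 + eps * g + tau * (e0 + e1 * t + e2 * t ^+ 2)] * 'X ^+ 2 +
  [p s * a1 + eps * h] * 'X ^+ 3 + [p eps * e1 + tau * b0] * 'X ^+ 4 +
  [p eps * a1] * 'X ^+ 5.

Lemma line_polyE t v : (line_poly t).[v] = gradient_eq t v.
Proof.
by rewrite /line_poly !(hornerD, hornerM, horner_exp, hornerC, hornerX) /gradient_eq; ring.
Qed.

Lemma quintic_eq0 (x y z u s r : K) : [p x] + [p y] * 'X + [p z] * 'X ^+ 2 +
  [p u] * 'X ^+ 3 + [p s] * 'X ^+ 4 + [p r] * 'X ^+ 5 = 0 ->
  [/\ x = 0, y = 0, z = 0 & [/\ u = 0, s = 0 & r = 0]].
Proof.
move/polyP => P; have := (P 0%N, P 1%N, P 2%N, P 3%N, P 4, P 5).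
rewrite !(coefD, coefCM, coefC, coefX, coefXn, coef0) /=.
by rewrite !(mulr0, mulr1, addr0, add0r) => -[[[[[-> ->] ->] ->] ->] ->].
Qed.

Lemma line_cover t : line_poly t != 0 -> exists2 L : seq K,
  (size L <= if a1 == 0%R then 4 else 5)%N &
  forall v, gradient_eq t v = 0 -> v \in L.
Proof.
move=> n0; have [|L sL LP] := @root_list _ (line_poly t) (if a1 == 0 then 4 else 5) n0.
  case: eqP => [a10|_]; last by rewrite -/(degle 5 _) /line_poly; degle_auto.
  by rewrite -/(degle 4 _) /line_poly a10 !mulr0 !polyC0 !mul0r !addr0; degle_auto.
by exists L => // v; rewrite -line_polyE; apply: LP.
Qed.

(** The analogue of the second equation at the points (0 : 1 : v). *)
Definition infinity_eq (v : K) :=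
  eps * v ^+ 2 * (v ^+ 2 * e1 + c3 + v * (v ^+ 2 * a0 + d2)) +
  (v ^+ 4 * b0 + v ^+ 2 * e2 + c4).

Definition infinity_poly :=
  [p c4] + [p 0] * 'X + [p eps * c3 + e2] * 'X ^+ 2 + [p eps * d2] * 'X ^+ 3 +
  [p eps * e1 + b0] * 'X ^+ 4 + [p eps * a0] * 'X ^+ 5.

Lemma infinity_cover : infinity_poly != 0 -> exists2 L : seq K,
  (size L <= if a0 == 0%R then 4 else 5)%N &
  forall v, infinity_eq v = 0 -> v \in L.
Proof.
move=> n0; have [|L sL LP] := @root_list _ infinity_poly (if a0 == 0 then 4 else 5) n0.
  case: eqP => [a10|_]; last by rewrite -/(degle 5 _) /infinity_poly; degle_auto.
  by rewrite -/(degle 4 _) /infinity_poly a10 !mulr0 !polyC0 !mul0r !addr0; degle_auto.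
exists L => // v vE; apply: LP; rewrite -[RHS]vE /infinity_poly.
by rewrite !(hornerD, hornerM, horner_exp, hornerC, hornerX) /infinity_eq; ring.
Qed.

Lemma infinity_cover1 : (a1 != 0) || (d3 != 0) -> exists2 L : seq K,
  (size L <= 1)%N & forall v, v ^+ 2 * a1 + d3 = 0 -> v \in L.
Proof.
have [-> /= n3|n1 _] := eqVneq a1 0.
  by exists [::] => // v; rewrite mulr0 add0r => /eqP; rewrite (negbTE n3).
exists [:: sq (d3 / a1)] => // v /eqP; rewrite add2_eq0 // => /eqP e.
by rewrite inE; apply/eqP/(sqr_inj2 two0); rewrite sqK -e mulfK.
Qed.

(** Without x3^2-term the polar equation b3(t) = 0 describes at most three
    lines through (0 : 0 : 1), each with at most four points on it. *)
Lemma lines_cover : a0 = 0 -> a1 = 0 ->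
  [|| d0 != 0, d1 != 0, d2 != 0 | d3 != 0] ->
  (forall t, d0 + d1 * t + d2 * t ^+ 2 + d3 * t ^+ 3 = 0 -> line_poly t != 0) ->
  exists2 L : seq (K * K), (size L <= if d3 == 0%R then 8 else 12)%N &
    forall t v, polar_eq t v = 0 -> gradient_eq t v = 0 -> (t, v) \in L.
Proof.
move=> A0 A1 nd nl.
have n3 : b3 != 0.
  apply: contraTneq nd => e; have [|-> -> -> ->] := @cubic_eq0 d0 d1 d2 d3.
    by rewrite -e.
  by rewrite eqxx.
have [|L sL LP] := @root_list _ b3 (if d3 == 0 then 2 else 3) n3.
  case: eqP => [D3|_]; last by rewrite -/(degle 3 _) /b3; degle_auto.
  by rewrite -/(degle 2 _) /b3 D3 polyC0 mul0r addr0; degle_auto.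
have b3t t : b3.[t] = d0 + d1 * t + d2 * t ^+ 2 + d3 * t ^+ 3.
  by rewrite /b3 !(hornerD, hornerM, horner_exp, hornerC, hornerX).
have polarE t v : polar_eq t v = b3.[t] by rewrite b3t /polar_eq A0 A1; ring.
have : exists2 L' : seq (K * K), (size L' <= 4 * size L)%N &
    forall t v, t \in L -> b3.[t] = 0 -> gradient_eq t v = 0 -> (t, v) \in L'.
  elim: L {sL LP} => [|t L [L' sL' L'P]]; first by exists [::].
  have [b3t0|b3t0] := eqVneq b3.[t] 0; last first.
    exists L'; first by apply: leq_trans sL' _; rewrite leq_mul2l leqnSn orbT.
    move=> s v; rewrite inE => /orP[/eqP->|]; last exact: L'P.
    by move=> e; rewrite e eqxx in b3t0.
  have := line_cover (nl t _); rewrite -b3t A1 eqxx => /(_ b3t0)[M sM MP].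
  exists ([seq (t, v) | v <- M] ++ L').
    by rewrite size_cat size_map mulnS leq_add.
  move=> s v; rewrite inE mem_cat => /orP[/eqP-> bs gs|hs bs gs].
    by rewrite map_f // MP.
  by rewrite (L'P _ _ hs bs gs) orbT.
case=> L' sL' L'P; exists L'.
  apply: leq_trans sL' _; case: (d3 == 0) sL => sL.
    by rewrite (leq_mul2l 4 _ 2) sL orbT.
  by rewrite (leq_mul2l 4 _ 3) sL orbT.
by move=> t v; rewrite polarE => bt gt; apply: L'P (LP _ bt) bt gt.
Qed.

End Counting.

(** * Counting singular points *)

Ltac isform_auto := lazymatch goal with
  | |- isform _ _ (_ + _) => apply: isformD; isform_auto
  | |- isform _ _ (_ ^+ _) => eapply isformX; [isform_auto | reflexivity]
  | |- isform _ _ (_ * _) =>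
      eapply isformM; [isform_auto | isform_auto | reflexivity]
  | |- isform _ _ (_%:MP) => exact: isformC
  | h : isform _ _ ?x |- isform _ _ ?x => exact h
  end.

Section Obstructions.
Variable K : closedFieldType.
Hypothesis two0 : 2%:R = 0 :> K.
Local Notation poly4 := {mpoly K[4]}.
Let mtwo0 : 2%:R = 0 :> poly4 := two0_mpoly two0 4.
Variables (F : poly4) (normF : normal_hypersurface 4 F).
Variables (X1 X2 X3 Z : poly4).
Local Notation X := [tuple X1; X2; X3].
Hypothesis fX : frame X Z.
Variables (kap tau eps : K) (c : nat -> nat -> K).
Hypothesis FE : F = Z ^+ 2 * normal_cone kap tau eps X1 X2 X3 +
  quartic (fun i j => (c i j)%:MP) X1 X2 X3.

Let fX1 : isform X 1 X1. Proof. by case: (isform3 X1 X2 X3). Qed.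
Let fX2 : isform X 1 X2. Proof. by case: (isform3 X1 X2 X3). Qed.
Let fX3 : isform X 1 X3. Proof. by case: (isform3 X1 X2 X3). Qed.
Let hX : forall i, tnth X i \is 1.-homog. Proof. by case: fX. Qed.
Let hZ : Z \is 1.-homog. Proof. by case: fX. Qed.

Lemma isform_cone : isform X 2 (normal_cone kap tau eps X1 X2 X3).
Proof. rewrite /normal_cone; isform_auto. Qed.

Lemma isform_vertex w f d : isform X d f -> (0 < d)%N -> X1 @* w = 0 ->
  X2 @* w = 0 -> X3 @* w = 0 -> f @* w = 0.
Proof.
move=> [p /dhomogP hp ->] d0 w1 w2 w3.
have hw : forall i, tnth X i @* w = 0.
  exact: (tuple3P (P := fun f => f @* w = 0)).
rewrite comp_mpoly_meval mevalE big_seq big1 // => t /hp /= dt.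
have [i ti] : exists i, t i != 0%N.
  apply/existsP; apply: contraT; rewrite negb_exists => /forallP t0.
  by move: d0; rewrite -dt mdegE big1 // => i _; apply/eqP; have := t0 i; rewrite negbK.
by rewrite (bigD1 i) //= hw expr0n (negbTE ti) mul0r mulr0.
Qed.

Lemma frame_neq0 w f d : isform X d f -> (0 < d)%N -> f @* w != 0 -> w != 0.
Proof.
move=> hf d0; apply: contraNneq => ->.
have z0 p : p \is 1.-homog -> p @* (0 : 'rV[K]_4) = 0.
  by move=> hp; rewrite (meval_linear _ hp) big1 // => l _; rewrite !mxE mul0r.
by apply/eqP/(isform_vertex hf d0); apply/z0/(isform_homog hX).
Qed.

Lemma frame_Zneq0 w : Z @* w != 0 -> w != 0.
Proof.
apply: contraNneq => ->.
by rewrite (meval_linear _ hZ) big1 // => l _; rewrite !mxE mul0r.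
Qed.

Lemma eval_quartic w :
  (quartic (fun i j => (c i j)%:MP) X1 X2 X3) @* w =
  quartic c (X1 @* w) (X2 @* w) (X3 @* w).
Proof.
rewrite quartic_morph; congr (quartic _ _ _ _).
by apply/funext => i; apply/funext => j; apply: mevalC.
Qed.

Lemma eval_cone w : (normal_cone kap tau eps X1 X2 X3) @* w =
  kap * (X1 @* w) ^+ 2 + tau * X1 @* w * X2 @* w + eps * (X3 @* w) ^+ 2.
Proof. by rewrite /normal_cone !(mevalXn, mevalD, mevalM, mevalC). Qed.

(** Otherwise F = Q (Z^2 + C), and both factors vanish at a point over
    (1 : 0 : 0). *)
Lemma cone_not_factor C : kap = 0 -> isform X 2 C ->
  quartic (fun i j => (c i j)%:MP) X1 X2 X3 =
    normal_cone kap tau eps X1 X2 X3 * C -> False.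
Proof.
move=> k0 hC BE.
have [w0 [w1 w2 w3 _]] := frame_point fX 1 0 0 0.
have [w [v1 v2 v3 vZ]] := frame_point fX 1 0 0 (sq (C @* w0)).
have Cw : C @* w = C @* w0 by apply: (isform_eval hC); rewrite ?v1 ?v2 ?v3.
apply: (not_product normF (G := normal_cone kap tau eps X1 X2 X3)
  (H := Z ^+ 2 + C) (g := 2) (h := 2) (w := w)) => //.
- exact: (isform_homog hX isform_cone).
- apply: rpredD; [exact: (homogX hZ) | exact: (isform_homog hX hC)].
- by rewrite FE BE; ring.
- by apply: (frame_neq0 fX1 isT); rewrite v1 oner_eq0.
- by rewrite eval_cone v1 v2 v3 k0; ring.
- by rewrite mevalD mevalXn vZ sqK Cw -mulr2n -mulr_natl two0 mul0r.
Qed.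

Lemma x1_not_factor C : kap = 0 -> eps = 0 -> isform X 3 C ->
  quartic (fun i j => (c i j)%:MP) X1 X2 X3 = X1 * C -> False.
Proof.
move=> k0 e0 hC BE.
have [w [v1 v2 v3 vZ]] := frame_point fX 0 0 0 1.
have w0 : w != 0 by apply: frame_Zneq0; rewrite vZ oner_eq0.
have Cw : C @* w = 0.
  exact: (isform_vertex hC).
apply: (not_product normF (G := X1) (H := tau%:MP * Z ^+ 2 * X2 + C)
  (g := 1) (h := 3) (w := w)) => //.
- exact: (isform_homog hX fX1).
- apply: rpredD; last exact: (isform_homog hX hC).
  rewrite -mulrA mul_mpolyC; apply: rpredZ.
  exact: (homogM (homogX hZ erefl) (isform_homog hX fX2)).
- by rewrite FE BE /normal_cone k0 e0 !mpolyC0; ring.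
- by rewrite !(mevalXn, mevalD, mevalM, mevalC) Cw v2; ring.
Qed.

Lemma x2_not_factor C : kap = 0 -> eps = 0 -> isform X 3 C ->
  quartic (fun i j => (c i j)%:MP) X1 X2 X3 = X2 * C -> False.
Proof.
move=> k0 e0 hC BE.
have [w [v1 v2 v3 vZ]] := frame_point fX 0 0 0 1.
have w0 : w != 0 by apply: frame_Zneq0; rewrite vZ oner_eq0.
have Cw : C @* w = 0.
  exact: (isform_vertex hC).
apply: (not_product normF (G := X2) (H := tau%:MP * Z ^+ 2 * X1 + C)
  (g := 1) (h := 3) (w := w)) => //.
- exact: (isform_homog hX fX2).
- apply: rpredD; last exact: (isform_homog hX hC).
  rewrite -mulrA mul_mpolyC; apply: rpredZ.
  exact: (homogM (homogX hZ erefl) (isform_homog hX fX1)).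
- by rewrite FE BE /normal_cone k0 e0 !mpolyC0; ring.
- by rewrite !(mevalXn, mevalD, mevalM, mevalC) Cw v1; ring.
Qed.

(** Under these conditions F is a quadratic form in X1 and X2, so X is double
    along the line X1 = X2 = 0 through the centre. *)
Lemma not_double_vertex_line : kap = 0 -> tau = 1 -> eps = 0 -> c 0%N 0%N = 0 ->
  c 1%N 0%N = 0 -> c 0%N 1%N = 0 -> False.
Proof.
move=> k0 t1 e0 b0 a0 a1.
have [z zE] : exists z, c 2 0 + z ^+ 2 + c 1 1 + c 0 2 != 0.
  have [e|e] := eqVneq (c 2 0 + c 1 1 + c 0 2) 0; last first.
    by exists 0; rewrite expr0n addr0.
  exists 1; rewrite expr1n (_ : _ + _ = c 2 0 + c 1 1 + c 0 2 + 1); last by ring.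
  by rewrite e add0r oner_eq0.
have [w [v1 v2 v3 vZ]] := frame_point fX 0 0 1 z.
have [v [u1 u2 u3 uZ]] := frame_point fX 1 1 0 0.
pose C i j : poly4 := (c i j)%:MP.
pose al := C 2 0 * X3 ^+ 2 + (C 3 0 * X1 + C 2 1 * X2) * X3 +
           (C 4 0 * X1 ^+ 2 + C 3 1 * X1 * X2 + C 2 2 * X2 ^+ 2).
pose be' := C 1 1 * X3 ^+ 2 + C 1 2 * X2 * X3 + C 1 3 * X2 ^+ 2.
pose be := Z ^+ 2 + be'.
pose ga := C 0 2 * X3 ^+ 2 + C 0 3 * X2 * X3 + C 0 4 * X2 ^+ 2.
have hal : al \is 2.-homog.
  apply: (isform_homog hX); rewrite /al /C; isform_auto.
have hbe : be \is 2.-homog.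
  apply: rpredD; first exact: (homogX hZ).
  by apply: (isform_homog hX); rewrite /be' /C; isform_auto.
have hga : ga \is 2.-homog.
  apply: (isform_homog hX); rewrite /ga /C; isform_auto.
apply: (not_double_plane normF (u := X2) (v := X1 + X2) (al := al + be + ga)
  (be := be) (ga := al) (w := w) (e := v)) => //.
- exact: (isform_homog hX fX2).
- apply: rpredD; [exact: (isform_homog hX fX1) | exact: (isform_homog hX fX2)].
- by apply: rpredD => //; apply: rpredD.
- by rewrite FE /normal_cone /quartic k0 t1 e0 b0 a0 a1 !mpolyC0 mpolyC1
    /al /be /be' /ga /C; ring: mtwo0.
- by apply: (frame_neq0 fX3 isT); rewrite v3 oner_eq0.
- by rewrite mevalD v1 v2 addr0.
- rewrite /al /be /be' /ga /C !(mevalXn, mevalD, mevalM, mevalC) v1 v2 v3 vZ.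
  by rewrite (_ : _ + _ = c 2 0 + z ^+ 2 + c 1 1 + c 0 2); last by ring.
- by rewrite mevalD u1 u2 -[1 + 1]mulr2n two0.
Qed.

Local Notation b0 := (c 0%N 0%N).
Local Notation a0 := (c 1%N 0%N).
Local Notation a1 := (c 0%N 1%N).
Local Notation e0 := (c 2%N 0%N).
Local Notation e1 := (c 1%N 1%N).
Local Notation e2 := (c 0%N 2%N).
Local Notation d0 := (c 3%N 0%N).
Local Notation d1 := (c 2%N 1%N).
Local Notation d2 := (c 1%N 2%N).
Local Notation d3 := (c 0%N 3%N).
Local Notation c0 := (c 4%N 0%N).
Local Notation c1 := (c 3%N 1%N).
Local Notation c2 := (c 2%N 2%N).
Local Notation c3 := (c 1%N 3%N).
Local Notation c4 := (c 0%N 4%N).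
Local Notation "'[c' x ]" := (x%:MP : poly4) (format "[c  x ]").

Lemma not_square j m k d x1 x2 x3 :
  isform X 3 m -> isform X j k -> isform X (2 * (3 - j)) d -> (j <= 3)%N ->
  normal_cone kap tau eps X1 X2 X3 *
    quartic (fun i j => (c i j)%:MP) X1 X2 X3 = m ^+ 2 + k ^+ 2 * d ->
  (forall w, X1 @* w = x1 -> X2 @* w = x2 -> X3 @* w = x3 -> k @* w = 0) ->
  kap * x1 ^+ 2 + tau * x1 * x2 + eps * x3 ^+ 2 != 0 -> False.
Proof.
move=> hm hk hd j3 E k0 Q0; have [w [w1 w2 w3 _]] := frame_point fX x1 x2 x3 0.
have hQ := isform_cone.
apply: (not_square_mod_square two0 normF fX hQ hm hk hd j3 FE E (w := w)).
  exact: k0.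
by rewrite eval_cone w1 w2 w3.
Qed.

(** The three equations make F a quadratic form in X1 and X3 + o X2, so that X
    is double along the line that joins the centre to a point over (0 : 1 : o). *)
Lemma not_double_edge o : kap = 1 -> tau = 0 -> eps = 0 ->
  b0 * o ^+ 4 + a1 * o ^+ 3 + e2 * o ^+ 2 + d3 * o + c4 = 0 ->
  a0 * o ^+ 3 + e1 * o ^+ 2 + d2 * o + c3 = 0 -> a1 * o ^+ 2 + d3 = 0 -> False.
Proof.
move=> k1 t0 ep0 E0 E1 E3.
pose V := X3 + o%:MP * X2.
pose C i j : poly4 := (c i j)%:MP; pose O : poly4 := o%:MP.
pose al' := O ^+ 2 * C 2 0 * X2 ^+ 2 + O * X2 * (C 3 0 * X1 + C 2 1 * X2) +
  (C 4 0 * X1 ^+ 2 + C 3 1 * X1 * X2 + C 2 2 * X2 ^+ 2).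
pose be := C 1 0 * O ^+ 2 * X2 ^+ 2 +
   (C 3 0 * X1 ^+ 2 + C 2 1 * X1 * X2 + C 1 2 * X2 ^+ 2).
pose ga := C 0 0 * V ^+ 2 + (V + O * X2) * (C 1 0 * X1 + C 0 1 * X2) +
  (C 2 0 * X1 ^+ 2 + C 1 1 * X1 * X2 + C 0 2 * X2 ^+ 2).
have fV : isform X 1 V by rewrite /V; isform_auto.
have [z zE] : exists z, z ^+ 2 + (o ^+ 2 * e0 + o * d1 + c2) != 0.
  have [e|e] := eqVneq (o ^+ 2 * e0 + o * d1 + c2) 0.
    by exists 1; rewrite e expr1n addr0 oner_eq0.
  by exists 0; rewrite expr0n add0r.
have [w [w1 w2 w3 wZ]] := frame_point fX 0 1 o z.
have [v [v1 v2 v3 vZ]] := frame_point fX 1 0 0 0.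
apply: (not_double_plane normF (u := X1) (v := V) (al := Z ^+ 2 + al')
  (be := be) (ga := ga) (w := w) (e := v)).
- exact: (isform_homog hX fX1).
- exact: (isform_homog hX fV).
- apply: rpredD; first exact: (homogX hZ).
  by apply: (isform_homog hX); rewrite /al' /C /O; isform_auto.
- by apply: (isform_homog hX); rewrite /be /C /O; isform_auto.
- by apply: (isform_homog hX); rewrite /ga /C /O; isform_auto.
- transitivity ((Z ^+ 2 + al') * X1 ^+ 2 + be * X1 * V + ga * V ^+ 2 +
    (a1 * o ^+ 2 + d3)%:MP * V * X2 ^+ 3 +
    (a0 * o ^+ 3 + e1 * o ^+ 2 + d2 * o + c3)%:MP * X1 * X2 ^+ 3 +
    (b0 * o ^+ 4 + a1 * o ^+ 3 + e2 * o ^+ 2 + d3 * o + c4)%:MP * X2 ^+ 4).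
    rewrite FE /normal_cone /quartic k1 t0 ep0 /al' /be /ga /V /C /O.
    by rewrite mpolyC0 mpolyC1; ring: mtwo0.
  by rewrite E0 E1 E3 mpolyC0 !mul0r !addr0.
- by apply: (frame_neq0 fX2 isT); rewrite w2 oner_eq0.
- by rewrite w1.
- by rewrite mevalD mevalM mevalC w2 w3 mulr1 -mulr2n -mulr_natl two0 mul0r.
- rewrite /al' /C /O !(mevalXn, mevalD, mevalM, mevalC) w1 w2 wZ.
  by rewrite (_ : _ + _ = z ^+ 2 + (o ^+ 2 * e0 + o * d1 + c2)); last by ring.
- by rewrite v1.
- by rewrite mevalD mevalM v2 v3 mulr0 addr0.
Qed.

Lemma not_double_edge_vertex : kap = 1 -> tau = 0 -> eps = 0 ->
  b0 = 0 -> a0 = 0 -> a1 = 0 -> False.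
Proof.
move=> k1 t0 ep0 E0 E1 E3.
pose C i j : poly4 := (c i j)%:MP.
pose al' := C 2 0 * X3 ^+ 2 + (C 3 0 * X1 + C 2 1 * X2) * X3 +
           (C 4 0 * X1 ^+ 2 + C 3 1 * X1 * X2 + C 2 2 * X2 ^+ 2).
pose be := C 1 1 * X3 ^+ 2 + C 1 2 * X2 * X3 + C 1 3 * X2 ^+ 2.
pose ga := C 0 2 * X3 ^+ 2 + C 0 3 * X2 * X3 + C 0 4 * X2 ^+ 2.
have [z zE] : exists z, z ^+ 2 + e0 != 0.
  have [e|e] := eqVneq e0 0; first by exists 1; rewrite e expr1n addr0 oner_eq0.
  by exists 0; rewrite expr0n add0r.
have [w [w1 w2 w3 wZ]] := frame_point fX 0 0 1 z.
have [v [v1 v2 v3 vZ]] := frame_point fX 1 0 0 0.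
apply: (not_double_plane normF (u := X1) (v := X2) (al := Z ^+ 2 + al')
  (be := be) (ga := ga) (w := w) (e := v)).
- exact: (isform_homog hX fX1).
- exact: (isform_homog hX fX2).
- apply: rpredD; first exact: (homogX hZ).
  by apply: (isform_homog hX); rewrite /al' /C; isform_auto.
- by apply: (isform_homog hX); rewrite /be /C; isform_auto.
- by apply: (isform_homog hX); rewrite /ga /C; isform_auto.
- rewrite FE /normal_cone /quartic k1 t0 ep0 /al' /be /ga /C E0 E1 E3.
  by rewrite mpolyC0 mpolyC1; ring: mtwo0.
- by apply: (frame_neq0 fX3 isT); rewrite w3 oner_eq0.
- by rewrite w1.
- by rewrite w2.
- rewrite /al' /C !(mevalXn, mevalD, mevalM, mevalC) w1 w2 w3 wZ.
  by rewrite (_ : _ + _ = z ^+ 2 + e0); last by ring.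
- by rewrite v1.
- by rewrite v2.
Qed.

(** The polar equation contains the double conic x3^2 = q0 x1^2 + q2 x2^2,
    the square of a linear form l, and the hypotheses say that Q B restricted
    to l = 0 is a square. *)
Lemma not_conic_square (q0 q2 t : K)
    (g0 := b0 * q0 ^+ 2 + e0 * q0 + c0) (g1 := e1 * q0 + c1)
    (g2 := e0 * q2 + e2 * q0 + c2) (g3 := e1 * q2 + c3)
    (g4 := b0 * q2 ^+ 2 + e2 * q2 + c4)
    (p0 := kap + eps * q0) (p2 := eps * q2) :
  d0 = a0 * q0 -> d1 = a1 * q0 -> d2 = a0 * q2 -> d3 = a1 * q2 ->
  p0 * g1 + tau * g0 = 0 -> p0 * g3 + tau * g2 + p2 * g1 = 0 ->
  tau * g4 + p2 * g3 = 0 -> p0 + tau * t + p2 * t ^+ 2 != 0 -> False.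
Proof.
move=> D0 D1 D2 D3 h1 h3 h5 nt.
pose h0 := p0 * g0; pose h2 := p0 * g2 + tau * g1 + p2 * g0.
pose h4 := p0 * g4 + tau * g3 + p2 * g2; pose h6 := p2 * g4.
pose m := [c sq h0] * X1 ^+ 3 + [c sq h2] * X1 ^+ 2 * X2 +
   [c sq h4] * X1 * X2 ^+ 2 + [c sq h6] * X2 ^+ 3.
pose l := X3 + [c sq q0] * X1 + [c sq q2] * X2.
pose q := [c q0] * X1 ^+ 2 + [c q2] * X2 ^+ 2.
pose Q0 := [c kap] * X1 ^+ 2 + [c tau] * X1 * X2.
pose b2 := [c e0] * X1 ^+ 2 + [c e1] * X1 * X2 + [c e2] * X2 ^+ 2.
pose b4 := [c c0] * X1 ^+ 4 + [c c1] * X1 ^+ 3 * X2 + [c c2] * X1 ^+ 2 * X2 ^+ 2 +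
     [c c3] * X1 * X2 ^+ 3 + [c c4] * X2 ^+ 4.
pose b1 := [c a0] * X1 + [c a1] * X2.
pose d := [c eps] * [c b0] * (X3 ^+ 4 + X3 ^+ 2 * q + q ^+ 2) +
  ([c eps] * b2 + Q0 * [c b0]) * (X3 ^+ 2 + q) + ([c eps] * b4 + Q0 * b2) +
  X3 * (Q0 + [c eps] * X3 ^+ 2) * b1.
apply: (@not_square 1 m l d 1 t (sq q0 + sq q2 * t)).
- rewrite /m; isform_auto.
- rewrite /l; isform_auto.
- rewrite /d /q /Q0 /b2 /b4 /b1; isform_auto.
- by [].
- have mE : m ^+ 2 = [c h0] * X1 ^+ 6 + [c h2] * X1 ^+ 4 * X2 ^+ 2 +
     [c h4] * X1 ^+ 2 * X2 ^+ 4 + [c h6] * X2 ^+ 6.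
    rewrite -(sqK h0) -(sqK h2) -(sqK h4) -(sqK h6) /m.
    by ring: mtwo0.
  have lE : l ^+ 2 = X3 ^+ 2 + q.
    by rewrite /q -{1}(sqK q0) -{1}(sqK q2) /l; ring: mtwo0.
  rewrite mE lE.
  transitivity ([c h0] * X1 ^+ 6 + [c h2] * X1 ^+ 4 * X2 ^+ 2 +
     [c h4] * X1 ^+ 2 * X2 ^+ 4 + [c h6] * X2 ^+ 6 + (X3 ^+ 2 + q) * d +
     ([c p0 * g1 + tau * g0] * X1 ^+ 5 * X2 +
     [c p0 * g3 + tau * g2 + p2 * g1] * X1 ^+ 3 * X2 ^+ 3 +
     [c tau * g4 + p2 * g3] * X1 * X2 ^+ 5)); last first.
    by rewrite h1 h3 h5 mpolyC0 !mul0r !addr0.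
  rewrite /normal_cone /quartic D0 D1 D2 D3 /d /b1 /b2 /b4 /Q0 /q /h0 /h2 /h4 /h6.
  rewrite /p0 /p2 /g0 /g1 /g2 /g3 /g4.
  by ring: mtwo0.
- move=> w w1 w2 w3; rewrite /l !(mevalD, mevalM, mevalC) w1 w2 w3.
  by ring: two0.
- rewrite (_ : _ + _ = p0 + tau * t + p2 * t ^+ 2) //.
  rewrite /p0 /p2 -{2}(sqK q0) -{2}(sqK q2); ring: two0.
Qed.

(** Here Q B is a square modulo the square of the line x2 = t x1, which is
    thus the image of a curve of singular points. *)
Lemma not_double_line (t : K) : kap = 0 -> tau = 1 -> eps = 1 ->
  a0 = 0 -> a1 = 0 -> e1 = b0 -> d1 = d3 * t ^+ 2 -> d0 = d2 * t ^+ 2 ->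
  c1 + c3 * t ^+ 2 = e0 + e2 * t ^+ 2 -> c0 = c2 * t ^+ 2 + c4 * t ^+ 4 -> False.
Proof.
move=> k0 t1 ep1 A0 A1 E1 D1 D0 C1 C0.
pose g := e0 + e2 * t ^+ 2; pose Q := X1 * X2 + X3 ^+ 2.
pose m := Q * ([c sq b0] * X3 + [c sq g] * X1).
pose l := X2 + [c t] * X1.
pose d := Q * ([c e2] * X3 ^+ 2 + X3 * ([c d2] * X1 + [c d3] * X2) +
  ([c c4] * X2 ^+ 2 + [c c3] * X1 * X2 + [c c2 + c4 * t ^+ 2] * X1 ^+ 2)).
apply: (@not_square 1 m l d 1 t (sq (t + 1))).
- rewrite /m /Q; isform_auto.
- rewrite /l; isform_auto.
- rewrite /d /Q; isform_auto.
- by [].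
- have mE : m ^+ 2 = Q ^+ 2 * ([c b0] * X3 ^+ 2 + [c g] * X1 ^+ 2).
    by rewrite -{1}(sqK b0) -{1}(sqK g) /m; ring: mtwo0.
  rewrite mE /quartic /normal_cone k0 t1 ep1 A0 A1 E1 D1 D0 C0.
  have -> : c1 = e0 + e2 * t ^+ 2 + c3 * t ^+ 2.
    by rewrite -C1; ring: two0.
  by rewrite /d /Q /l /g mpolyC0 mpolyC1; ring: mtwo0.
- by move=> w w1 w2 w3; rewrite /l mevalD mevalM mevalC w1 w2; ring: two0.
- rewrite k0 t1 ep1 sqK (_ : _ + _ = 1) ?oner_eq0 //; ring: two0.
Qed.

Lemma not_double_line_infinity : kap = 0 -> tau = 1 -> eps = 1 ->
  a0 = 0 -> a1 = 0 -> d3 = 0 -> d2 = 0 -> e1 = b0 -> c3 = e2 -> c4 = 0 -> False.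
Proof.
move=> k0 t1 ep1 A0 A1 D3 D2 E1 C3 C4.
pose Q := X1 * X2 + X3 ^+ 2.
pose m := Q * ([c sq b0] * X3 + [c sq e2] * X2).
pose d := Q * ([c e0] * X3 ^+ 2 + X3 * ([c d0] * X1 + [c d1] * X2) +
  ([c c0] * X1 ^+ 2 + [c c1] * X1 * X2 + [c c2] * X2 ^+ 2)).
apply: (@not_square 1 m X1 d 0 0 1).
- rewrite /m /Q; isform_auto.
- isform_auto.
- rewrite /d /Q; isform_auto.
- by [].
- have mE : m ^+ 2 = Q ^+ 2 * ([c b0] * X3 ^+ 2 + [c e2] * X2 ^+ 2).
    by rewrite -{1}(sqK b0) -{1}(sqK e2) /m; ring: mtwo0.
  rewrite mE /quartic /normal_cone k0 t1 ep1 A0 A1 D3 D2 E1 C3 C4.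
  by rewrite /d /Q mpolyC0 mpolyC1; ring: mtwo0.
- by [].
- rewrite k0 t1 ep1 (_ : _ + _ = 1) ?oner_eq0 //; ring: two0.
Qed.

Lemma not_double_line_rank1 (t : K) : kap = 1 -> tau = 0 -> eps = 0 ->
  a0 = 0 -> a1 = 0 -> e1 = 0 -> d1 = d3 * t ^+ 2 -> d0 = d2 * t ^+ 2 ->
  c1 = c3 * t ^+ 2 -> False.
Proof.
move=> k0 t1 ep1 A0 A1 E1 D1 D0 C1.
pose r := c0 + t ^+ 2 * (c2 + c4 * t ^+ 2).
pose m := X1 * ([c sq b0] * X3 ^+ 2 + ([c sq e0] * X1 + [c sq e2] * X2) * X3 +
  [c sq r] * X1 ^+ 2).
pose l := X2 + [c t] * X1.
pose d := X1 ^+ 2 * (X3 * ([c d2] * X1 + [c d3] * X2) +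
  ([c c4] * X2 ^+ 2 + [c c3] * X1 * X2 + [c c2 + c4 * t ^+ 2] * X1 ^+ 2)).
apply: (@not_square 1 m l d 1 t 0).
- rewrite /m; isform_auto.
- rewrite /l; isform_auto.
- rewrite /d; isform_auto.
- by [].
- have mE : m ^+ 2 = X1 ^+ 2 * ([c b0] * X3 ^+ 4 + ([c e0] * X1 ^+ 2 +
      [c e2] * X2 ^+ 2) * X3 ^+ 2 + [c r] * X1 ^+ 4).
    by rewrite -{1}(sqK b0) -{1}(sqK e0) -{1}(sqK e2) -{1}(sqK r) /m; ring: mtwo0.
  rewrite mE /quartic /normal_cone k0 t1 ep1 A0 A1 E1 D1 D0 C1.
  by rewrite /d /l /r mpolyC0 mpolyC1; ring: mtwo0.
- by move=> w w1 w2 w3; rewrite /l mevalD mevalM mevalC w1 w2; ring: two0.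
- rewrite k0 t1 ep1 (_ : _ + _ = 1) ?oner_eq0 //; ring: two0.
Qed.

Lemma nonroot (p : {poly K}) : p != 0 -> exists t, p.[t] != 0.
Proof. by move/(closed_nonrootP p) => [t]; exists t. Qed.

Lemma poly3_neq0 (x y z : K) : [|| x != 0, y != 0 | z != 0] ->
  exists t, x + y * t + z * t ^+ 2 != 0.
Proof.
move=> H; have [|t] := @nonroot (Poly [:: x; y; z]).
  apply: contraTneq H => /polyP P; rewrite !negb_or !negbK.
  by have := P 0; have := P 1; have := P 2; rewrite !coef_Poly !coef0 /= => -> -> ->; rewrite eqxx.
by rewrite horner_Poly /= => H'; exists t; apply: contra_neq H' => E; rewrite -[RHS]E; ring.
Qed.

Lemma root2 (x y z : K) : x != 0 -> exists t, x * t ^+ 2 + y * t + z = 0.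
Proof.
move=> x0; have [t] := @solve_monicpoly K 2 (fun i => if i is 0 then z / x else y / x) isT.
rewrite !big_ord_recl big_ord0 /= expr0 expr1 mulr1 addr0 => tE.
exists t; rewrite tE (_ : x * (z / x + y / x * t) = z + y * t); last by field.
by ring: two0.
Qed.

(** A line x2 = t x1 meets the conic x1 x2 + x3^2 = 0 in a single point, and the
    other conic in two distinct ones when p + r t <> 0. *)
Lemma conic_point (A p r n0 n1 n2 : K) :
  [/\ p = 0, r = 0, n0 = 0, n2 = 0 & n1 = A] \/
  exists x1 x2 x3, A * x3 ^+ 2 + (p * x1 + r * x2) * x3 +
     (n0 * x1 ^+ 2 + n1 * x1 * x2 + n2 * x2 ^+ 2) = 0 /\ x1 * x2 + x3 ^+ 2 != 0.
Proof.
have [->|A0] := eqVneq A 0.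
  right; exists 0, 0, 1; split; first by ring.
  by rewrite mulr0 add0r expr1n oner_eq0.
have [pr|pr] := boolP ((p == 0) && (r == 0)).
  case/andP: pr => /eqP-> /eqP->.
  have [n|n] := boolP [|| n0 != 0, n1 + A != 0 | n2 != 0].
    have [t tE] := poly3_neq0 n.
    have [v vE] := @root2 A 0 (n0 + n1 * t + n2 * t ^+ 2) A0.
    right; exists 1, t, v; split; first by rewrite -[RHS]vE; ring.
    apply: contra_neq tE => /eqP; rewrite mul1r add2_eq0 // => /eqP tE.
    by rewrite -[RHS]vE -tE; ring: two0.
  left; move: n; rewrite !negb_or !negbK => /and3P[/eqP-> n1A /eqP->]; split=> //.
  by apply/eqP; rewrite -add2_eq0.
right; have [t tE] : exists t, p + r * t != 0.
  have [|t tE] := @poly3_neq0 p r 0; last by exists t; move: tE; rewrite mul0r addr0.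
  by move: pr; rewrite negb_and => /orP[] ->; rewrite ?orbT.
have [v vE] := @root2 A (p + r * t) (n0 + n1 * t + n2 * t ^+ 2) A0.
have [tv|tv] := eqVneq t (v ^+ 2); last first.
  exists 1, t, v; rewrite mul1r add2_eq0 //; split=> //.
  by rewrite -[RHS]vE; ring.
exists 1, t, (v + (p + r * t) / A); split.
  rewrite -[RHS]vE; set u := p + r * t; have Au : A * (u / A) = u by field.
  transitivity (A * v ^+ 2 + u * v + (n0 + n1 * t + n2 * t ^+ 2) +
      (A * (u / A) + u) * (u / A)); first by rewrite /u; ring: two0.
  by rewrite Au; ring: two0.
rewrite mul1r add2_eq0 //; apply/eqP; rewrite {1}tv => /(sqr_inj2 two0)/eqP.
rewrite -subr_eq0 opprD addNKr oppr_eq0 mulf_eq0 invr_eq0 (negbTE A0) orbF.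
by rewrite (negbTE tE).
Qed.

Let nsq := @not_square.

(** With only even powers of x3 in B one has B = B0^2 + x1 x2 B1^2, so that
    Q B has the shape of not_square with k equal to B0 + x3 B1, to B0 or to
    B1, for the three types of Q respectively.  What remains are the cases in
    which k has no zero off Q = 0. *)
Lemma not_even : cone_type kap tau eps -> a0 = 0 -> a1 = 0 -> d0 = 0 -> d1 = 0 ->
  d2 = 0 -> d3 = 0 -> False.
Proof.
move=> ct A0 A1 D0 D1 D2 D3.
pose B0 := [c sq b0] * X3 ^+ 2 + ([c sq e0] * X1 + [c sq e2] * X2) * X3 +
  ([c sq c0] * X1 ^+ 2 + [c sq c2] * X1 * X2 + [c sq c4] * X2 ^+ 2).
pose B1 := [c sq e1] * X3 + [c sq c1] * X1 + [c sq c3] * X2.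
have fB0 : isform X 2 B0 by rewrite /B0; isform_auto.
have fB1 : isform X 1 B1 by rewrite /B1; isform_auto.
have BE : quartic (fun i j => (c i j)%:MP) X1 X2 X3 = B0 ^+ 2 + X1 * X2 * B1 ^+ 2.
  rewrite /quartic /= A0 A1 D0 D1 D2 D3 mpolyC0.
  rewrite -{1}(sqK b0) -{1}(sqK e0) -{1}(sqK e1) -{1}(sqK e2).
  rewrite -{1}(sqK c0) -{1}(sqK c1) -{1}(sqK c2) -{1}(sqK c3) -{1}(sqK c4).
  by rewrite /B0 /B1; ring: mtwo0.
case: ct => -[K0 T0 E0].
- pose k := B0 + X3 * B1; pose Q := X1 * X2 + X3 ^+ 2.
  have QE : normal_cone kap tau eps X1 X2 X3 = Q.
    by rewrite /normal_cone K0 T0 E0 mpolyC0 mpolyC1 /Q; ring.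
  pose A := sq b0 + sq e1.
  have kE : k = [c A] * X3 ^+ 2 +
      ([c sq e0 + sq c1] * X1 + [c sq e2 + sq c3] * X2) * X3 +
      ([c sq c0] * X1 ^+ 2 + [c sq c2] * X1 * X2 + [c sq c4] * X2 ^+ 2).
    by rewrite /k /B0 /B1 /A; ring: mtwo0.
  have [[P R N0 N2 N1]|] :=
    conic_point A (sq e0 + sq c1) (sq e2 + sq c3) (sq c0) (sq c2) (sq c4).
    have {}kE : k = [c A] * Q by rewrite kE P R N0 N2 N1 mpolyC0 /Q; ring.
    apply: (@cone_not_factor
      (B1 ^+ 2 + [c A ^+ 2] * Q)) => //.
      by rewrite /Q; isform_auto.
    rewrite QE BE (_ : B0 = k + X3 * B1); last by rewrite /k; ring: mtwo0.
    by rewrite kE /Q; ring: mtwo0.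
  case=> x1 [x2 [x3 [kx Qx]]].
  apply: (@nsq 2 (X3 * B0 + X1 * X2 * B1) k (X1 * X2) x1 x2 x3).
  + isform_auto.
  + rewrite /k; isform_auto.
  + isform_auto.
  + by [].
  + by rewrite QE BE /k /Q; ring: mtwo0.
  + move=> w w1 w2 w3; rewrite kE !(mevalXn, mevalD, mevalM, mevalC) w1 w2 w3.
    by rewrite -[RHS]kx; ring.
  + by rewrite K0 T0 E0 mul0r add0r !mul1r.
- have nb0 : b0 != 0.
    apply/eqP => B00.
    exact: (@not_double_vertex_line).
  have nb : sq b0 != 0 by apply: contra_neq nb0 => e; rewrite -(sqK b0) e expr0n.
  have [v vE] := root2 (sq e0 + sq e2) (sq c0 + sq c2 + sq c4) nb.
  apply: (@nsq 2 (X1 * X2 * B1) B0 (X1 * X2) 1 1 v).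
  + isform_auto.
  + by [].
  + isform_auto.
  + by [].
  + by rewrite BE /normal_cone K0 T0 E0 mpolyC0 mpolyC1; ring: mtwo0.
  + move=> w w1 w2 w3; rewrite /B0 !(mevalXn, mevalD, mevalM, mevalC) w1 w2 w3.
    by rewrite -[RHS]vE; ring.
  + by rewrite K0 T0 E0 (_ : _ + _ = 1) ?oner_eq0 //; ring.
have sq_eq0 a : sq a = 0 -> a = 0 by move=> e; rewrite -(sqK a) e expr0n.
have [[v [t vt]]|nvt] := pselect (exists v t, sq e1 * v + sq c1 + sq c3 * t = 0).
  apply: (@nsq 1 (X1 * B0) B1 (X1 ^+ 2 * X1 * X2) 1 t v).
  + isform_auto.
  + by [].
  + isform_auto.
  + by [].
  + by rewrite BE /normal_cone K0 T0 E0 mpolyC0 mpolyC1; ring: mtwo0.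
  + move=> w w1 w2 w3; rewrite /B1 !(mevalXn, mevalD, mevalM, mevalC) w1 w2 w3.
    by rewrite -[RHS]vt; ring.
  + by rewrite K0 T0 E0 (_ : _ + _ = 1) ?oner_eq0 //; ring.
have E1 : e1 = 0.
  apply: sq_eq0; apply: contra_notP nvt => /eqP n1.
  exists (sq c1 / sq e1), 0; rewrite mulrCA divff // mulr1 mulr0 addr0.
  by rewrite -mulr2n -mulr_natl two0 mul0r.
have C3 : c3 = 0.
  apply: sq_eq0; apply: contra_notP nvt => /eqP n1.
  exists 0, (sq c1 / sq c3); rewrite mulrCA divff // mulr1 mulr0 add0r.
  by rewrite -mulr2n -mulr_natl two0 mul0r.
have [B00|nb0] := eqVneq b0 0.
  exact: (@not_double_edge_vertex).
have nb : sq b0 != 0 by apply: contra_neq nb0 => e; rewrite -(sqK b0) e expr0n.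
have [o oE] := root2 (sq e2) (sq c4) nb.
apply: (@not_double_edge o) => //.
- transitivity ((sq b0 * o ^+ 2 + sq e2 * o + sq c4) ^+ 2); last by rewrite oE expr0n.
  by rewrite A1 D3 -{1}(sqK b0) -{1}(sqK e2) -{1}(sqK c4); ring: two0.
- by rewrite A0 E1 D2 C3; ring.
- by rewrite A1 D3; ring.
Qed.

(** F and its derivatives along the first three coordinates of a frame; the
    remaining one is identically zero. *)
Definition singular_system (x1 x2 x3 z : K) :=
  [/\ z ^+ 2 * (kap * x1 ^+ 2 + tau * x1 * x2 + eps * x3 ^+ 2) + quartic c x1 x2 x3 = 0,
      z ^+ 2 * (tau * x2) + (a0 * x3 ^+ 3 + e1 * x2 * x3 ^+ 2 +
        (d0 * x1 ^+ 2 + d2 * x2 ^+ 2) * x3 + (c1 * x1 ^+ 2 * x2 + c3 * x2 ^+ 3)) = 0,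
      z ^+ 2 * (tau * x1) + (a1 * x3 ^+ 3 + e1 * x1 * x3 ^+ 2 +
        (d1 * x1 ^+ 2 + d3 * x2 ^+ 2) * x3 + (c1 * x1 ^+ 3 + c3 * x1 * x2 ^+ 2)) = 0 &
      (a0 * x1 + a1 * x2) * x3 ^+ 2 + (d0 * x1 ^+ 3 + d1 * x1 ^+ 2 * x2 +
        d2 * x1 * x2 ^+ 2 + d3 * x2 ^+ 3) = 0].

Lemma ddir_F (w v : 'rV[K]_4) : ddir (v 0 : 'I_4 -> K) F @* w =
   (Z @* w) ^+ 2 * (tau * (X1 @* v * X2 @* w + X1 @* w * X2 @* v)) +
   X1 @* v * (a0 * (X3 @* w) ^+ 3 + e1 * X2 @* w * (X3 @* w) ^+ 2 +
        (d0 * (X1 @* w) ^+ 2 + d2 * (X2 @* w) ^+ 2) * X3 @* w +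
        (c1 * (X1 @* w) ^+ 2 * X2 @* w + c3 * (X2 @* w) ^+ 3)) +
   X2 @* v * (a1 * (X3 @* w) ^+ 3 + e1 * X1 @* w * (X3 @* w) ^+ 2 +
        (d1 * (X1 @* w) ^+ 2 + d3 * (X2 @* w) ^+ 2) * X3 @* w +
        (c1 * (X1 @* w) ^+ 3 + c3 * X1 @* w * (X2 @* w) ^+ 2)) +
   X3 @* v * ((a0 * X1 @* w + a1 * X2 @* w) * (X3 @* w) ^+ 2 +
        (d0 * (X1 @* w) ^+ 3 + d1 * (X1 @* w) ^+ 2 * X2 @* w +
        d2 * X1 @* w * (X2 @* w) ^+ 2 + d3 * (X2 @* w) ^+ 3)).
Proof.
have h1 := isform_homog hX fX1; have h2 := isform_homog hX fX2.
have h3 := isform_homog hX fX3.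
rewrite FE /normal_cone /quartic !(ddirX, ddirD, ddirM, ddirC).
rewrite (ddir_linear _ h1) (ddir_linear _ h2) (ddir_linear _ h3) (ddir_linear _ hZ).
rewrite !(mevalXn, mevalZ, mevalD, mevalM, mevalC) ?meval0 /=.
move: (X1 @* w) (X2 @* w) (X3 @* w) (Z @* w) (X1 @* v) (X2 @* v) (X3 @* v) (Z @* v).
by move=> x1 x2 x3 z y1 y2 y3 u; ring: two0.
Qed.

Lemma singular_point_system P (w := coords P) : singular_point F P ->
  singular_system (X1 @* w) (X2 @* w) (X3 @* w) (Z @* w).
Proof.
case/andP => /eqP F0 /forallP dF.
have dd (v : 'rV[K]_4) : ddir (v 0 : 'I_4 -> K) F @* w = 0.
  rewrite /ddir raddf_sum big1 // => i _; rewrite /= mevalZ.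
  by have /eqP -> := dF i; rewrite mulr0.
have [v1 [v11 v12 v13 _]] := frame_point fX 1 0 0 0.
have [v2 [v21 v22 v23 _]] := frame_point fX 0 1 0 0.
have [v3 [v31 v32 v33 _]] := frame_point fX 0 0 1 0.
split.
- move: F0; rewrite FE mevalD mevalM mevalXn eval_quartic eval_cone; exact.
- by have := dd v1; rewrite ddir_F v11 v12 v13 => E; rewrite -[RHS]E; ring.
- by have := dd v2; rewrite ddir_F v21 v22 v23 => E; rewrite -[RHS]E; ring.
- by have := dd v3; rewrite ddir_F v31 v32 v33 => E; rewrite -[RHS]E; ring.
Qed.

Lemma singular_system_scale l x1 x2 x3 z : l != 0 ->
  singular_system (l * x1) (l * x2) (l * x3) (l * z) -> singular_system x1 x2 x3 z.
Proof.
move=> l0 [E0 E1 E2 E3]; split.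
- apply: (mulfI (expf_neq0 4 l0)); rewrite mulr0 -[RHS]E0 /quartic; ring.
- apply: (mulfI (expf_neq0 3 l0)); rewrite mulr0 -[RHS]E1; ring.
- apply: (mulfI (expf_neq0 3 l0)); rewrite mulr0 -[RHS]E2; ring.
- apply: (mulfI (expf_neq0 3 l0)); rewrite mulr0 -[RHS]E3; ring.
Qed.

Hypothesis coneT : cone_type kap tau eps.

Local Notation sys := singular_system.
Local Notation polar := (polar_eq a0 a1 d0 d1 d2 d3).
Local Notation gradient := (gradient_eq kap tau eps b0 a1 e0 e1 e2 d1 d3 c0 c1 c2 c3 c4).
Local Notation infinity := (infinity_eq eps b0 a0 e1 e2 d2 c3 c4).
Local Notation linep := (line_poly kap tau eps b0 a1 e0 e1 e2 d1 d3 c0 c1 c2 c3 c4).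
Local Notation infp := (infinity_poly eps b0 a0 e1 e2 d2 c3 c4).

Lemma affine_system t v z : sys 1 t v z -> polar t v = 0 /\ gradient t v = 0.
Proof.
case=> E0 E1' E2' E3; split; first by rewrite -[RHS]E3 /polar_eq; ring.
transitivity ((kap + tau * t + eps * v ^+ 2) *
   (z ^+ 2 * (tau * 1) + (a1 * v ^+ 3 + e1 * 1 * v ^+ 2 +
        (d1 * 1 ^+ 2 + d3 * t ^+ 2) * v + (c1 * 1 ^+ 3 + c3 * 1 * t ^+ 2))) +
  tau * (z ^+ 2 * (kap * 1 ^+ 2 + tau * 1 * t + eps * v ^+ 2) + quartic c 1 t v) +
  tau * v * ((a0 * 1 + a1 * t) * v ^+ 2 + (d0 * 1 ^+ 3 + d1 * 1 ^+ 2 * t +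
        d2 * 1 * t ^+ 2 + d3 * t ^+ 3))).
  by rewrite /gradient_eq /quartic; ring: two0.
by rewrite E0 E2' E3 !mulr0 !addr0.
Qed.

Lemma infinity_system v z : tau = 1 -> kap = 0 -> sys 0 1 v z ->
  v ^+ 2 * a1 + d3 = 0 /\ infinity v = 0.
Proof.
move=> t1 k0 [E0 E1' E2' E3]; have F3 : v ^+ 2 * a1 + d3 = 0 by rewrite -[RHS]E3; ring.
split=> //.
transitivity ((eps * v ^+ 2) *
   (z ^+ 2 * (tau * 1) + (a0 * v ^+ 3 + e1 * 1 * v ^+ 2 +
        (d0 * 0 ^+ 2 + d2 * 1 ^+ 2) * v + (c1 * 0 ^+ 2 * 1 + c3 * 1 ^+ 3))) +
  (z ^+ 2 * (kap * 0 ^+ 2 + tau * 0 * 1 + eps * v ^+ 2) + quartic c 0 1 v) +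
  v * (v ^+ 2 * a1 + d3)).
  by rewrite /infinity_eq /quartic t1 k0; ring: two0.
by rewrite E0 E1' F3 !mulr0 !addr0.
Qed.

Let nvl := @not_double_vertex_line.
Let nde := @not_double_edge.
Let ndev := @not_double_edge_vertex.
Let ncs := @not_conic_square.
Let ndl := @not_double_line.
Let ndli := @not_double_line_infinity.
Let ndlr := @not_double_line_rank1.
Let nev := @not_even.
Let ncf := @cone_not_factor.
Let nx1 := @x1_not_factor.
Let nx2 := @x2_not_factor.

Lemma rank1_no_infinity x2 x3 z : kap = 1 -> (x2 != 0) || (x3 != 0) ->
  ~ sys 0 x2 x3 z.
Proof.
move=> k1 n S.
have [t0 ep0] : tau = 0 /\ eps = 0.
  case: coneT => -[k t ep] //; by move: k1 => /eqP; rewrite k eq_sym oner_eq0.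
have [x20|x20] := eqVneq x2 0.
  move: n S; rewrite x20 eqxx /= => x30 S.
  have {S} : sys (x3 * 0) (x3 * 0) (x3 * 1) (x3 * (z / x3)).
    by rewrite !mulr0 mulr1 mulrC divfK.
  move/(singular_system_scale x30) => [E0 E1' E2' _]; apply: ndev => //.
  - by rewrite -[RHS]E0 /quartic t0 ep0; ring.
  - by rewrite -[RHS]E1' t0; ring.
  - by rewrite -[RHS]E2' t0; ring.
have {S} : sys (x2 * 0) (x2 * 1) (x2 * (x3 / x2)) (x2 * (z / x2)).
  by rewrite mulr0 mulr1 ![x2 * _]mulrC !divfK.
move/(singular_system_scale x20) => [E0 E1' _ E3].
apply: (nde (o := x3 / x2)) => //.
- by rewrite -[RHS]E0 /quartic t0 ep0; ring.
- by rewrite -[RHS]E1' t0; ring.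
- by rewrite -[RHS]E3; ring.
Qed.

(** The point (0 : 0 : 1) of the plane is the vertex of the pencil of lines
    x2 = t x1 and is covered by neither of the two affine charts. *)
Lemma top_system z : sys 0 0 1 z -> [/\ a0 = 0, a1 = 0, kap = 0 & eps = 1].
Proof.
move=> S; have [_ E1' E2' _] := S.
have A0 : a0 = 0 by rewrite -[RHS]E1'; ring.
have A1 : a1 = 0 by rewrite -[RHS]E2'; ring.
have [[k t ep]|[k t ep]|[k t ep]] := coneT.
- by [].
- have [E0 _ _ _] := S; case: (nvl k t ep) => //.
  by rewrite -[RHS]E0 /quartic k ep; ring.
- by case: (rank1_no_infinity k _ S); rewrite oner_eq0 orbT.
Qed.

(** Bounds for the images of the singular points in the chart x1 <> 0, on the
    line x1 = 0 and at its point (0 : 0 : 1). *)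
Definition plane_cover (n1 n2 n3 : nat) := exists (L1 : seq (K * K)) (L2 : seq K),
  [/\ (size L1 <= n1)%N, (size L2 <= n2)%N,
      forall t v z, sys 1 t v z -> (t, v) \in L1,
      forall v z, sys 0 1 v z -> v \in L2 &
      n3 = 0%N -> forall z, ~ sys 0 0 1 z].

Let rank1_tau : kap != 1 -> tau = 1 /\ kap = 0.
Proof. by case: coneT => -[-> -> _]; rewrite ?eqxx. Qed.

Lemma infinity_simple : (a1 != 0) || (d3 != 0) -> exists2 L2 : seq K,
  (size L2 <= 1)%N & forall v z, sys 0 1 v z -> v \in L2.
Proof.
move=> n; have [L2 sL2 L2P] := infinity_cover1 two0 n.
exists L2 => // v z S; have [k1|k1] := eqVneq kap 1.
  by case: (rank1_no_infinity k1 _ S); rewrite oner_eq0.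
have [t1 k0] := rank1_tau k1.
by have [E _] := infinity_system t1 k0 S; apply: L2P.
Qed.

Lemma plane_cover_generic : binary_resultant a0 a1 d0 d1 d2 d3 != 0 -> plane_cover 13 1 0.
Proof.
move=> res; have [L1 sL1 L1P] := coprime_cover two0 b0 e0 e1 e2 c0 c1 c2 c3 c4 coneT res.
have [|L2 sL2 L2P] := infinity_simple.
  apply: contraNT res; rewrite negb_or !negbK => /andP[/eqP A1 /eqP D3].
  by rewrite /binary_resultant A1 D3; apply/eqP; ring.
exists L1, L2; split=> //.
- by move=> t v z /affine_system[pe ge]; apply: L1P.
- move=> _ z /top_system[A0 A1 _ _]; move: res.
  by rewrite /binary_resultant A0 A1 (_ : _ + _ = 0) ?eqxx //; ring.
Qed.

Lemma plane_cover_common : binary_resultant a0 a1 d0 d1 d2 d3 = 0 ->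
  (a0 != 0) || (a1 != 0) -> plane_cover 13 1 0 \/ plane_cover 8 5 0.
Proof.
move=> res a01; have [q0 [q1 [q2 [D0 D1 D2 D3]]]] := common_factor two0 res a01.
have top0 z : ~ sys 0 0 1 z.
  by move=> /top_system[A0 A1 _ _]; move: a01; rewrite A0 A1 eqxx.
have [[L sL LP]|[Q1 h1 h3 h5]|[[k t ep] [[Q0 Q1 Q2] [C0 C1 C2 C3 C4]]]] :=
  common_cover two0 b0 e0 e1 e2 c0 c1 c2 c3 c4 D0 D1 D2 D3 coneT a01.
- have [A1|A1] := eqVneq a1 0.
    right; have A0 : a0 != 0 by move: a01; rewrite A1 eqxx orbF.
    have LP' t v z : sys 1 t v z -> (t, v) \in L.
      by move=> /affine_system[pe ge]; apply: LP => //; rewrite A1 mul0r addr0.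
    have [k1|/rank1_tau[t1 k0]] := eqVneq kap 1.
      exists L, [::]; split=> // v z S.
      by case: (rank1_no_infinity k1 _ S); rewrite oner_eq0.
    have [|L2 sL2 L2P] := @infinity_cover _ eps b0 a0 e1 e2 d2 c3 c4.
      apply/eqP; rewrite /infinity_poly => /quintic_eq0[C4 _ E2 [_ B0 EA]].
      move/eqP: EA; rewrite mulf_eq0 (negbTE A0) orbF => /eqP ep.
      move: E2 B0; rewrite ep !mul0r !add0r => E2 B0.
      pose C i j : poly4 := (c i j)%:MP.
      apply: (nx1 (C := C 1 0 * X3 ^+ 3 + (C 2 0 * X1 + C 1 1 * X2) * X3 ^+ 2 +
        (C 3 0 * X1 ^+ 2 + C 2 1 * X1 * X2 + C 1 2 * X2 ^+ 2) * X3 +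
        (C 4 0 * X1 ^+ 3 + C 3 1 * X1 ^+ 2 * X2 + C 2 2 * X1 * X2 ^+ 2 +
           C 1 3 * X2 ^+ 3))) => //.
        by rewrite /C; isform_auto.
      by rewrite /quartic D3 A1 mul0r C4 B0 E2 mpolyC0 /C; ring.
    exists L, L2; split=> //; first by rewrite (negbTE A0) in sL2.
    by move=> v z S; have [_ E] := infinity_system t1 k0 S; apply: L2P.
  left; have [L2 sL2 L2P] : exists2 L2 : seq K, (size L2 <= 1)%N &
      forall v z, sys 0 1 v z -> v \in L2 by apply: infinity_simple; rewrite A1.
  pose t0 := a0 / a1; have t0E : a0 = a1 * t0 by rewrite mulrC divfK.
  have [|L' sL' L'P] := @line_cover _ kap tau eps b0 a1 e0 e1 e2 d1 d3 c0 c1 c2 c3 c4 t0.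
    apply/eqP; rewrite /line_poly => /quintic_eq0[C0 _ E0 [S3 B0 EA]].
    move/eqP: EA; rewrite mulf_eq0 (negbTE A1) orbF => /eqP ep.
    move/eqP: S3; rewrite ep mul0r addr0 mulf_eq0 (negbTE A1) orbF => /eqP s0.
    have [[k t e]|[k t e]|[k t e]] := coneT.
    + by move/eqP: ep; rewrite e oner_eq0.
    + move: C0 E0 B0 s0; rewrite ep k t !mul0r !add0r !mul1r => C0 E0 B0 s0.
      rewrite s0 !(mul0r, mulr0, expr0n, addr0, add0r) /= in C0 E0.
      have A0 : a0 = 0 by rewrite t0E s0 mulr0.
      have D0' : d0 = 0 by rewrite D0 A0 mul0r.
      pose C i j : poly4 := (c i j)%:MP.
      apply: (nx2 (C := C 0 1 * X3 ^+ 3 + (C 1 1 * X1 + C 0 2 * X2) * X3 ^+ 2 +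
        (C 2 1 * X1 ^+ 2 + C 1 2 * X1 * X2 + C 0 3 * X2 ^+ 2) * X3 +
        (C 3 1 * X1 ^+ 3 + C 2 2 * X1 ^+ 2 * X2 + C 1 3 * X1 * X2 ^+ 2 +
           C 0 4 * X2 ^+ 3))) => //.
        by rewrite /C; isform_auto.
      by rewrite /quartic A0 D0' C0 B0 E0 mpolyC0 /C; ring.
    + by move/eqP: s0; rewrite k t mul0r addr0 oner_eq0.
  exists (L ++ [seq (t0, v) | v <- L']), L2; split=> //.
    rewrite size_cat size_map (leq_add (n1 := 8) (n2 := 5)) //.
    by rewrite (negbTE A1) in sL'.
  move=> t v z /affine_system[pe ge]; rewrite mem_cat.
  have [At|At] := eqVneq (a0 + a1 * t) 0; last by rewrite LP.
  have -> : t = t0.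
    by apply: (mulfI A1); apply/eqP; rewrite -t0E -add2_eq0 // addrC At.
  rewrite map_f ?orbT // L'P //.
  rewrite (_ : t0 = t) //.
  by apply: (mulfI A1); apply/eqP; rewrite -t0E -add2_eq0 // At.
- exfalso; have [|t tE] := @poly3_neq0 (kap + eps * q0) tau (eps * q2).
    by case: coneT => -[k t ep]; rewrite ?t ?oner_eq0 ?orbT // k ep mul0r addr0 oner_eq0.
  apply: (ncs (q0 := q0) (q2 := q2) (t := t)) => //.
  + by rewrite D1 Q1 mulr0 add0r.
  + by rewrite D2 Q1 mulr0 addr0.
- exfalso; pose C i j : poly4 := (c i j)%:MP.
  apply: (ncf (C := C 0 0 * (X3 ^+ 2 + X1 * X2) + C 2 0 * X1 ^+ 2 + C 1 1 * X1 * X2 +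
    C 0 2 * X2 ^+ 2 + X3 * (C 1 0 * X1 + C 0 1 * X2))) => //.
    by rewrite /C; isform_auto.
  rewrite /quartic /normal_cone D0 D1 D2 D3 Q0 Q1 Q2 C0 C1 C2 C3 C4 k t ep /C.
  by rewrite mpolyC0 mpolyC1; ring: mtwo0.
Qed.

Lemma plane_cover_lines : a0 = 0 -> a1 = 0 -> plane_cover 12 0 1 \/ plane_cover 8 4 1.
Proof.
move=> A0 A1.
have nb0 : eps = 0 -> tau = 1 -> b0 != 0.
  move=> ep t1; apply/eqP => B0; apply: nvl => //.
  by case: coneT => -[//= k t e]; move/eqP: t1; rewrite t eq_sym oner_eq0.
have nd : [|| d0 != 0, d1 != 0, d2 != 0 | d3 != 0].
  apply: contraT; rewrite !negb_or !negbK => /and4P[/eqP Z0 /eqP Z1 /eqP Z2 /eqP Z3].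
  by case: (nev coneT A0 A1 Z0 Z1 Z2 Z3).
have [|L sL LP] := @lines_cover K kap tau eps b0 a0 a1 e0 e1 e2 d0 d1 d2 d3
    c0 c1 c2 c3 c4 A0 A1 nd.
  move=> t bt; apply/eqP; rewrite /line_poly => /quintic_eq0[C0 C1 C2 [C3 C4 _]].
  have [[k tt ep]|[k tt ep]|[k tt ep]] := coneT.
  - move: C0 C1 C2 C3 C4; rewrite k tt ep A1 !(mul1r, add0r, mulr0) => C0 _ C2 C3 C4.
    have E1 : e1 = b0 by apply/eqP; rewrite -add2_eq0 // C4.
    have D1 : d1 = d3 * t ^+ 2 by apply/eqP; rewrite -add2_eq0 // C3.
    have G : c1 + c3 * t ^+ 2 = e0 + e2 * t ^+ 2.
      apply/eqP; rewrite -add2_eq0 // -[X in _ == X]C2 E1; apply/eqP; ring: two0.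
    apply: (ndl (t := t)) => //.
    + apply/eqP; rewrite -add2_eq0 // -[X in _ == X]bt D1; apply/eqP; ring: two0.
    + apply/eqP; rewrite -add2_eq0 // -[X in _ == X]C0; apply/eqP; ring: two0.
  - by move: C4; rewrite ep tt !mul0r add0r mul1r => B0; move: (nb0 ep tt); rewrite B0 eqxx.
  - move: C0 C1 C2; rewrite k tt ep !(mul0r, addr0, mul1r) => C0 C1 E1.
    have D1 : d1 = d3 * t ^+ 2 by apply/eqP; rewrite -add2_eq0 // C1.
    apply: (ndlr (t := t)) => //.
    + apply/eqP; rewrite -add2_eq0 // -[X in _ == X]bt D1; apply/eqP; ring: two0.
    + by apply/eqP; rewrite -add2_eq0 // C0.
have LP' t v z : sys 1 t v z -> (t, v) \in L.
  by move=> /affine_system[pe ge]; apply: LP.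
have [D3|D3] := eqVneq d3 0; last first.
  left; exists L, [::]; split=> //; first by rewrite (negbTE D3) in sL.
  move=> v z S; have [k1|/rank1_tau[t1 k0]] := eqVneq kap 1.
    by case: (rank1_no_infinity k1 _ S); rewrite oner_eq0.
  have [E _] := infinity_system t1 k0 S.
  by move: D3; rewrite -E A1 mulr0 add0r eqxx.
right; rewrite D3 eqxx in sL.
have [k1|/rank1_tau[t1 k0]] := eqVneq kap 1.
  exists L, [::]; split=> // v z S.
  by case: (rank1_no_infinity k1 _ S); rewrite oner_eq0.
have [|L2 sL2 L2P] := @infinity_cover _ eps b0 a0 e1 e2 d2 c3 c4.
  apply/eqP; rewrite /infinity_poly => /quintic_eq0[C4 _ E2 [D2 B0 _]].
  have [ep|ep] : eps = 1 \/ eps = 0 by case: coneT => -[_ _ ->]; [left|right|right].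
    move: E2 D2 B0; rewrite ep !mul1r => E2 D2 B0; apply: ndli => //.
    + by apply/eqP; rewrite -add2_eq0 // B0.
    + by apply/eqP; rewrite -add2_eq0 // E2.
  by move: B0; rewrite ep mul0r add0r => B0; move: (nb0 ep t1); rewrite B0 eqxx.
rewrite A0 eqxx in sL2; exists L, L2; split=> // v z S.
by have [_ E] := infinity_system t1 k0 S; apply: L2P.
Qed.

Lemma plane_cover_exists : exists n1 n2 n3, (n1 + n2 + n3 < 15)%N /\ plane_cover n1 n2 n3.
Proof.
have [res|res] := eqVneq (binary_resultant a0 a1 d0 d1 d2 d3) 0; last first.
  by exists 13, 1%N, 0%N; split=> //; apply: plane_cover_generic.
have [a01|] := boolP ((a0 != 0) || (a1 != 0)).
  have [H|H] := plane_cover_common res a01; first by exists 13, 1%N, 0%N.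
  by exists 8, 5, 0%N.
rewrite negb_or !negbK => /andP[/eqP A0 /eqP A1].
by have [H|H] := plane_cover_lines A0 A1; [exists 12, 0%N, 1%N | exists 8, 4, 1%N].
Qed.

(** The equation for z^2 comes from the derivative along x2, or from F itself when
    that derivative does not involve z. *)
Definition fibre_affine (t v : K) := if tau == 0 then sq (quartic c 1 t v) else
  sq (a1 * v ^+ 3 + e1 * v ^+ 2 + (d1 + d3 * t ^+ 2) * v + (c1 + c3 * t ^+ 2)).
Definition fibre_infinity (v : K) := sq (a0 * v ^+ 3 + e1 * v ^+ 2 + d2 * v + c3).

Lemma singular_cover : exists2 L : seq (K * K * K * K), (size L < 15)%N &
  forall x1 x2 x3 z, sys x1 x2 x3 z -> [|| x1 != 0, x2 != 0 | x3 != 0] ->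
  exists l q, [/\ l != 0, q \in L &
     (x1, x2, x3, z) = (l * q.1.1.1, l * q.1.1.2, l * q.1.2, l * q.2)].
Proof.
have [n1 [n2 [n3 [n15 [L1 [L2 [sL1 sL2 L1P L2P L3P]]]]]]] := plane_cover_exists.
pose L3 := if n3 is 0%N then [::] else [:: (0 : K, 0 : K, 1 : K, sq b0)].
exists ([seq (1, p.1, p.2, fibre_affine p.1 p.2) | p <- L1] ++
  [seq (0, 1, v, fibre_infinity v) | v <- L2] ++ L3).
  have sL3 : (size L3 <= n3)%N by rewrite /L3; case: (n3).
  rewrite !size_cat !size_map (leq_ltn_trans _ n15) // addnA.
  by rewrite leq_add // leq_add.
move=> x1 x2 x3 z S n; have [x10|x10] := eqVneq x1 0; last first.
  exists x1, (1, x2 / x1, x3 / x1, fibre_affine (x2 / x1) (x3 / x1)).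
  have {}S : sys 1 (x2 / x1) (x3 / x1) (z / x1).
    apply: (singular_system_scale x10).
    by rewrite mulr1 ![x1 * _]mulrC !divfK.
  split=> //.
    rewrite mem_cat; apply/orP; left; apply/mapP; exists (x2 / x1, x3 / x1) => //.
    exact: L1P S.
  rewrite /= mulr1 [x1 * (x2 / x1)]mulrC [x1 * (x3 / x1)]mulrC !divfK //; congr (_, _).
  suff -> : fibre_affine (x2 / x1) (x3 / x1) = z / x1 by rewrite mulrC divfK.
  have [E0 _ E2' _] := S; move: (x2 / x1) (x3 / x1) (z / x1) E0 E2' => t v u E0 E2'.
  apply: (sqr_inj2 two0); rewrite /fibre_affine.
  case: coneT => -[k tt ep]; rewrite tt ?oner_eq0 ?eqxx sqK; apply/eqP; rewrite -add2_eq0 //.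
  - by rewrite -[X in _ == X]E2' tt; apply/eqP; ring.
  - by rewrite -[X in _ == X]E2' tt; apply/eqP; ring.
  - by rewrite -[X in _ == X]E0 k tt ep; apply/eqP; ring.
have [k1|/rank1_tau[t1 k0]] := eqVneq kap 1.
  case: (@rank1_no_infinity x2 x3 z k1); last by rewrite -x10.
  by move: n; rewrite x10 eqxx.
have [x20|x20] := eqVneq x2 0; last first.
  exists x2, (0, 1, x3 / x2, fibre_infinity (x3 / x2)).
  have {}S : sys 0 1 (x3 / x2) (z / x2).
    apply: (singular_system_scale x20).
    by rewrite mulr0 mulr1 ![x2 * _]mulrC !divfK // -x10.
  split=> //.
    rewrite !mem_cat; apply/orP; right; apply/orP; left; apply/mapP.
    by exists (x3 / x2) => //; exact: L2P S.
  rewrite /= mulr1 mulr0 x10 [x2 * (x3 / x2)]mulrC !divfK //; congr (_, _).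
  suff -> : fibre_infinity (x3 / x2) = z / x2 by rewrite mulrC divfK.
  have [_ E1' _ _] := S; move: (x3 / x2) (z / x2) E1' => v u E1'.
  apply: (sqr_inj2 two0); rewrite sqK; apply/eqP; rewrite -add2_eq0 //.
  by rewrite -[X in _ == X]E1' t1; apply/eqP; ring.
have x30 : x3 != 0 by move: n; rewrite x10 x20 eqxx.
exists x3, (0, 0, 1, sq b0).
have {}S : sys 0 0 1 (z / x3).
  apply: (singular_system_scale x30).
  by rewrite mulr0 mulr1 [x3 * _]mulrC divfK // -{1}x10 -x20.
split=> //.
  rewrite !mem_cat /L3; case: (n3) L3P => [|m] L3P; first by case: (L3P erefl _ S).
  by rewrite inE eqxx !orbT.
rewrite /= mulr1 mulr0 x10 x20; congr (_, _).
suff -> : sq b0 = z / x3 by rewrite mulrC divfK.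
have [_ _ _ ep] := top_system S; have [E0 _ _ _] := S.
apply: (sqr_inj2 two0); rewrite sqK; apply/eqP; rewrite -add2_eq0 //.
by rewrite -[X in _ == X]E0 ep /quartic k0; apply/eqP; ring.
Qed.

(** Every singular point is proportional in the frame to one of at most 14
    listed vectors or to the centre, and proportional points are equal. *)
Lemma singular_count (s : seq (proj_space K 3)) : uniq s ->
  (forall P, P \in s -> singular_point F P) -> (size s <= 15)%N.
Proof.
move=> us sS; have [L sL LP] := singular_cover.
pose ev P : K * K * K * K := let w := coords P in (X1 @* w, X2 @* w, X3 @* w, Z @* w).
pose vertex : K * K * K * K := (0, 0, 0, 1).
pose scales P (q : K * K * K * K) := `[< exists2 l : K, l != 0 &
  ev P = (l * q.1.1.1, l * q.1.1.2, l * q.1.2, l * q.2) >].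
have [_ _ inj] := fX.
have evP P : P \in s -> exists2 q, q \in vertex :: L & scales P q.
  move=> Ps; pose w := coords P.
  have S := singular_point_system (sS P Ps).
  have [n|n] := boolP [|| X1 @* w != 0, X2 @* w != 0 | X3 @* w != 0].
    have [l [q [l0 qL E]]] := LP _ _ _ _ S n.
    by exists q; [rewrite inE qL orbT | apply/asboolP; exists l].
  move: n; rewrite !negb_or !negbK => /and3P[/eqP n1 /eqP n2 /eqP n3].
  exists vertex; first by rewrite inE eqxx.
  apply/asboolP; exists (Z @* w); last by rewrite /ev /= n1 n2 n3 mulr1 mulr0.
  apply: contra_neq (coords_neq0 P) => z0; apply: inj => //.
  exact: (tuple3P (P := fun f => f @* w = 0)).
pose f P := nth vertex (vertex :: L) (find (scales P) (vertex :: L)).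
have fP P : P \in s -> f P \in vertex :: L /\ scales P (f P).
  move=> Ps; have [q qL qP] := evP P Ps.
  have H : has (scales P) (vertex :: L) by apply/hasP; exists q.
  by split; [rewrite mem_nth // -has_find | apply: nth_find].
have finj : {in s &, injective f}.
  move=> P1 P2 P1s P2s fE.
  have [_ /asboolP[l1 l10 E1']] := fP _ P1s; have [_ /asboolP[l2 l20 E2']] := fP _ P2s.
  apply: (@eq_point _ _ P1 P2 (l1 / l2)); first by rewrite mulf_neq0 ?invr_eq0.
  apply/eqP; rewrite -subr_eq0; apply/eqP.
  have lin (p : poly4) : p \is 1.-homog -> p @* coords P1 = l1 / l2 * p @* coords P2 ->
      p @* (coords P1 - (l1 / l2) *: coords P2) = 0.
    move=> hp e; rewrite (meval_linear _ hp).
    rewrite (eq_bigr (fun j => coords P1 0 j * p@_U_(j) - l1 / l2 * (coords P2 0 j * p@_U_(j)))).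
      rewrite big_split /= sumrN -mulr_sumr.
      by move: e; rewrite !(meval_linear _ hp) => ->; rewrite subrr.
    by move=> j _; rewrite !mxE mulrBl mulrA.
  case: E1' => e1' e2' e3' e4'; case: E2' => g1' g2' g3' g4'; rewrite fE in e1' e2' e3' e4'.
  have sc (x y a : K) : x = l1 * a -> y = l2 * a -> x = l1 / l2 * y.
    by move=> -> ->; rewrite mulrA divfK.
  apply: inj.
    apply: (tuple3P (P := fun p => p @* (coords P1 - (l1 / l2) *: coords P2) = 0)).
    - exact: (lin _ (isform_homog hX fX1) (sc _ _ _ e1' g1')).
    - exact: (lin _ (isform_homog hX fX2) (sc _ _ _ e2' g2')).
    - exact: (lin _ (isform_homog hX fX3) (sc _ _ _ e3' g3')).
  exact: (lin _ hZ (sc _ _ _ e4' g4')).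
rewrite -(size_map f) (leq_trans _ sL) //.
apply: (@leq_trans (size (vertex :: L))) => //; apply: uniq_leq_size.
  by rewrite map_inj_in_uniq.
by move=> _ /mapP[P Ps ->]; case: (fP P Ps).
Qed.

End Obstructions.

(** A predicate on a type without enumeration has a cardinal as soon as its
    finite lists of distinct elements are bounded: take a longest one. *)
Lemma has_card_bounded (T : eqType) (S : pred T) (n : nat) :
  (forall s : seq T, uniq s -> (forall x, x \in s -> S x) -> (size s <= n)%N) ->
  exists2 m, has_card S m & (m <= n)%N.
Proof.
move=> H; pose A k := `[< exists s : seq T, [/\ uniq s, size s = k & forall x, x \in s -> S x] >].
have A0 : exists k, A k by exists 0%N; apply/asboolP; exists [::].
have Ab k : A k -> (k <= n)%N by move=> /asboolP[s [us <- sS]]; apply: H.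
case: (ex_maxnP A0 Ab) => m /asboolP[s [us sm sS]] mmax.
exists m; last by rewrite -sm H.
exists s; split=> // x; apply/idP/idP => [/sS//|Sx].
apply: contraT => xs; suff /mmax : A m.+1 by rewrite ltnn.
apply/asboolP; exists (x :: s); split; rewrite /= ?xs ?sm //.
by move=> y; rewrite inE => /orP[/eqP->|/sS].
Qed.

Lemma upper_bound (K : closedFieldType) (F : {mpoly K[4]}) : 2%N \in [pchar K] ->
  normal_hypersurface 4 F -> (exists P, inseparable_projection F P) ->
  exists2 m, has_card (singular_point F) m & (m <= 15)%N.
Proof.
move=> /pcharf0 two0 nF [P /(normal_presentation_exists two0)].
case=> X1 [X2 [X3 [Z [k [t [e [ct [fX [B /form4_quartic[c BE] FE]]]]]]]]].
rewrite BE in FE.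
by apply: has_card_bounded; apply: (singular_count two0 nF fX FE ct).
Qed.

(** * Complete integral closedness *)

(** Completely integrally closed: a / b belongs to R once c (a / b)^k does for
    all k with a single nonzero c. *)
Definition cic (R : idomainType) := forall a b c : R, c != 0 ->
  (forall k, exists d, c * a ^+ k = b ^+ k * d) -> exists d, a = b * d.

Lemma cic_field (L : fieldType) : cic L.
Proof.
move=> a b c c0 H; have [b0|b0] := eqVneq b 0.
  have [d /eqP] := H 1%N; rewrite b0 !expr1 mul0r mulf_eq0 (negbTE c0) /= => /eqP->.
  by exists 0; rewrite mul0r.
by exists (a / b); rewrite mulrCA divff ?mulr1.
Qed.

Lemma cic_bij (R S : idomainType) (f : {rmorphism R -> S}) : injective f ->
  (forall y, exists x, f x = y) -> cic S -> cic R.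
Proof.
move=> f_inj f_surj cS a b c c0 H.
have [||d fd] := cS (f a) (f b) (f c).
- by rewrite -(rmorph0 f) (inj_eq f_inj).
- by move=> k; have [d e] := H k; exists (f d); rewrite -!rmorphXn -!rmorphM e.
- by have [x xE] := f_surj d; exists x; apply: f_inj; rewrite rmorphM xE.
Qed.

Section Poly.
Import Pdiv.Idomain.
Variable R : idomainType.
Implicit Types A B C D E : {poly R}.

Lemma power_divisor_const B C : C != 0 -> (forall k, B ^+ k %| C) ->
  exists b, B = b%:P.
Proof.
move=> C0 H; have [B0|B0] := eqVneq B 0; first by exists 0; rewrite B0.
have [sB|sB] := leqP (size B) 1; first by exists B`_0; apply: size1_polyC.
have := dvdp_leq C0 (H (size C)); have sC : (0 < size C)%N by rewrite size_poly_gt0.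
have := size_exp B (size C); move: sB sC.
by case: (size B) => [|[|b]] // _; case: (size C) => // c _ /=; lia.
Qed.

(** Over the fraction field the polynomial ring is principal, and after removal
    of the greatest common divisor all powers of the denominator divide C. *)
Lemma almost_integral_multiple A B C : B != 0 -> C != 0 ->
  (forall k, exists D, C * A ^+ k = B ^+ k * D) ->
  exists2 d, d != 0 & exists E, d *: A = B * E.
Proof.
move=> B0 C0 H; set G := gcdp A B.
have G0 : G != 0 by rewrite gcdp_eq0 negb_and B0 orbT.
have cop : coprimep (A %/ G) (B %/ G).
  by apply: coprimep_div_gcd; rewrite B0 orbT.
have AE := divpK (dvdp_gcdl A B); have BE := divpK (dvdp_gcdr A B).
set a := lead_coef _ ^+ _ in AE; set b := lead_coef _ ^+ _ in BE.
have a0 : a != 0 by rewrite expf_neq0 // lead_coef_eq0.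
have b0 : b != 0 by rewrite expf_neq0 // lead_coef_eq0.
rewrite -/G in AE BE; set A' := A %/ G in AE cop; set B' := B %/ G in BE cop.
have [k|b' B'E] := @power_divisor_const B' C C0.
  have cop' : coprimep (B' ^+ k) (A' ^+ k).
    by apply/coprimep_expl/coprimep_expr; rewrite coprimep_sym.
  rewrite -(Gauss_dvdpl _ cop') -(dvdp_mul2r _ _ (expf_neq0 k G0)).
  rewrite -mulrA -!exprMn AE BE !exprZn -scalerAr.
  rewrite (dvdpZl _ _ (expf_neq0 k b0)) (dvdpZr _ _ (expf_neq0 k a0)).
  by have [D ->] := H k; rewrite dvdp_mulr.
have b'0 : b' != 0.
  apply: contraNneq B0 => z; have := BE; rewrite B'E z polyC0 mul0r => /esym/eqP.
  by rewrite -mul_polyC mulf_eq0 polyC_eq0 (negbTE b0).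
exists (b' * a); first exact: mulf_neq0.
exists (b *: A'); rewrite -scalerA -AE -scalerAr [in RHS]scalerAl -BE B'E.
by rewrite mul_polyC -scalerAl [in LHS]mulrC.
Qed.

Hypothesis cR : cic R.

(** The leading coefficient of E / d is almost integral over R, hence in R;
    subtracting the leading term lowers the degree. *)
Lemma almost_integral_const d C E : C != 0 ->
  (forall k, exists D, C * E ^+ k = d ^+ k *: D) -> exists E', E = d *: E'.
Proof.
move=> C0; have [m] := ubnP (size E); elim: m E => // m IH E sE H.
have [->|E0] := eqVneq E 0; first by exists 0; rewrite scaler0.
have [||l lE] := cR (a := lead_coef E) (b := d) (c := lead_coef C).
- by rewrite lead_coef_eq0.
- move=> k; have [D e] := H k; exists (lead_coef D).
  by rewrite -lead_coef_exp -lead_coefM e lead_coefZ.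
pose X := 'X^((size E).-1) : {poly R}; pose E1 := E - (d * l) *: X.
have s1 : (size E1 < m)%N.
  apply: leq_trans (_ : size E <= m)%N; last exact: sE.
  have sX : (size ((d * l) *: X) <= size E)%N.
    by rewrite -lE size_scale ?lead_coef_eq0 // size_polyXn prednK ?size_poly_gt0.
  rewrite ltnNge; apply/negP => le.
  have se : size E1 = size E.
    apply/eqP; rewrite eqn_leq le andbT.
    apply: leq_trans (size_polyD _ _) _; by rewrite size_polyN geq_max leqnn.
  have : lead_coef E1 = 0.
    rewrite lead_coefE se coefB coefZ coefXn eqxx mulr1 -lE lead_coefE; exact: subrr.
  by move/eqP; rewrite lead_coef_eq0 -size_poly_eq0 se size_poly_eq0 (negbTE E0).
have [k|E' E'E] := IH E1 s1; last first.
  by exists (E' + l *: X); rewrite scalerDr -E'E scalerA subrK.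
have [D DE] := choice H.
exists (\sum_(i < k.+1) (- (l *: X)) ^+ i * D (k - i)%N *+ 'C(k, i)).
rewrite /E1 exprDn mulr_sumr scaler_sumr; apply: eq_bigr => i _.
have le_ik : (i <= k)%N by rewrite -ltnS.
rewrite mulrnAr -scalerMnr; congr (_ *+ _).
rewrite mulrA DE -[in LHS]scalerA -scalerN exprZn -scalerAl -scalerAr.
by rewrite scalerA -exprD subnK // [in RHS]mulrC.
Qed.

Lemma cic_poly : cic {poly R}.
Proof.
move=> A B C C0 H; have [B0|B0] := eqVneq B 0.
  have [D /eqP] := H 1%N; rewrite B0 !expr1 mul0r mulf_eq0 (negbTE C0) /= => /eqP->.
  by exists 0; rewrite mul0r.
have [d d0 [E dE]] := almost_integral_multiple B0 C0 H.
have [k|E' E'E] := @almost_integral_const d C E C0.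
  have [D DE] := H k; exists D; apply: (mulfI (expf_neq0 k B0)).
  by rewrite mulrCA -exprMn -dE exprZn -!scalerAr DE.
exists E'; move: dE; rewrite E'E -scalerAr -!mul_polyC.
by apply: mulfI; rewrite polyC_eq0.
Qed.
End Poly.

Section Mpoly.
Variables (n : nat) (R : idomainType).

Definition last_eval (q : {poly {mpoly R[n]}}) : {mpoly R[n.+1]} :=
  (map_poly (@mwiden n R) q).['X_ord_max].

Lemma monomial_widen (m : 'X_{1..n.+1}) :
  mwiden 'X_[[multinom m (widen_ord (leqnSn n) i) | i < n]] *
    'X_ord_max ^+ m ord_max = 'X_[m] :> {mpoly R[n.+1]}.
Proof.
have widenE : mnmwiden [multinom m (widen_ord (leqnSn n) i) | i < n] =
    [multinom if (i < n)%N then m i else 0%N | i < n.+1].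
  apply/mnmP => i; rewrite mnmE; case: (unliftP ord_max i) => [j ->|->].
    have -> : lift ord_max j = widen_ord (leqnSn n) j.
      by apply: val_inj; rewrite /= /bump leqNgt ltn_ord.
    by rewrite mnmwiden_widen mnmE /= ltn_ord.
  by rewrite mnmwiden_ordmax ltnn.
rewrite mwidenX widenE mpolyXn -mpolyXD; congr 'X_[_].
apply/mnmP => i; rewrite mnmDE mulmnE mnmE mnm1E.
case: ltnP => [lt_in|le_ni].
  by rewrite -val_eqE /= (gtn_eqF lt_in) mul0n addn0.
have -> : i = ord_max by apply/val_inj/eqP; rewrite eqn_leq le_ni -ltnS ltn_ord.
by rewrite eqxx mul1n add0n.
Qed.

Lemma muniK : cancel (@muni n R) last_eval.
Proof.
move=> p; rewrite muniE /last_eval raddf_sum /= horner_sum [RHS]mpolyE.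
apply: eq_bigr => m _; rewrite map_polyZ map_polyXn hornerZ hornerXn /= mwidenZ.
by rewrite -scalerAl monomial_widen.
Qed.

Lemma muni_surj q : exists p, @muni n R p = q.
Proof.
elim/poly_ind: q => [|q c [p <-]]; first by exists 0; rewrite raddf0.
exists (p * 'X_ord_max + mwiden c); rewrite rmorphD rmorphM /=; congr (_ * _ + _).
  rewrite muniE msuppX big_seq1 mcoeffX eqxx scale1r mnm1E eqxx expr1.
  rewrite (_ : [multinom _ | i < n] = 0%MM) ?mpolyX0 ?scale1r //.
  apply/mnmP => i; rewrite mnmE mnm1E mnmE -val_eqE /=.
  by rewrite (gtn_eqF (ltn_ord i)).
rewrite {1}(mpolyE c) (big_morph _ (@mwidenD _ _) (@mwiden0 _ _)).
rewrite (big_morph _ (@muniD _ _) (@muni0 _ _)) [in RHS](mpolyE c) raddf_sum /=.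
apply: eq_bigr => m _.
rewrite mwidenZ mwidenX muniZ muniE msuppX big_seq1 mcoeffX eqxx scale1r.
rewrite mnmwiden_ordmax expr0 alg_polyC -mul_polyC -polyCM mul_mpolyC; congr ((_ *: _)%:P).
by congr 'X_[_]; apply/mnmP => i; rewrite mnmE mnmwiden_widen.
Qed.
End Mpoly.

Lemma cic_mpoly n (R : idomainType) : cic R -> cic {mpoly R[n]}.
Proof.
move=> cR; elim: n => [|n IH].
  apply: (@cic_bij _ _ (@mcoeff 0 R 0%MM)) cR => [p q e|c].
    by rewrite [p]nvar0_mpolyC [q]nvar0_mpolyC; congr (_%:MP).
  by exists c%:MP; rewrite /= mcoeffC eqxx mulr1.
exact: (@cic_bij {mpoly R[n.+1]} {poly {mpoly R[n]}} (@muni n R)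
  (can_inj (@muniK n R)) (@muni_surj n R) (cic_poly IH)).
Qed.

(** * Squares and even polynomials *)

Section Homog.
Variables (R : idomainType) (n : nat).
Implicit Types p q : {mpoly R[n]}.

Lemma pihomogM d k p q : p \is d.-homog ->
  pihomog mdeg (d + k) (p * q) = p * pihomog mdeg k q.
Proof.
move=> hp; rewrite {1}(pihomog_partitionE (leqnn (mmeasure mdeg q))).
set N := mmeasure mdeg q; rewrite mulr_sumr raddf_sum /=.
have term (i : nat) : pihomog mdeg (d + k) (p * pihomog mdeg i q) =
    if i == k then p * pihomog mdeg k q else 0.
  have h : p * pihomog mdeg i q \is (d + i).-homog by apply: dhomogM; rewrite ?pihomogP.
  case: eqVneq => [<-|ik]; first by rewrite pihomog_dE.
  by rewrite (pihomog_ne0 _ h) // eqn_add2l.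
under eq_bigr => i _ do rewrite term.
rewrite -big_mkcond /=.
have [lt|ge] := ltnP k N; first by rewrite (big_pred1 (Ordinal lt)).
rewrite big_pred0 => [|i]; last by rewrite (ltn_eqF (leq_trans (ltn_ord i) ge)).
suff -> : pihomog mdeg k q = 0 by rewrite mulr0.
rewrite pihomogE big_seq_cond big_pred0 // => m; apply/andP => -[mq /eqP mk].
by have := mmeasure_mnm_lt mdeg mq; rewrite mk ltnNge ge.
Qed.

(** Compare homogeneous components of degree d + k. *)
Lemma homog_factor d k p q : p != 0 -> p \is d.-homog -> p * q \is (d + k).-homog ->
  q \is k.-homog.
Proof.
move=> p0 hp hpq; have := pihomogM k q hp; rewrite pihomog_dE // => /(mulfI p0) ->.
exact: pihomogP.
Qed.

Lemma homog_cofactor d e k p q : p != 0 -> p \is d.-homog -> p * q \is e.-homog ->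
  (d + k)%N = e -> q \is k.-homog.
Proof. by move=> p0 hp hpq de; apply: homog_factor p0 hp _; rewrite de. Qed.

(** In characteristic two these are the polynomials in the squares of the
    variables. *)
Definition even p := forall i, p^`M(i) = 0.

Lemma even_cofactor p q : p != 0 -> even p -> even (p * q) -> even q.
Proof.
move=> p0 hp hpq i; apply: (mulfI p0); rewrite mulr0 -[RHS](hpq i).
by rewrite mderivM hp mul0r add0r.
Qed.

Hypothesis two0 : 2%:R = 0 :> R.

Lemma even_sqr p : even (p ^+ 2).
Proof. by move=> i; rewrite expr2 mderivM; ring: (two0_mpoly two0 n). Qed.
End Homog.

Section Frobenius.
Variables (K : closedFieldType) (two0 : 2%:R = 0 :> K) (n : nat).
Implicit Types p q : {mpoly K[n]}.

Lemma sum_sqr (R : comNzRingType) (I : Type) (r : seq I) (f : I -> R) :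
  2%:R = 0 :> R -> \sum_(i <- r) f i ^+ 2 = (\sum_(i <- r) f i) ^+ 2.
Proof.
move=> t0; elim/big_rec2: _ => [|i x y _ ->]; first by rewrite expr0n.
ring: t0.
Qed.

Lemma even_square p : even p -> exists q, p = q ^+ 2.
Proof.
move=> ep; pose half (m : 'X_{1..n}) := [multinom (m i)./2 | i < n].
exists (\sum_(m <- msupp p) sq p@_m *: 'X_[half m]).
rewrite -(sum_sqr _ _ (two0_mpoly two0 n)) {1}[p]mpolyE big_seq [RHS]big_seq.
apply: eq_bigr => m mp; rewrite exprZn sqK mpolyXn; congr (_ *: 'X_[_]).
apply/mnmP => i; rewrite mulmnE mnmE muln2.
suff /negbTE oi : ~~ odd (m i) by rewrite -[LHS]odd_double_half oi.
apply/negP => oi; have mi : (0 < m i)%N by case: (m i) oi.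
have := congr1 (fun q => q@_(m - U_(i))) (ep i).
rewrite mcoeff_mderiv mcoeff0 submK; last first.
  by apply/mnm_lepP => j; rewrite mnm1E; case: eqVneq => // <-.
rewrite mnmBE mnm1E eqxx subn1 prednK // -mulr_natr => /eqP.
rewrite mulf_eq0 mcoeff_eq0 mp /= -[m i]odd_double_half oi natrD -muln2 natrM two0.
by rewrite mulr0 addr0 oner_eq0.
Qed.

Definition squares : n.-tuple {mpoly K[n]} := [tuple 'X_i ^+ 2 | i < n].

Lemma squaresX (m : 'X_{1..n}) : 'X_[m] \mPo squares = 'X_[m] ^+ 2 :> {mpoly K[n]}.
Proof.
rewrite comp_mpolyX mpolyXE_id -prodrXl; apply: eq_bigr => i _.
by rewrite tnth_mktuple exprAC.
Qed.

(** Squares of the variables have been substituted; over a perfect field the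
    result is a square, and frobenius_twist is the converse. *)
Lemma frobenius_root d p : p \is d.-homog ->
  exists2 q, q \is d.-homog & p \mPo squares = q ^+ 2.
Proof.
move=> /dhomogP hp; exists (\sum_(m <- msupp p) sq p@_m *: 'X_[m]).
  rewrite big_seq; apply: rpred_sum => m /hp dm; apply: rpredZ.
  by rewrite dhomogX; apply/eqP.
rewrite -(sum_sqr _ _ (two0_mpoly two0 n)) {1}[p]mpolyE raddf_sum /=.
by apply: eq_bigr => m _; rewrite comp_mpolyZ squaresX exprZn sqK.
Qed.

Lemma frobenius_twist d q : q \is d.-homog ->
  exists2 p, p \is d.-homog & p \mPo squares = q ^+ 2.
Proof.
move=> /dhomogP hq; exists (\sum_(m <- msupp q) q@_m ^+ 2 *: 'X_[m]).
  rewrite big_seq; apply: rpred_sum => m /hq dm; apply: rpredZ.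
  by rewrite dhomogX; apply/eqP.
rewrite {3}[q]mpolyE -(sum_sqr _ _ (two0_mpoly two0 n)) raddf_sum /=.
by apply: eq_bigr => m _; rewrite comp_mpolyZ squaresX exprZn.
Qed.

Lemma frobenius_inj p : p \mPo squares = 0 -> p = 0.
Proof.
rewrite {1}[p]mpolyE raddf_sum /=.
rewrite (eq_bigr (fun m => (sq p@_m *: 'X_[m]) ^+ 2)) => [|m _]; last first.
  by rewrite comp_mpolyZ squaresX exprZn sqK.
rewrite (sum_sqr _ _ (two0_mpoly two0 n)) => /eqP; rewrite sqrf_eq0 => /eqP e.
apply/mpolyP => m; rewrite mcoeff0; case: (boolP (m \in msupp p)) => [mp|].
  have /eqP := congr1 (mcoeff m) e; rewrite mcoeff0 raddf_sum /= (bigD1_seq m) //=.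
  rewrite big1 => [|i im]; last by rewrite mcoeffZ mcoeffX (negbTE im) mulr0.
  by rewrite mcoeffZ mcoeffX eqxx mulr1 addr0 -sqrf_eq0 sqK => /eqP.
exact: memN_msupp_eq0.
Qed.

End Frobenius.

Lemma X0_factor (R : comNzRingType) (p : {mpoly R[3]}) :
  p \mPo [tuple 0; 'X_1; 'X_(2%:R)] = 0 :> {mpoly R[3]} -> exists q, p = 'X_0 * q.
Proof.
set L := [tuple _; _; _] => p0.
suff [q qE] : exists q, p = p \mPo L + 'X_0 * q by exists q; rewrite qE p0 add0r.
rewrite {1 2}[p]mpolyE raddf_sum /=.
elim/big_rec2: _ => [|m x y _ [q ->]]; first by exists 0; rewrite mulr0 addr0.
rewrite comp_mpolyZ comp_mpolyX mpolyXE_id !big_ord3 /= /tnth /=.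
case: (m 0) => [|k]; first by exists q; rewrite !expr0 addrA.
exists (q + p@_m *: ('X_0 ^+ k * 'X_1 ^+ m 1%R * 'X_(2%:R) ^+ m 2%:R)).
rewrite exprS expr0n /= !mul0r scaler0 add0r mulrDr [LHS]addrC -addrA; congr (_ + (_ + _)).
by rewrite -scalerAr !mulrA.
Qed.

(** * The parametrized surface *)

Lemma comp_scale (R : comNzRingType) n k d (p : {mpoly R[n]}) c (L L' : n.-tuple {mpoly R[k]}) :
  p \is d.-homog -> (forall i, tnth L' i = c * tnth L i) -> p \mPo L' = c ^+ d * (p \mPo L).
Proof.
move=> /dhomogP hp LE; rewrite !comp_mpolyEX mulr_sumr.
rewrite big_seq [RHS]big_seq; apply: eq_bigr => m /hp <-.
rewrite !comp_mpolyX -scalerAr; congr (_ *: _).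
under eq_bigr do rewrite LE exprMn.
by rewrite big_split /= -expr_sum mdegE.
Qed.

Lemma last_variable_expansion (R : idomainType) n d (a : {mpoly R[n.+1]}) :
  a \is d.-homog -> exists2 c : nat -> {mpoly R[n]},
    forall i, c i \is (d - i).-homog &
    a = \sum_(i < d.+1) mwiden (c i) * 'X_ord_max ^+ i.
Proof.
move=> /dhomogP ha; rewrite [a]mpolyE big_seq.
elim/big_ind: _ => [|a1 a2 [c1 h1 ->] [c2 h2 ->]|m /ha dm].
- by exists (fun=> 0) => [i|]; rewrite ?dhomog0 // big1 // => i _; rewrite mwiden0 mul0r.
- exists (fun i => c1 i + c2 i) => [i|]; first exact: rpredD.
  by rewrite -big_split; apply: eq_bigr => i _ /=; rewrite mwidenD mulrDl.
pose m' := [multinom m (widen_ord (leqnSn n) i) | i < n].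
have dE : (mdeg m' + m ord_max)%N = d.
  rewrite -dm mdegE /= mdegE [RHS]big_ord_recr /=; congr (_ + _)%N.
  by apply: eq_bigr => i _; rewrite mnmE.
exists (fun i => if i == m ord_max :> nat then a@_m *: 'X_[m'] else 0) => [i|].
  by case: eqP => [->|_]; rewrite ?dhomog0 // dhomogZ // dhomogX -dE addnK eqxx.
have lt : (m ord_max < d.+1)%N by rewrite ltnS -dE leq_addl.
rewrite (bigD1 (Ordinal lt)) //= eqxx big1 => [|i im].
  by rewrite addr0 mwidenZ -scalerAl monomial_widen.
by rewrite (_ : (i == m ord_max :> nat) = false) ?mwiden0 ?mul0r //; apply: negbTE im.
Qed.

Section Surface.
Variables (K : closedFieldType) (two0 : 2%:R = 0 :> K).
Local Notation T := {mpoly K[3]}.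
Let t0 := two0_mpoly two0 3.
Local Notation fr p := (p \mPo squares K 3).

Definition conic : T := 'X_0 * 'X_1 + 'X_(2%:R) ^+ 2.
Definition branch : T := 'X_0 * 'X_(2%:R) ^+ 3 + 'X_1 ^+ 3 * 'X_(2%:R) + 'X_0 ^+ 4.
Definition surface : {mpoly K[4]} := 'X_ord_max ^+ 2 * mwiden conic + mwiden branch.
Local Notation H := (conic * branch).

(** The parametrization x_i = s_i^2, z = B(s) / Q(s), made homogeneous by the
    factor Q(s): a form of degree d goes to Q^d times its value there.  The
    squares of Q(s) and B(s) are Q(x) and B(x), as the coefficients of Q and B
    are 0 and 1. *)
Definition param : 4.-tuple T :=
  [tuple if unlift ord_max i is Some j then conic * 'X_j ^+ 2 else branch | i < 4].
Local Notation phi p := (p \mPo param).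

Lemma homog_X n i : ('X_i : {mpoly K[n]}) \is 1.-homog.
Proof. by rewrite dhomogX; apply/eqP/mdeg1. Qed.

Ltac form_degree := repeat first
  [ exact: homog_X | apply: rpredD | eapply homogM | eapply homogX | reflexivity ].

Lemma conic_homog : conic \is 2.-homog.
Proof. by rewrite /conic; apply: rpredD; form_degree. Qed.

Lemma branch_homog : branch \is 4.-homog.
Proof. by rewrite /branch; form_degree. Qed.

Lemma phi_last : phi 'X_ord_max = branch.
Proof. by rewrite comp_mpolyXU -tnth_nth tnth_mktuple unlift_none. Qed.

Lemma phi_widen d (p : T) : p \is d.-homog -> phi (mwiden p) = conic ^+ d * fr p.
Proof.
move=> hp; rewrite mwiden_comp; apply: comp_scale hp _ => i.
rewrite !tnth_mktuple (_ : widen_ord _ i = lift ord_max i) ?liftK //.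
by apply: val_inj; rewrite /= /bump leqNgt ltn_ord.
Qed.

Lemma phi_homog d (a : {mpoly K[4]}) : a \is d.-homog -> phi a \is (4 * d).-homog.
Proof.
apply: comp_homogM => i; rewrite tnth_mktuple.
case: unliftP => [j _|_]; last exact: branch_homog.
by apply: homogM conic_homog _ _; first exact: homogX (homog_X _) _.
Qed.

Lemma conic_twist : fr conic = conic ^+ 2.
Proof.
rewrite /conic !(rmorphXn, rmorphD, rmorphM) /= !comp_mpolyXU -!tnth_nth !tnth_mktuple.
ring: t0.
Qed.

Lemma branch_twist : fr branch = branch ^+ 2.
Proof.
rewrite /branch !(rmorphXn, rmorphD, rmorphM) /= !comp_mpolyXU -!tnth_nth !tnth_mktuple.
ring: t0.
Qed.

Lemma phi_surface : phi surface = 0.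
Proof.
rewrite /surface [LHS]rmorphD [X in X + _ = _]rmorphM [X in X * _ + _ = _]rmorphXn /= phi_last.
rewrite (phi_widen conic_homog) (phi_widen branch_homog) conic_twist branch_twist.
ring: t0.
Qed.

Let dX (i j : 'I_3) : ('X_j)^`M(i) = (i == j)%:R :> T.
Proof.
rewrite mderivX mnm1E eq_sym; case: eqVneq => [->|_]; last by rewrite scale0r.
rewrite scale1r (_ : (_ - _)%MM = 0%MM) ?mpolyX0 //.
by apply/mnmP => k; rewrite mnmBE subnn mnm0E.
Qed.

Let d0X (i : 'I_3) : (1 : T)^`M(i) = 0.
Proof. exact: mderivC. Qed.

Lemma H12 : H^`M(0)^`M(1) = 'X_0 ^+ 4.
Proof.
rewrite /conic /branch !exprS !expr0.
rewrite !(mderivD, mderivM, dX, d0X, mderiv0, mderivMn) /=.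
ring: t0.
Qed.

Lemma H13 : H^`M(0)^`M(2%:R) = ('X_1 + 'X_(2%:R)) ^+ 4.
Proof.
rewrite /conic /branch !exprS !expr0.
rewrite !(mderivD, mderivM, dX, d0X, mderiv0, mderivMn) /=.
ring: t0.
Qed.

(** In even degree 2 D the terms c_i z^i go to Q^(2 D - i) B^i times the square
    of a form; sorted by the parity of i they give a square and Q B times a
    square. *)
Lemma squares_split D (a : {mpoly K[4]}) : (0 < D)%N -> a \is (2 * D).-homog ->
  exists r t, [/\ r \is (4 * D).-homog, t \is (4 * D - 3).-homog &
    phi a = r ^+ 2 + t ^+ 2 * H].
Proof.
move=> D0 ha; have [c hc ->] := last_variable_expansion ha.
elim/big_ind: _ => [|a1 a2 [r1 [u1 [h1 g1 e1]]] [r2 [u2 [h2 g2 e2]]]|i _].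
- by exists 0, 0; rewrite !dhomog0 rmorph0; split=> //; ring: t0.
- exists (r1 + r2), (u1 + u2); rewrite !rpredD // rmorphD /= e1 e2; split=> //.
  ring: t0.
have [s hs sE] := frobenius_root two0 (hc i).
have le_i : (i <= 2 * D)%N by rewrite -ltnS.
have -> : phi (mwiden (c i) * 'X_ord_max ^+ i) = conic ^+ (2 * D - i) * s ^+ 2 * branch ^+ i.
  by rewrite [LHS]rmorphM [X in _ * X = _]rmorphXn /= phi_last (phi_widen (hc i)) sE.
have cX k : conic ^+ k \is (2 * k).-homog := dhomogMn k conic_homog.
have bX k : branch ^+ k \is (4 * k).-homog := dhomogMn k branch_homog.
have [k [iE|iE]] : exists k, (i = k * 2 :> nat)%N \/ (i = (k * 2).+1 :> nat)%N.
    by exists i./2; lia.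
- exists (conic ^+ (D - k) * s * branch ^+ k), 0; split; last 1 first.
  + rewrite iE (_ : 2 * D - _ = (D - k) * 2)%N ?exprM; first ring: t0.
    lia.
  + by apply: homogM (bX _) _; [exact: homogM (cX _) hs (erefl _)|lia].
  + exact: dhomog0.
- exists 0, (conic ^+ (D - k.+1) * s * branch ^+ k); split; last 1 first.
  + rewrite iE (_ : 2 * D - _ = ((D - k.+1) * 2).+1)%N ?exprS ?exprM; first ring: t0.
    lia.
  + exact: dhomog0.
  + by apply: homogM (bX _) _; [exact: homogM (cX _) hs (erefl _)|lia].
Qed.

End Surface.

Section Surface.
Variables (K : closedFieldType) (two0 : 2%:R = 0 :> K).
Local Notation T := {mpoly K[3]}.
Let t0 := two0_mpoly two0 3.
Local Notation fr p := (p \mPo squares K 3).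
Local Notation Q := (conic K).
Local Notation B := (branch K).
Local Notation H := (Q * B).
Local Notation phi p := (p \mPo param K).

Lemma even_mderivM (p q : T) i : even p -> (p * q)^`M(i) = p * q^`M(i).
Proof. by move=> hp; rewrite mderivM hp mul0r add0r. Qed.

(** Squares are constants for all derivations, so second derivatives isolate
    the coefficient of Q B. *)
Lemma squares_deriv (r t : T) i j :
  (r ^+ 2 + t ^+ 2 * H)^`M(i)^`M(j) = t ^+ 2 * H^`M(i)^`M(j).
Proof.
have er := even_sqr two0 r; have et := even_sqr two0 t.
by rewrite mderivD er add0r !(even_mderivM _ _ et).
Qed.

Lemma X_neq0 (i : 'I_3) : 'X_i != 0 :> T.
Proof.
apply/eqP => /(congr1 (mcoeff U_(i))) /eqP.
by rewrite mcoeffX eqxx mcoeff0 oner_eq0.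
Qed.

Lemma squares_eq0 (r t : T) : r ^+ 2 + t ^+ 2 * H = 0 -> r = 0 /\ t = 0.
Proof.
move=> e; have := squares_deriv r t 0 1; rewrite e !mderiv0 (H12 two0) => /esym/eqP.
rewrite mulf_eq0 !expf_eq0 (negbTE (X_neq0 0)) /= orbF => /eqP t_0; split=> //.
by move/eqP: e; rewrite t_0 expr0n mul0r addr0 sqrf_eq0 => /eqP.
Qed.

(** The first variable does not divide X1 + X2. *)
Lemma X0_power_factor k (x y : T) : 'X_0 ^+ k * x = ('X_1 + 'X_(2%:R)) ^+ 4 * y ->
  exists z, y = 'X_0 ^+ k * z.
Proof.
elim: k x y => [|k IH] x y e; first by exists y; rewrite mul1r.
have [y' yE] : exists y', y = 'X_0 * y'.
  apply: X0_factor; set L := [tuple _; _; _].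
  have /esym/eqP : 0 = ('X_1 + 'X_(2%:R)) ^+ 4 * (y \mPo L) :> T.
    have sL : ('X_1 + 'X_(2%:R)) \mPo L = 'X_1 + 'X_(2%:R).
      by rewrite rmorphD /= !comp_mpolyXU -!tnth_nth.
    rewrite -{1}sL -[X in X * _](rmorphXn (comp_mpoly L)) -[RHS]rmorphM -e.
    by rewrite [RHS]rmorphM [X in X * _]rmorphXn /= comp_mpolyXU -tnth_nth exprS !mul0r.
  rewrite mulf_eq0 => /orP[|/eqP //]; rewrite expf_eq0 /= => /eqP s0.
  have /eqP := congr1 (mcoeff U_(1%R : 'I_3)) s0.
  have ne : (U_(2%:R) == U_(1%R) :> 'X_{1..3})%MM = false.
    by apply/negbTE/eqP => /(congr1 (fun m : 'X_{1..3} => m 1%R)); rewrite !mnm1E.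
  by rewrite mcoeffD !mcoeffX eqxx mcoeff0 ne addr0 oner_eq0.
have [|z zE] := IH x y'; last by exists z; rewrite yE zE exprS mulrA.
apply: (mulfI (X_neq0 0)); rewrite mulrA -exprS e yE; ring.
Qed.

(** Multiplied by the square of phi m, the polynomial E has the required shape.
    The two second derivatives of Q B being coprime, the coefficient t^2 is
    divisible by that square, and cofactors of even polynomials are even. *)
Lemma squares_cofactor D e (m n : {mpoly K[4]}) (E : T) : (0 < D)%N ->
  m \is e.-homog -> n \is (2 * D + e).-homog -> phi m != 0 -> phi n = phi m * E ->
  exists r t, [/\ r \is (4 * D).-homog, t \is (4 * D - 3).-homog &
    E = r ^+ 2 + t ^+ 2 * H].
Proof.
move=> D0 hm hn m0 nE.
(* The factor m makes the degree even and turns phi m into a square. *)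
have hnm : n * m \is (2 * (D + e)).-homog.
  by apply: homogM hn hm _; lia.
have [|r [t [hr ht rtE]]] := squares_split two0 _ hnm; first by lia.
have {rtE} rtE : phi m ^+ 2 * E = r ^+ 2 + t ^+ 2 * H.
  by rewrite -rtE [RHS]rmorphM /= nE; ring.
have em := even_sqr two0 (phi m); have m20 : phi m ^+ 2 != 0 by rewrite sqrf_eq0.
have hphi := phi_homog hm.
have e12 : phi m ^+ 2 * E^`M(0)^`M(1) = t ^+ 2 * 'X_0 ^+ 4.
  by rewrite -(H12 two0) -(squares_deriv r) -rtE !(even_mderivM _ _ em).
have e13 : phi m ^+ 2 * E^`M(0)^`M(2%:R) = t ^+ 2 * ('X_1 + 'X_(2%:R)) ^+ 4.
  by rewrite -(H13 two0) -(squares_deriv r) -rtE !(even_mderivM _ _ em).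
have [|b bE] := @X0_power_factor 4 E^`M(0)^`M(2%:R) E^`M(0)^`M(1).
  apply: (mulfI m20); rewrite mulrCA e13 [RHS]mulrCA e12; ring.
have X4 : 'X_0 ^+ 4 != 0 :> T by rewrite expf_neq0 ?X_neq0.
have tE : t ^+ 2 = phi m ^+ 2 * b.
  by apply: (mulIf X4); rewrite -e12 bE; ring.
have [u uE] : exists u, b = u ^+ 2.
  apply: (even_square two0); apply: (even_cofactor m20 em).
  by rewrite -tE; apply: even_sqr.
have rE : r ^+ 2 = phi m ^+ 2 * (E + b * H).
  by rewrite mulrDr mulrA -tE rtE; ring: t0.
have [v vE] : exists v, E + b * H = v ^+ 2.
  apply: (even_square two0); apply: (even_cofactor m20 em).
  by rewrite -rE; apply: even_sqr.
have rv : r = phi m * v.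
  by apply: (sqr_inj2 t0); rewrite /= rE vE exprMn.
have tu : t = phi m * u.
  by apply: (sqr_inj2 t0); rewrite /= tE uE exprMn.
exists v, u; split.
- by apply: (homog_cofactor m0 hphi (e := 4 * (D + e))); rewrite -?rv //; lia.
- by apply: (homog_cofactor m0 hphi (e := 4 * (D + e) - 3)); rewrite -?tu //; lia.
by rewrite -vE -uE; ring: t0.
Qed.

End Surface.

(** * Behaviour along the tangent cone *)

Lemma mpoly_morph_ext (R : comNzRingType) n (S : comNzRingType)
    (f h : {rmorphism {mpoly R[n]} -> S}) :
  (forall c, f c%:MP = h c%:MP) -> (forall i, f 'X_i = h 'X_i) -> f =1 h.
Proof.
move=> fC fX p; rewrite [p]mpolyE !raddf_sum; apply: eq_bigr => m _ /=.
rewrite -mul_mpolyC !rmorphM fC mpolyXE_id !rmorph_prod; congr (_ * _).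
by apply: eq_bigr => i _; rewrite !rmorphXn fX.
Qed.

(** Apply complete integral closedness to t / b, whose even powers are w^i. *)
Lemma square_divides (R : idomainType) (t b w : R) : cic R -> b != 0 ->
  t ^+ 2 = b ^+ 2 * w -> exists d, t = b * d.
Proof.
move=> cR b0 e; apply: (cR _ _ b) => // k.
have even_case i : t ^+ (2 * i) = b ^+ (2 * i) * w ^+ i by rewrite !exprM e exprMn.
have [i [->|->]] : exists i, k = (2 * i)%N \/ k = (2 * i).+1.
- by exists k./2; lia.
- by exists (b * w ^+ i); rewrite even_case; ring.
- by exists (w ^+ i * t); rewrite !exprS even_case; ring.
Qed.

(** 1 + b x is invertible modulo every power of b. *)
Lemma divides_one_add (R : idomainType) (b t x w : R) k : b != 0 ->
  t * (1 + b * x) = b ^+ k * w -> exists d, t = b ^+ k * d.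
Proof.
move=> b0; elim: k w => [|k IH] w e; first by exists t; rewrite mul1r.
have [|d dE] := IH (b * w); first by rewrite e exprSr mulrA.
exists (w - x * d); rewrite exprSr -mulrA mulrBr.
have : d * (1 + b * x) = b * w.
  by apply: (mulfI (expf_neq0 k b0)); rewrite mulrA -dE e exprSr mulrA.
by move=> <-; rewrite dE; congr (_ * _); ring.
Qed.

Lemma mwiden_homog (R : idomainType) n d (p : {mpoly R[n]}) :
  p \is d.-homog -> mwiden p \is d.-homog.
Proof.
move=> /dhomogP hp; rewrite [p]mpolyE (big_morph _ (@mwidenD _ _) (@mwiden0 _ _)).
rewrite big_seq; apply: rpred_sum => m /hp <-.
rewrite mwidenZ mwidenX; apply: dhomogZ; rewrite dhomogX /= mdegE big_ord_recr /=.
rewrite mnmwiden_ordmax addn0 mdegE; apply/eqP/eq_bigr => i _.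
by rewrite mnmwiden_widen.
Qed.

Section Surface.
Variables (K : closedFieldType) (two0 : 2%:R = 0 :> K).
Local Notation T := {mpoly K[3]}.
Let t0 := two0_mpoly two0 3.
Let p0 := two0_poly two0.
Let pp0 := two0_poly (two0_poly two0).
Local Notation fr p := (p \mPo squares K 3).
Local Notation Q := (conic K).
Local Notation B := (branch K).
Local Notation H := (Q * B).
Local Notation phi p := (p \mPo param K).

(** The value of B on the conic (v^2 : 1 : v); its roots are the lines of X on
    the tangent cone. *)
Definition rulings : {poly K} := 'X^8 + 'X^5 + 'X.
Local Notation g := rulings.

Definition conic_param (i : 'I_3) : {poly K} := [tuple 'X^2; 1; 'X]`_i.
(** Restriction to the conic Q = 0. *)
Definition bar : {mpoly K[3]} -> {poly K} := mmap (@polyC K) conic_param.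
HB.instance Definition _ := GRing.RMorphism.on bar.

(** In this chart Q becomes g y and B becomes g (1 + y r), so that the factor g
    cancels from z = B / Q. *)
Definition nearby_param (i : 'I_3) : {poly {poly K}} :=
  [tuple g%:P * 'X + ('X^2)%:P; 1; ('X)%:P]`_i.
Definition psi : {mpoly K[3]} -> {poly {poly K}} :=
  mmap (polyC \o @polyC K) nearby_param.
HB.instance Definition _ := GRing.RMorphism.on psi.

Lemma barX i : bar 'X_i = conic_param i.
Proof. by rewrite /bar mmapX mmap1U. Qed.

Lemma psiX i : psi 'X_i = nearby_param i.
Proof. by rewrite /psi mmapX mmap1U. Qed.

Lemma psi_bar p : (psi p)`_0 = bar p.
Proof.
rewrite -horner_coef0 -[LHS]/((horner_eval 0 \o psi) p).
apply: mpoly_morph_ext p => [c|i] /=.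
  by rewrite /psi /bar !mmapC /= /horner_eval hornerC.
rewrite psiX barX /horner_eval /nearby_param /conic_param.
by case: i => -[|[|[|//]]] i /=; rewrite !hornerE.
Qed.

Lemma bar_branch : bar B = g.
Proof.
rewrite /branch !(rmorphXn, rmorphD, rmorphM) /= !barX /conic_param /= /g.
ring: p0.
Qed.

Lemma polyC_Xn k : ('X^k)%:P = 'X%:P ^+ k :> {poly {poly K}}.
Proof. exact: rmorphXn. Qed.

Lemma psi_conic : psi Q = g%:P * 'X.
Proof.
have -> : psi Q = psi 'X_0 * psi 'X_1 + psi 'X_(2%:R) ^+ 2.
  by rewrite /conic !(rmorphXn, rmorphD, rmorphM).
by rewrite !psiX /nearby_param /= polyC_Xn; ring: pp0.
Qed.

Lemma psi_branch : psi B = g%:P * (1 + 'X * ('X%:P ^+ 3 + (g%:P * 'X) ^+ 3)).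
Proof.
have -> : psi B = psi 'X_0 * psi 'X_(2%:R) ^+ 3 + psi 'X_1 ^+ 3 * psi 'X_(2%:R) +
    psi 'X_0 ^+ 4.
  by rewrite /branch !(rmorphXn, rmorphD, rmorphM).
rewrite !psiX /nearby_param /= polyC_Xn.
have gE : g%:P = 'X%:P ^+ 8 + 'X%:P ^+ 5 + 'X%:P :> {poly {poly K}}.
  by rewrite /g !polyCD !polyC_Xn.
transitivity (g%:P * ('X * ('X%:P ^+ 3 + (g%:P * 'X) ^+ 3)) + g%:P); last by ring.
rewrite {5}gE; ring: pp0.
Qed.

Lemma rulings_neq0 : g != 0.
Proof.
apply/eqP => /(congr1 (coefp 1)) /eqP.
by rewrite /= !coefE /= !add0r oner_eq0.
Qed.

Lemma size_rulings : size g = 9%N.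
Proof.
by rewrite /g -addrA size_polyDl size_polyXn // size_polyDl ?size_polyXn ?size_polyX.
Qed.

Definition lift_monomial m k : T :=
  if odd k then 'X_0 ^+ k./2 * 'X_1 ^+ (m - 1 - k./2) * 'X_(2%:R)
  else 'X_0 ^+ k./2 * 'X_1 ^+ (m - k./2).

(** A form of degree m with prescribed restriction to the conic: v^2 and v lift
    to s1 and s3, and s2, which restricts to 1, makes up the degree. *)
Definition conic_lift m (q : {poly K}) : T := \sum_(k < (2 * m).+1) q`_k *: lift_monomial m k.

Lemma conic_lift_homog m q : conic_lift m q \is m.-homog.
Proof.
rewrite /conic_lift; apply: rpred_sum => -[k /= lek] _; apply: dhomogZ.
have XH (i : 'I_3) e : ('X_i ^+ e : T) \is e.-homog.
  by apply: homogX (homog_X _ _) _; rewrite mul1n.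
rewrite /lift_monomial; case: ifP => ok.
  by apply: homogM (homog_X _ _) _; [exact: homogM (XH _ _) (XH _ _) (erefl _)|lia].
by apply: homogM (XH _ _) (XH _ _) _; lia.
Qed.

Lemma bar_conic_lift m (q : {poly K}) : bar (conic_lift m q) = \poly_(k < (2 * m).+1) q`_k.
Proof.
rewrite /conic_lift raddf_sum poly_def; apply: eq_bigr => k _ /=.
rewrite -mul_mpolyC rmorphM /= {1}/bar mmapC -mul_polyC; congr (_ * _).
rewrite /lift_monomial; case: ifP => ok; rewrite !(rmorphXn, rmorphM) /= !barX
  /conic_param /= expr1n mulr1 -exprM -?exprSr; congr (_ ^+ _); lia.
Qed.

Lemma bar_conic_lift_id m (q : {poly K}) : (size q <= (2 * m).+1)%N -> bar (conic_lift m q) = q.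
Proof.
move=> sq; rewrite bar_conic_lift; apply/polyP => j; rewrite coef_poly.
by case: ltnP => // le; rewrite nth_default // (leq_trans sq).
Qed.

Lemma conic_liftD m : {morph conic_lift m : p q / p + q}.
Proof.
move=> p q; rewrite /conic_lift -big_split; apply: eq_bigr => k _ /=.
by rewrite coefD scalerDl.
Qed.

Lemma lift_monomialE m k c : (k <= 2 * m)%N ->
  conic_lift m (c *: 'X^k) = c *: lift_monomial m k.
Proof.
rewrite -ltnS => lt; rewrite /conic_lift (bigD1 (Ordinal lt)) //= coefZ coefXn eqxx mulr1.
rewrite big1 ?addr0 // => i ik; rewrite coefZ coefXn.
by rewrite (_ : (i == k :> nat) = false) ?mulr0 ?scale0r //; apply/negbTE.
Qed.

(** Modulo Q one may replace s3^2 by s1 s2. *)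
Lemma conic_division m a : a \is m.-homog -> exists2 a1,
  a1 \is (m - 2).-homog /\ ((m < 2)%N -> a1 = 0) & a = Q * a1 + conic_lift m (bar a).
Proof.
move=> /dhomogP ha; rewrite [a]mpolyE big_seq.
elim/big_ind: _ => [|a2 a3 [b2 [h2 z2] e2] [b3 [h3 z3] e3]|t /ha dt].
- exists 0; first by rewrite dhomog0.
  rewrite mulr0 add0r rmorph0 /conic_lift big1 // => i _; by rewrite coef0 scale0r.
- exists (b2 + b3); first by split=> [|lt]; [exact: rpredD|rewrite z2 // z3 // addr0].
  by rewrite rmorphD conic_liftD /= {1}e2 {1}e3; ring.
have tE : 'X_[t] = 'X_0 ^+ t 0 * 'X_1 ^+ t 1 * 'X_(2%:R) ^+ t 2%:R :> T.
  by rewrite mpolyXE_id big_ord3.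
have {dt} : (t 0%R + t 1%R + t 2%:R%R)%N = m by rewrite -dt /= mdegE big_ord3.
rewrite tE; move: (t 0) (t 1) (t 2%:R) (a@_t) => i j k c dm.
have barE : bar (c *: ('X_0 ^+ i * 'X_1 ^+ j * 'X_(2%:R) ^+ k)) = c *: 'X^(2 * i + k).
  rewrite -mul_mpolyC rmorphM /= {1}/bar mmapC -mul_polyC; congr (_ * _).
  rewrite !(rmorphXn, rmorphM) /= !barX /conic_param /= expr1n mulr1 -exprM -exprD.
  by [].
rewrite barE lift_monomialE; last by lia.
have [l [b kE]] : exists l (b : bool), k = (l * 2 + b)%N.
  by exists k./2, (odd k); lia.
pose S : T := \sum_(u < l) ('X_(2%:R) ^+ 2) ^+ (l.-1 - u) * ('X_0 * 'X_1) ^+ u.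
have XH (u : 'I_3) e : ('X_u ^+ e : T) \is e.-homog.
  by apply: homogX (homog_X _ _) _; rewrite mul1n.
have SE : Q * S = ('X_(2%:R) ^+ 2) ^+ l + ('X_0 * 'X_1) ^+ l.
  rewrite -[X in _ + X](opp2 t0) subrXX; congr (_ * _).
  by rewrite /conic (opp2 t0) addrC.
exists (c *: ('X_0 ^+ i * 'X_1 ^+ j * 'X_(2%:R) ^+ b * S)).
  split=> [|m2]; last first.
    by rewrite /S (_ : l = 0%N) ?big_ord0 ?mulr0 ?scaler0 //; lia.
  case: (posnP l) => [l0|l0].
    by rewrite /S l0 big_ord0 mulr0 scaler0 dhomog0.
  apply: dhomogZ; apply: (homogM (e := 2 * l.-1) (homogM (homogM (XH _ _) (XH _ _)
    (erefl _)) (XH _ _) (erefl _))); last by lia.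
  apply: rpred_sum => -[u /= ul] _.
  apply: (homogM (homogX (XH _ _) (erefl _)) (homogX (homogM (homog_X _ _) (homog_X _ _)
    (erefl _)) (erefl _))); lia.
rewrite -scalerAr -scalerDr; congr (_ *: _).
have -> : lift_monomial m (2 * i + k) =
    'X_0 ^+ i * 'X_1 ^+ j * 'X_(2%:R) ^+ b * ('X_0 * 'X_1) ^+ l.
  rewrite /lift_monomial (_ : odd (2 * i + k) = b); last by lia.
  rewrite (_ : (2 * i + k)./2 = i + l)%N; last by lia.
  case: b kE => kE; rewrite exprMn exprD ?expr1 ?expr0.
    by rewrite (_ : m - 1 - (i + l) = j + l)%N ?exprD; [ring|lia].
  by rewrite (_ : m - (i + l) = j + l)%N ?exprD; [ring|lia].
rewrite mulrCA SE kE exprD exprM (exprAC _ l 2); ring: t0.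
Qed.

Lemma bar_eq0 m a : a \is m.-homog -> bar a = 0 -> exists2 a1,
  a1 \is (m - 2).-homog /\ ((m < 2)%N -> a1 = 0) & a = Q * a1.
Proof.
move=> ha b0; have [a1 h ->] := conic_division ha; exists a1 => //.
by rewrite b0 /conic_lift big1 ?addr0 // => i _; rewrite coef0 scale0r.
Qed.

Lemma g_neq0 : g%:P != 0 :> {poly {poly K}}.
Proof. by rewrite polyC_eq0 rulings_neq0. Qed.

(** A form in the kernel of psi restricts to 0 on the conic, hence is divisible
    by Q, whose image is not a zero divisor; the degree descends. *)
Lemma psi_eq0 m a : a \is m.-homog -> psi a = 0 -> a = 0.
Proof.
have [k] := ubnP m; elim: k m a => // k IH m a mk ha e.
have [|a1 [h1 z1] aE] := bar_eq0 ha; first by rewrite -psi_bar e coef0.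
have [lt|ge] := ltnP m 2; first by rewrite aE z1 // mulr0.
suff z : a1 = 0 by rewrite aE z mulr0.
apply: (IH _ _ _ h1); first by lia.
move: e; rewrite aE rmorphM /= psi_conic => /eqP.
by rewrite !mulf_eq0 (negbTE g_neq0) polyX_eq0 /= => /eqP.
Qed.

Lemma size_bar m a : a \is m.-homog -> (size (bar a) <= (2 * m).+1)%N.
Proof.
move=> ha; have [a1 _ aE] := conic_division ha.
have bQ : bar Q = 0 by rewrite -psi_bar psi_conic coefCM coefX mulr0.
rewrite aE rmorphD rmorphM /= bQ mul0r add0r bar_conic_lift; exact: size_poly.
Qed.

(** Expansion in powers of B and Q.  The restriction of r to the conic is
    divisible by g^n, the restriction of B^n, so r = B^n d + Q r1 for some form
    d; and psi r1 is divisible by g^(n - 1), psi Q being g y. *)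
Lemma image_level n m r : (4 * n <= m)%N -> r \is m.-homog ->
  (exists D, psi r = g%:P ^+ n * D) ->
  exists2 h, h \is (m - 2 * n).-homog & phi h = r ^+ 2 * Q ^+ (m - 4 * n).
Proof.
elim: n m r => [|n IH] m r le hr [D rD].
  have [p hp pE] := frobenius_twist two0 hr; exists (mwiden p).
    by rewrite !muln0 subn0; apply: mwiden_homog.
  by rewrite (phi_widen hp) pE muln0 subn0 mulrC.
have bE : bar r = g ^+ n.+1 * D`_0 by rewrite -psi_bar rD -rmorphXn coefCM.
pose d := conic_lift (m - 4 * n.+1) D`_0.
have hd : d \is (m - 4 * n.+1).-homog := conic_lift_homog _ _.
have dE : bar d = D`_0.
  apply: bar_conic_lift_id; have [->|D0] := eqVneq D`_0 0; first by rewrite size_poly0.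
  have := size_bar hr; rewrite bE size_mul ?expf_neq0 ?rulings_neq0 //.
  have := size_exp g n.+1; rewrite size_rulings.
  have : (0 < size (g ^+ n.+1))%N by rewrite size_poly_gt0 expf_neq0 ?rulings_neq0.
  move: le; clear; case: (size (g ^+ n.+1)) => // s /=. move: (size _) => u; lia.
have [||r1 [h1 _] rE] := @bar_eq0 m (r + B ^+ n.+1 * d).
- apply: rpredD => //; apply: homogM (dhomogMn n.+1 (branch_homog K)) hd _; lia.
- rewrite rmorphD rmorphM rmorphXn /= bar_branch dE bE; ring: p0.
have {rE} rE : r = B ^+ n.+1 * d + Q * r1 by rewrite -rE; ring: t0.
have [||h hh hE] := IH (m - 2)%N r1 _ h1; first by lia.
  move: rD; rewrite rE rmorphD !rmorphM rmorphXn /= psi_conic psi_branch.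
  set y := 1 + _ => e.
  pose W := D + y ^+ n.+1 * psi d.
  have We : g%:P * ('X * psi r1) = g%:P * (g%:P ^+ n * W).
    rewrite /W mulrDr mulrDr !mulrA -exprS -e exprMn; ring: pp0.
  have {}We := mulfI g_neq0 We.
  have W0 : W`_0 = 0.
    have /eqP := congr1 (coefp 0) We; rewrite /= coefXM /= -rmorphXn coefCM eq_sym.
    by rewrite mulf_eq0 expf_eq0 (negbTE rulings_neq0) andbF /= => /eqP.
  exists (drop_poly 1 W); apply: (mulfI (x := 'X)); first by rewrite polyX_eq0.
  rewrite We -{1}(poly_take_drop 1 W) mulrCA; congr (_ * _).
  rewrite (_ : take_poly 1 W = 0) ?add0r ?expr1 1?mulrC //.
  by apply/polyP => -[|i]; rewrite coef_take_poly // coef0.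
have [p hp pE] := frobenius_twist two0 hd.
exists (mwiden p * 'X_ord_max ^+ (2 * n.+1) + h).
  apply: rpredD.
    apply: homogM (mwiden_homog hp) (homogX (homog_X _ _) (erefl _)) _; lia.
  by rewrite (_ : _ - _ = m - 2 - 2 * n)%N //; lia.
rewrite rmorphD rmorphM rmorphXn /= phi_last (phi_widen hp) pE hE rE.
rewrite (_ : m - 2 - 4 * n = m - 4 * n.+1 + 2)%N; last by lia.
rewrite exprD (mulnC 2 n.+1) exprM; ring: t0.
Qed.

(** Both psi Q and psi B are divisible by g. *)
Lemma phi_psi e h : h \is e.-homog -> exists D, psi (phi h) = g%:P ^+ e * D.
Proof.
move=> hh; have [c hc ->] := last_variable_expansion hh.
elim/big_ind: _ => [|h1 h2 [D1 e1] [D2 e2]|i _].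
- by exists 0; rewrite comp_mpoly0 rmorph0 mulr0.
- by exists (D1 + D2); rewrite mulrDr -e1 -e2 -[RHS]rmorphD -rmorphD.
have le_i : (i <= e)%N by rewrite -ltnS.
have -> : phi (mwiden (c i) * 'X_ord_max ^+ i) = Q ^+ (e - i) * fr (c i) * B ^+ i.
  by rewrite [LHS]rmorphM [X in _ * X = _]rmorphXn /= phi_last (phi_widen (hc i)).
rewrite !rmorphM !rmorphXn /= psi_conic psi_branch.
set y := 1 + _; exists ('X ^+ (e - i) * psi (fr (c i)) * y ^+ i).
rewrite -[X in _ = _ ^+ X * _](subnK le_i) exprD !exprMn; ring.
Qed.

(** The derivative along y kills the squares and turns the hypothesis into a
    divisibility of psi t alone, as psi (Q B) has derivative g^2 (1 + g^3 y^4).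
    That of psi r follows, and image_level applies to both. *)
Lemma image_of_squares D r t : (0 < D)%N -> r \is (4 * D).-homog ->
  t \is (4 * D - 3).-homog ->
  (exists W, psi (r ^+ 2 + t ^+ 2 * H) = g%:P ^+ (2 * D) * W) ->
  exists2 h, h \is (2 * D).-homog & phi h = r ^+ 2 + t ^+ 2 * H.
Proof.
case: D => // D _ hr ht [W WE].
pose a := psi r; pose b := psi t; pose v : {poly {poly K}} := 'X%:P.
have e : a ^+ 2 + b ^+ 2 * (g%:P ^+ 2 * ('X + v ^+ 3 * 'X ^+ 2 + g%:P ^+ 3 * 'X ^+ 5)) =
    g%:P ^+ (2 * D.+1) * W.
  have -> : g%:P ^+ (2 * D.+1) * W = a ^+ 2 + b ^+ 2 * (psi Q * psi B).
    by rewrite -WE !(rmorphXn, rmorphD, rmorphM).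
  rewrite psi_conic psi_branch -/v; ring.
have dsq (p : {poly {poly K}}) : (p ^+ 2)^`() = 0.
  by rewrite expr2 derivM; ring: pp0.
have dC (p : {poly K}) k : (p%:P ^+ k)^`() = 0 by rewrite -rmorphXn derivC.
have de : b ^+ 2 * (1 + g%:P * (g%:P ^+ 2 * 'X ^+ 4)) = g%:P ^+ (2 * D) * W^`().
  apply: (mulfI (expf_neq0 2 g_neq0)); rewrite [RHS]mulrA -exprD -mulnS.
  have := congr1 (@deriv _) e.
  rewrite !(derivD, derivM, dsq, dC, derivXn, derivX) => e'.
  transitivity (g%:P ^+ (2 * D.+1) * W^`()); last by [].
  move: e'; rewrite !mul0r !add0r => <-.
  rewrite /v !derivC; ring: pp0.
have [c cE] := divides_one_add g_neq0 de.
have cicK2 : cic {poly {poly K}} := cic_poly (cic_poly (@cic_field K)).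
have [t1 tE] : exists t1, b = g%:P ^+ D * t1.
  apply: (square_divides cicK2 (w := c)); first by rewrite expf_neq0 ?g_neq0.
  by rewrite cE mulnC exprM.
have [r1 rE] : exists r1, a = g%:P ^+ D.+1 * r1.
  apply: (square_divides cicK2 (w := W - t1 ^+ 2 *
    ('X + v ^+ 3 * 'X ^+ 2 + g%:P ^+ 3 * 'X ^+ 5))); first by rewrite expf_neq0 ?g_neq0.
  rewrite -exprM (mulnC D.+1) mulrBr -e tE exprMn -exprM (mulnC D) mulnS exprD; ring.
have [||h1 hh1 h1E] := @image_level D.+1 (4 * D.+1) r _ hr; first by [].
  by exists r1.
have [||h2 hh2 h2E] := @image_level D (4 * D.+1 - 3) t _ ht; first by lia.
  by exists t1.
exists (h1 + 'X_ord_max * h2).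
  apply: rpredD; first by rewrite (_ : 2 * D.+1 = 4 * D.+1 - 2 * D.+1)%N //; lia.
  by apply: homogM (homog_X _ _) hh2 _; lia.
rewrite rmorphD rmorphM /= phi_last h1E h2E subnn.
rewrite (_ : 4 * D.+1 - 3 - 4 * D = 1)%N; last by lia.
ring.
Qed.

Theorem almost_integral_form D e (m n : {mpoly K[4]}) : (0 < D)%N ->
  m \is e.-homog -> n \is (2 * D + e).-homog -> phi m != 0 ->
  (exists2 l, phi l != 0 & exists2 f, l \is f.-homog &
    forall k, exists2 h, h \is (f + k * (2 * D)).-homog &
      phi l * phi n ^+ k = phi m ^+ k * phi h) ->
  exists2 h, h \is (2 * D).-homog & phi n = phi m * phi h.
Proof.
move=> D0 hm hn m0 [l l0 [f hl H]].
have cicT : cic T := cic_mpoly (n := 3) (@cic_field K).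
have [k|E nE] := cicT (phi n) (phi m) (phi l) l0.
  by have [h _ ->] := H k; exists (phi h).
have [r [t [hr ht EE]]] := squares_cofactor two0 D0 hm hn m0 nE.
have [|h hh hE] := @image_of_squares D r t D0 hr ht; last first.
  by exists h => //; rewrite nE hE EE.
(* The image of a form of degree e under psi (phi _) is divisible by g^e, so
   the powers of psi E / g^(2 D) have a common denominator. *)
rewrite -EE.
have cicK2 : cic {poly {poly K}} := cic_poly (cic_poly (@cic_field K)).
apply: (cicK2 _ _ (psi (phi l))).
  by apply: contraNneq l0 => /(psi_eq0 (phi_homog hl)) ->.
move=> k; have [h hh hE] := H k.
have -> : psi (phi l) * psi E ^+ k = psi (phi h).
  rewrite -rmorphXn -rmorphM; congr (psi _).
  by apply: (mulfI (expf_neq0 k m0)); rewrite -hE nE exprMn; ring.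
have [W ->] := phi_psi hh; exists (g%:P ^+ f * W).
by rewrite exprD (mulnC k) exprM; ring.
Qed.

End Surface.

(** * The ideal of the surface *)

Lemma add_power (R : comNzRingType) (x y : R) j : exists u, (x + y) ^+ j = x * u + y ^+ j.
Proof.
elim: j => [|j [u e]]; first by exists 0; rewrite mulr0 add0r.
by exists ((x + y) * u + y ^+ j); rewrite exprS e exprS; ring.
Qed.

Section Surface.
Variables (K : closedFieldType) (two0 : 2%:R = 0 :> K).
Local Notation T := {mpoly K[3]}.
Let f0 := two0_mpoly two0 4.
Local Notation fr p := (p \mPo squares K 3).
Local Notation Q := (conic K).
Local Notation B := (branch K).
Local Notation H := (Q * B).
Local Notation phi p := (p \mPo param K).
Local Notation F := (surface K).
Local Notation g := (rulings K).
Local Notation Z := ('X_ord_max : {mpoly K[4]}).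

(** Restriction to the cone over the conic Q = 0, with z as a free variable. *)
Definition cone_bar : {mpoly K[4]} -> {poly {poly K}} :=
  mmap (polyC \o @polyC K)
    (fun i => if unlift ord_max i is Some j then (conic_param K j)%:P else 'X).
HB.instance Definition _ := GRing.RMorphism.on cone_bar.

Lemma cone_bar_widen p : cone_bar (mwiden p) = (bar p)%:P.
Proof.
apply: (mpoly_morph_ext (f := cone_bar \o @mwiden _ _) (h := polyC \o @bar K)) p => [c|i] /=.
  by rewrite mwidenC /cone_bar /bar !mmapC.
rewrite mwidenX mnmwiden1 barX /cone_bar mmapX mmap1U.
rewrite (_ : widen_ord _ i = lift ord_max i) ?liftK //.
by apply: val_inj; rewrite /= /bump leqNgt ltn_ord.
Qed.

Lemma cone_bar_last : cone_bar Z = 'X.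
Proof. by rewrite /cone_bar mmapX mmap1U unlift_none. Qed.

Lemma conic_neq0 : Q != 0.
Proof.
apply/eqP => e; have := psi_conic two0; rewrite e rmorph0 => /esym/eqP.
by rewrite mulf_eq0 (negbTE (g_neq0 K)) polyX_eq0.
Qed.

Lemma bar_conic : bar Q = 0.
Proof. by rewrite -psi_bar (psi_conic two0) coefCM coefX mulr0. Qed.

(** Apply bar_eq0 to the coefficients of the powers of z. *)
Lemma cone_bar_eq0 d (c : {mpoly K[4]}) : c \is d.-homog -> cone_bar c = 0 ->
  exists c', c = mwiden Q * c'.
Proof.
move=> hc; have [ci hci cE] := last_variable_expansion hc; rewrite {1}cE raddf_sum /= => e.
have bi (i : 'I_d.+1) : bar (ci i) = 0.
  have := congr1 (coefp i) e; rewrite /= coef0 coef_sum => <-.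
  rewrite (bigD1 i) //= rmorphM rmorphXn /= cone_bar_last cone_bar_widen coefCM coefXn eqxx.
  rewrite mulr1 big1 ?addr0 // => j ji.
  rewrite rmorphM rmorphXn /= cone_bar_last cone_bar_widen coefCM coefXn.
  by rewrite (_ : (i == j :> nat) = false) ?mulr0 //; apply/negbTE; rewrite eq_sym.
rewrite cE; elim/big_ind: _ => [|c1 c2 [d1 ->] [d2 ->]|i _].
- by exists 0; rewrite mulr0.
- by exists (d1 + d2); rewrite mulrDr.
have [u _ ->] := bar_eq0 two0 (hci i) (bi i).
by exists (mwiden u * Z ^+ i); rewrite mwidenM mulrA.
Qed.

Lemma surface_homog : F \is 4.-homog.
Proof.
rewrite /surface; apply: rpredD; last exact: mwiden_homog (branch_homog K).
by apply: homogM (homogX (homog_X _ _) (erefl _)) (mwiden_homog (conic_homog K)) _.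
Qed.

Lemma cone_bar_surface : cone_bar F = g%:P.
Proof.
rewrite /surface rmorphD rmorphM /= !cone_bar_widen bar_conic polyC0 mulr0 add0r.
by rewrite (bar_branch two0).
Qed.

Lemma surface_neq0 : F != 0.
Proof.
apply/eqP => e; have := cone_bar_surface; rewrite e rmorph0 => /esym/eqP.
by rewrite (negbTE (g_neq0 K)).
Qed.

(** On the cone Q = 0 the polynomial F restricts to g, which is not zero. *)
Lemma surface_conic_coprime k d (a c : {mpoly K[4]}) : (4 <= d)%N -> a \is d.-homog ->
  mwiden Q ^+ k * a = F * c -> exists c', a = F * c'.
Proof.
move=> d4; elim: k a d d4 c => [|k IH] a d d4 c ha e; first by exists c; rewrite -e mul1r.
have hQa : mwiden Q ^+ k.+1 * a \is (2 * k.+1 + d).-homog.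
  exact: dhomogM (dhomogMn _ (mwiden_homog (conic_homog K))) ha.
have hc : c \is (2 * k.+1 + d - 4).-homog.
  apply: (homog_cofactor surface_neq0 surface_homog (e := 2 * k.+1 + d)); first by rewrite -e.
  lia.
have [|c' cE] := cone_bar_eq0 hc.
  apply: (mulfI (g_neq0 K)); rewrite -cone_bar_surface mulr0 -rmorphM -e rmorphM rmorphXn /=.
  by rewrite cone_bar_widen bar_conic polyC0 expr0n mul0r.
apply: (IH a d d4 c' ha); have Q0 : mwiden Q != 0.
  by apply: contraNneq conic_neq0 => z; apply/eqP/inj_mwiden; rewrite z mwiden0.
by apply: (mulfI Q0); rewrite mulrA -exprS e cE mulrCA.
Qed.

(** Modulo F one has Q z^2 = B, which lowers the degree in z at the price of
    powers of Q. *)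
Lemma linear_remainder d (a : {mpoly K[4]}) : (0 < d)%N -> a \is d.-homog ->
  exists c al be, [/\ al \is (3 * d).-homog, be \is (3 * d - 1).-homog &
    mwiden Q ^+ d * a = F * c + (mwiden al + mwiden be * Z)].
Proof.
move=> d0 ha; have [ai hai ->] := last_variable_expansion ha.
elim/big_ind: _ => [|a1 a2 [c1 [x1 [y1 [h1 g1 e1]]]] [c2 [x2 [y2 [h2 g2 e2]]]]|i _].
- by exists 0, 0, 0; rewrite !dhomog0 mwiden0 !mulr0 mul0r !addr0.
- exists (c1 + c2), (x1 + x2), (y1 + y2); split; [exact: rpredD|exact: rpredD|].
  rewrite [LHS]mulrDr e1 e2 !mwidenD; ring.
have [j [b iE]] : exists j (b : bool), nat_of_ord i = (2 * j + b)%N.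
  by exists (i./2), (odd i); lia.
have le_i : (i <= d)%N by rewrite -ltnS.
have [u uE] := add_power F (mwiden B) j.
have FB : F + mwiden B = Z ^+ 2 * mwiden Q by rewrite /surface; ring: f0.
pose w := ai i * Q ^+ (d - j) * B ^+ j.
have hw : w \is (3 * d - b).-homog.
  apply: homogM (homogM (hai i) (dhomogMn _ (conic_homog K)) (erefl _))
    (dhomogMn _ (branch_homog K)) _; lia.
have E : mwiden Q ^+ d * (mwiden (ai i) * Z ^+ i) =
    F * (mwiden (ai i) * mwiden Q ^+ (d - j) * Z ^+ b * u) + mwiden w * Z ^+ b.
  transitivity (mwiden (ai i) * mwiden Q ^+ (d - j) * Z ^+ b * (F + mwiden B) ^+ j).
    rewrite FB iE -[in X in X * _](@subnK j d) ?exprD ?exprM ?exprMn; last by lia.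
    ring.
  rewrite uE /w !mwidenM !rmorphXn /=; ring.
case: b iE hw E => iE hw E.
  by exists (mwiden (ai i) * mwiden Q ^+ (d - j) * Z * u), 0, w;
    rewrite dhomog0 mwiden0 add0r E.
exists (mwiden (ai i) * mwiden Q ^+ (d - j) * 1 * u), w, 0; rewrite subn0 in hw.
by rewrite dhomog0 mwiden0 mul0r addr0 E /= expr0 [X in _ + X]mulr1.
Qed.

(** The linear remainder al + be z goes to an even polynomial plus an even
    multiple of Q B, up to a power of Q; such a sum vanishes only if both parts
    do.  So F divides a multiple of a by a power of Q, hence a. *)
Lemma phi_kernel d (a : {mpoly K[4]}) : (4 <= d)%N -> a \is d.-homog -> phi a = 0 ->
  exists c, a = F * c.
Proof.
move=> d4 ha phia; have [|c [al [be [hal hbe e]]]] := linear_remainder _ ha; first by lia.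
have [s _ sE] := frobenius_root two0 hal; have [t _ tE] := frobenius_root two0 hbe.
have := congr1 (fun p => phi p) e.
rewrite [LHS]rmorphM /= phia mulr0 [RHS]rmorphD [X in _ = X + _]rmorphM /= (phi_surface two0).
rewrite mul0r add0r [RHS]rmorphD [X in _ = _ + X]rmorphM /= phi_last.
rewrite (phi_widen hal) (phi_widen hbe) sE tE => e0.
have [|z1 z2] := @squares_eq0 _ two0 (Q ^+ (3 * d) * s) (Q ^+ (3 * d - 1) * t).
  apply/esym; rewrite -[LHS](mulr0 (Q ^+ (3 * d))) e0.
  have [n ->] : exists n, (3 * d = n.+1)%N by exists (3 * d).-1; lia.
  by rewrite subn1 /= !exprS; ring.
have Qk k : Q ^+ k != 0 by rewrite expf_neq0 ?conic_neq0.
have be0 : be = 0.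
  apply: (frobenius_inj two0); rewrite tE; apply/eqP; rewrite sqrf_eq0.
  by move/eqP: z2; rewrite mulf_eq0 (negbTE (Qk _)).
have al0 : al = 0.
  apply: (frobenius_inj two0); rewrite sE; apply/eqP; rewrite sqrf_eq0.
  by move/eqP: z1; rewrite mulf_eq0 (negbTE (Qk _)).
apply: (surface_conic_coprime d4 ha (k := d) (c := c)).
by rewrite e al0 be0 mwiden0 mul0r !addr0.
Qed.

End Surface.

(** * Integral elements of a graded ring *)

Section FractionQuotient.
Local Open Scope quotient_scope.

Lemma fraction_quotient (A : idomainType) (u : {fraction A}) :
  exists x y, y != 0 /\ u = FracField.tofrac x / FracField.tofrac y.
Proof.
elim/quotW: u => r; have r2 := denom_ratioP r.
exists \n_r, \d_r; split=> //; have y0 : FracField.tofrac \d_r != 0 by rewrite tofrac_eq0.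
apply: (mulIf y0); rewrite divfK //.
apply/eqP; rewrite /GRing.mul /= !piE; apply/eqP.
rewrite /FracField.mulf !numden_Ratio ?oner_eq0 ?mulr1 //.
exact: mulrC.
Qed.

End FractionQuotient.

Lemma clear_denominators (L : fieldType) (c : nat -> L) X Y N : Y != 0 ->
  (\sum_(i < N.+1) c i * (X / Y) ^+ i) * Y ^+ N =
  \sum_(i < N.+1) c i * X ^+ i * Y ^+ (N - i).
Proof.
move=> Y0; rewrite mulr_suml; apply: eq_bigr => -[i /= lt] _.
rewrite expr_div_n -[in LHS](subnKC (n := N) lt) exprD.
by rewrite -!mulrA (mulKf (expf_neq0 i Y0)).
Qed.

Section Integral.
Variables (A : idomainType) (L : fieldType) (iota : {rmorphism A -> L}).
Hypothesis iota_inj : injective iota.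
Local Notation tofrac := (@FracField.tofrac A).

(** Clearing denominators moves the equation from the fraction field of A into
    A, and from there to L. *)
Lemma integral_equation (u : {fraction A}) x y : y != 0 ->
  u = tofrac x / tofrac y -> integralOver tofrac u ->
  exists N (q : nat -> A),
    (iota x / iota y) ^+ N = \sum_(i < N) iota (q i) * (iota x / iota y) ^+ i.
Proof.
move=> y0 uE [p mp /rootP pu].
have ty : tofrac y != 0 by rewrite tofrac_eq0.
have iy : iota y != 0 by rewrite -(rmorph0 iota) (inj_eq iota_inj).
have [N sN] : exists N, size p = N.+1.
  by exists (size p).-1; rewrite prednK // size_poly_gt0 monic_neq0.
have hom_eq : \sum_(i < N.+1) p`_i * x ^+ i * y ^+ (N - i) = 0.
  apply: tofrac_inj; rewrite tofrac0 raddf_sum /=.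
  rewrite (eq_bigr (fun i : 'I_N.+1 =>
    tofrac p`_i * tofrac x ^+ i * tofrac y ^+ (N - i))) => [|i _]; last first.
    by rewrite !tofracM !tofracXn.
  rewrite -(clear_denominators (fun i => tofrac p`_i)) // -uE.
  move: pu; rewrite horner_coef size_map_inj_poly ?tofrac0 ?sN //; last exact: tofrac_inj.
  move=> pu; rewrite -[RHS](mul0r (tofrac y ^+ N)) -[X in _ = X * _]pu; congr (_ * _).
  by apply: eq_bigr => i _; rewrite coef_map_id0 ?tofrac0.
have {hom_eq} : \sum_(i < N.+1) iota p`_i * (iota x / iota y) ^+ i = 0.
  apply: (mulIf (expf_neq0 N iy)); rewrite mul0r (clear_denominators (fun i => iota p`_i)) //.
  move/(congr1 iota): hom_eq; rewrite rmorph0 raddf_sum => e; rewrite -[RHS]e.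
  by apply: eq_bigr => i _; rewrite /= !rmorphM !rmorphXn.
rewrite big_ord_recr /= (_ : p`_N = 1); last by move/monicP: mp; rewrite lead_coefE sN.
rewrite rmorph1 mul1r => /eqP; rewrite addrC addr_eq0 => /eqP e.
exists N, (fun i => - p`_i); rewrite e -sumrN; apply: eq_bigr => i _.
by rewrite rmorphN mulNr.
Qed.

Lemma injective_neq0 y : y != 0 -> iota y != 0.
Proof. by move=> y0; rewrite -(rmorph0 iota) (inj_eq iota_inj). Qed.

Lemma fraction_in_image (u : {fraction A}) x y z : y != 0 ->
  u = tofrac x / tofrac y -> iota x / iota y = iota z -> u = tofrac z.
Proof.
move=> y0 -> e; apply: (canLR (mulfK _)); first by rewrite tofrac_eq0.
rewrite -tofracM; congr tofrac; apply: iota_inj.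
by rewrite rmorphM -e divfK // injective_neq0.
Qed.
End Integral.

Lemma quotient_cross (L : fieldType) (x y x' y' : L) : y != 0 -> x' != 0 -> y' != 0 ->
  (x' * y) * ((x / y) / (x' / y')) = x * y'.
Proof. by move=> y0 x'0 y'0; field; rewrite x'0 y0 y'0. Qed.

Lemma power_regroup (R : comNzRingType) (mu b e : R) N k :
  mu ^+ k * (mu ^+ N * (b * e) ^+ k) = mu ^+ N * (b * (mu * e)) ^+ k.
Proof. by rewrite [in RHS]mulrCA [in RHS]exprMn mulrCA. Qed.

(** With a common denominator beta of the coefficients q, the powers
    (beta e)^k are reduced by the equation to exponents below N, for which
    mu^N is a common denominator. *)
Lemma graded_almost_integral (L : fieldType) (S : nat -> L -> Prop)
    (N d f : nat) (q : nat -> L) (e mu beta : L) :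
  (forall k, S k 0) -> (forall k x y, S k x -> S k y -> S k (x + y)) -> S 0%N 1 ->
  (forall k l x y, S k x -> S l y -> S (k + l)%N (x * y)) ->
  e ^+ N = \sum_(i < N) q i * e ^+ i ->
  S f mu -> S f (mu * e) -> S d beta ->
  (forall i, (i < N)%N -> S d (beta * q i)) ->
  forall k, S (N * f + k * d)%N (mu ^+ N * (beta * e) ^+ k).
Proof.
move=> S0 SD S1 SM eN Smu Smue Sb Sq k.
have SX l x i : S l x -> S (i * l)%N (x ^+ i).
  by move=> Sx; elim: i => [|i IH] //; rewrite exprS mulSn; apply: SM.
have [n] := ubnP k; elim: n k => // n IH k kn; have [lt|ge] := ltnP k N.
  have -> : mu ^+ N * (beta * e) ^+ k = mu ^+ (N - k) * (mu * e) ^+ k * beta ^+ k.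
    rewrite -[in mu ^+ N](subnK (ltnW lt)) exprD !exprMn.
    by move: (mu ^+ k) (mu ^+ (N - k)) (e ^+ k) => *; ring.
  have -> : (N * f + k * d = (N - k) * f + k * f + k * d)%N by nia.
  by apply: (SM _ _ _ _ (SM _ _ _ _ (SX _ _ _ Smu) (SX _ _ _ Smue)) (SX _ _ _ Sb)).
have -> : mu ^+ N * (beta * e) ^+ k = \sum_(i < N)
    (mu ^+ N * (beta * e) ^+ (k - N + i)) * (beta * q i) * beta ^+ (N - i.+1).
  rewrite -[in LHS](subnK ge) exprD [(beta * e) ^+ N]exprMn eN.
  rewrite !mulr_sumr; apply: eq_bigr => -[i /= lt] _.
  rewrite [(beta * e) ^+ (_ + i)]exprD [(beta * e) ^+ i]exprMn.
  rewrite -[in beta ^+ N](subnK lt) exprD exprS.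
  by move: (e ^+ i) (beta ^+ i) (_ ^+ (N - i.+1)) => *; ring.
apply: big_ind => [|x y|[i /= lt] _]; [exact: S0|exact: SD|].
have -> : (N * f + k * d = N * f + (k - N + i) * d + d + (N - i.+1) * d)%N by nia.
apply: (SM _ _ _ _ (SM _ _ _ _ (IH _ _) (Sq _ lt)) (SX _ _ _ Sb)); lia.
Qed.

(** * The local rings of the surface *)

Local Notation tofrac := (@FracField.tofrac _).

Lemma fraction_sub (L : fieldType) (x y x' y' : L) : y != 0 -> y' != 0 ->
  x / y - x' / y' = (x * y' - x' * y) / (y * y').
Proof. by move=> y0 y'0; rewrite -mulNr addf_div // mulNr. Qed.

Lemma fraction_mul (L : fieldType) (x y x' y' : L) :
  (x / y) * (x' / y') = (x * x') / (y * y').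
Proof. by rewrite mulf_div. Qed.

Section LocalImage.
Variables (K : closedFieldType) (P : proj_space K 3).
Local Notation phi p := (p \mPo param K).

(** The local ring of the surface at P, realized inside the field K(s). *)
Definition regular_image (u : {fraction {mpoly K[3]}}) : bool :=
  `[< exists (d : nat) (a b : {mpoly K[4]}),
      [/\ a \is d.-homog, b \is d.-homog, ~~ vanishes b P, phi b != 0 &
          u = tofrac (phi a) / tofrac (phi b)] >].

Fact regular_image_subring : subring_closed regular_image.
Proof.
split.
- apply/asboolP; exists 0%N, 1, 1.
  by split; rewrite ?dhomog1 ?rmorph1 ?oner_eq0 ?divr1 ?tofrac1 // /vanishes meval1 oner_eq0.
- move=> u v /asboolP[d [a [b [ha hb nb pb ->]]]] /asboolP[e [a' [b' [ha' hb' nb' pb' ->]]]].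
  have eb : tofrac (phi b) != 0 by rewrite tofrac_eq0.
  have eb' : tofrac (phi b') != 0 by rewrite tofrac_eq0.
  apply/asboolP; exists (d + e)%N, (a * b' - a' * b), (b * b'); split.
  + apply: rpredB; first exact: dhomogM.
    by rewrite addnC; apply: dhomogM.
  + exact: dhomogM.
  + exact: nvanM.
  + by rewrite rmorphM mulf_neq0.
  + rewrite (fraction_sub _ _ eb eb') [phi (_ - _)]rmorphB /= [phi (a * _)]rmorphM /=.
    by rewrite [phi (a' * _)]rmorphM /= [phi (b * _)]rmorphM /= tofracB
      (tofracM (phi a)) (tofracM (phi a')) (tofracM (phi b)).
- move=> u v /asboolP[d [a [b [ha hb nb pb ->]]]] /asboolP[e [a' [b' [ha' hb' nb' pb' ->]]]].
  apply/asboolP; exists (d + e)%N, (a * a'), (b * b'); split.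
  + exact: dhomogM.
  + exact: dhomogM.
  + exact: nvanM.
  + by rewrite rmorphM mulf_neq0.
  + rewrite (fraction_mul (tofrac (phi a))).
    by rewrite [phi (a * _)]rmorphM /= [phi (b * _)]rmorphM /=
      (tofracM (phi a)) (tofracM (phi b)).
Qed.

HB.instance Definition _ :=
  GRing.isSubringClosed.Build {fraction {mpoly K[3]}} regular_image regular_image_subring.

Definition image_ring := {u : {fraction {mpoly K[3]}} | regular_image u}.
HB.instance Definition _ := SubType.on image_ring.
HB.instance Definition _ := Choice.on image_ring.
HB.instance Definition _ := [SubChoice_isSubComNzRing of image_ring by <:].

Definition image_unit : {pred image_ring} := fun x => `[< exists y, y * x = 1 >].

(** The inverse is chosen classically; image_ring is not closed under division
    in K(s). *)
Definition image_inv (x : image_ring) : image_ring :=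
  if pselect (exists y, y * x = 1) is left e then projT1 (cid e) else x.

Fact image_mulV : {in image_unit, left_inverse 1 image_inv *%R}.
Proof.
move=> x /asboolP e; rewrite /image_inv; case: pselect => // e'.
by case: cid.
Qed.

Fact image_unitPl (x y : image_ring) : y * x = 1 -> image_unit x.
Proof. by move=> e; apply/asboolP; exists y. Qed.

Fact image_inv_out : {in [predC image_unit], image_inv =1 id}.
Proof.
move=> x /negP ne; rewrite /image_inv; case: pselect => // e; case: ne.
exact/asboolP.
Qed.

HB.instance Definition _ := GRing.ComNzRing_hasMulInverse.Build image_ring
  image_mulV image_unitPl image_inv_out.

Fact image_integral (x y : image_ring) : x * y = 0 -> (x == 0) || (y == 0).
Proof.
move/(congr1 val); rewrite rmorphM rmorph0 => /eqP; rewrite mulf_eq0.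
case/orP => /eqP e; apply/orP; [left|right]; apply/eqP/val_inj; rewrite e; exact/esym/rmorph0.
Qed.

HB.instance Definition _ := GRing.ComUnitRing_isIntegral.Build image_ring image_integral.

Fact local_fraction_of (u : local_ring P) : exists ab : {mpoly K[4]} * {mpoly K[4]},
  exists d, [/\ ab.1 \is d.-homog, ab.2 \is d.-homog,
    ~~ vanishes ab.2 P & val u = tofrac ab.1 / tofrac ab.2].
Proof. by have /asboolP[d [a [b H]]] := valP u; exists (a, b), d. Qed.

(** A chosen representative of a regular fraction; local_piE shows that the
    choice does not matter. *)
Definition local_num u := (projT1 (cid (local_fraction_of u))).1.
Definition local_den u := (projT1 (cid (local_fraction_of u))).2.

Lemma local_numden u : exists d, [/\ local_num u \is d.-homog, local_den u \is d.-homog,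
  ~~ vanishes (local_den u) P & val u = tofrac (local_num u) / tofrac (local_den u)].
Proof. exact: projT2 (cid (local_fraction_of u)). Qed.

Hypotheses (two0 : 2%:R = 0 :> K) (FP : vanishes (surface K) P).

(** A form in the kernel of phi is a multiple of F, up to a power of a
    nonvanishing linear form, and thus vanishes at P. *)
Lemma phi_neq0 d (b : {mpoly K[4]}) : b \is d.-homog -> ~~ vanishes b P -> phi b != 0.
Proof.
move=> hb nb; apply/eqP => b0; have [l hl nl] := nonvanishing_linear P.
have [|||c cE] := @phi_kernel K two0 (d + 4) (b * l ^+ 4).
- by rewrite leq_addl.
- by apply: homogM hb (homogX hl _) _.
- by rewrite rmorphM /= b0 mul0r.
have := nvanM nb (nvanX 4 nl); rewrite cE => /negP[].
by rewrite /vanishes mevalM (eqP FP) mul0r.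
Qed.

Fact pi_regular u :
  regular_image (tofrac (phi (local_num u)) / tofrac (phi (local_den u))).
Proof.
have [d [ha hb nb _]] := local_numden u; apply/asboolP.
by exists d, (local_num u), (local_den u); split=> //; apply: phi_neq0 hb nb.
Qed.

Definition local_pi (u : local_ring P) : image_ring := Sub _ (pi_regular u).

Lemma local_piE u d (a b : {mpoly K[4]}) : b \is d.-homog -> ~~ vanishes b P ->
  val u = tofrac a / tofrac b -> val (local_pi u) = tofrac (phi a) / tofrac (phi b).
Proof.
move=> hb nb uE; have [e [_ hd nd uE']] := local_numden u; rewrite uE in uE'.
have /(congr1 (fun p => phi p)) := frac_eq nb nd uE'.
rewrite [LHS]rmorphM [RHS]rmorphM /= => E.
rewrite -[LHS]/(tofrac (phi (local_num u)) / tofrac (phi (local_den u))).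
apply/eqP; rewrite eqr_div ?tofrac_eq0 ?(phi_neq0 hb nb) ?(phi_neq0 hd nd) //.
by rewrite -!tofracM tofrac_eq -E mulrC.
Qed.

Lemma local_pi_zmod : zmod_morphism local_pi.
Proof.
move=> u v; have [d [ha hb nb uE]] := local_numden u.
have [e [ha' hb' nb' vE]] := local_numden v.
have eb : tofrac (local_den u) != 0 by apply: nvan_tofrac nb.
have eb' : tofrac (local_den v) != 0 by apply: nvan_tofrac nb'.
have wE : val (u - v) = tofrac (local_num u * local_den v - local_num v * local_den u) /
    tofrac (local_den u * local_den v).
  by rewrite rmorphB /= uE vE (fraction_sub _ _ eb eb') tofracB
    (tofracM (local_num u)) (tofracM (local_num v)) (tofracM (local_den u)).
apply: val_inj; rewrite (local_piE (dhomogM hb hb') (nvanM nb nb') wE) [RHS]rmorphB /=.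
have pb : tofrac (phi (local_den u)) != 0 by rewrite tofrac_eq0 (phi_neq0 hb nb).
have pb' : tofrac (phi (local_den v)) != 0 by rewrite tofrac_eq0 (phi_neq0 hb' nb').
rewrite (fraction_sub _ _ pb pb') [phi (_ - _)]rmorphB /= [phi (local_num u * _)]rmorphM /=.
by rewrite [phi (local_num v * _)]rmorphM /= [phi (_ * _)]rmorphM /= tofracB
  (tofracM (phi (local_num u))) (tofracM (phi (local_num v))) (tofracM (phi (local_den u))).
Qed.

Lemma local_pi_monoid : monoid_morphism local_pi.
Proof.
split=> [|u v].
  have e1 : val (1 : local_ring P) = tofrac 1 / tofrac (1 : {mpoly K[4]}).
    by rewrite tofrac1 divr1 rmorph1.
  apply: val_inj; rewrite (local_piE (d := 0%N) _ _ e1) ?dhomog1 //.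
    by rewrite !rmorph1 /= divr1.
  by rewrite /vanishes meval1 oner_eq0.
have [d [ha hb nb uE]] := local_numden u; have [e [ha' hb' nb' vE]] := local_numden v.
have wE : val (u * v) = tofrac (local_num u * local_num v) / tofrac (local_den u * local_den v).
  by rewrite rmorphM /= uE vE fraction_mul
    (tofracM (local_num u)) (tofracM (local_den u)).
apply: val_inj; rewrite (local_piE (dhomogM hb hb') (nvanM nb nb') wE) [RHS]rmorphM /=.
rewrite (fraction_mul (tofrac (phi (local_num u)))) [phi (local_num u * _)]rmorphM /=.
by rewrite [phi (_ * _)]rmorphM /= (tofracM (phi (local_num u))) (tofracM (phi (local_den u))).
Qed.
End LocalImage.

Section Normality.
Variables (K : closedFieldType) (P : proj_space K 3).
Hypotheses (two0 : 2%:R = 0 :> K) (FP : vanishes (surface K) P).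
Local Notation phi p := (p \mPo param K).
Local Notation A := (image_ring P).
Local Notation pi := (local_pi two0 FP).
Local Notation L := {fraction {mpoly K[3]}}.

HB.instance Definition _ :=
  GRing.isZmodMorphism.Build (local_ring P) A pi (local_pi_zmod two0 FP).
HB.instance Definition _ :=
  GRing.isMonoidMorphism.Build (local_ring P) A pi (local_pi_monoid two0 FP).

Lemma local_pi_surj (a : A) : exists u, pi u = a.
Proof.
have /asboolP[d [x [y [hx hy ny py aE]]]] := valP a.
have [u uE] := local_fraction hx hy ny.
by exists u; apply: val_inj; rewrite (local_piE two0 FP hy ny uE) -aE.
Qed.

Lemma local_pi_kernel u : pi u = 0 <-> in_local_ideal 4 (surface K) u.
Proof.
split=> [u0|[e [c [b [hc hb nb uE]]]]]; last first.
  apply: val_inj; rewrite (local_piE two0 FP hb nb uE) [phi (_ * _)]rmorphM /=.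
  by rewrite (phi_surface two0) mul0r tofrac0 mul0r.
have [d [ha hb nb uE]] := local_numden u.
have [l hl nl] := nonvanishing_linear P.
have pa : phi (local_num u) = 0.
  have := local_piE two0 FP hb nb uE; rewrite u0 -[LHS]/0 => /esym/eqP.
  rewrite mulf_eq0 invr_eq0 !tofrac_eq0 (negbTE (phi_neq0 two0 FP hb nb)) orbF.
  by move/eqP.
have h4 : local_num u * l ^+ 4 \is (4 + d).-homog by apply: homogM ha (homogX hl (erefl _)) _; lia.
have [||c cE] := phi_kernel two0 _ h4; first by rewrite leq_addr.
  by rewrite rmorphM /= pa mul0r.
exists d, c, (local_den u * l ^+ 4); split.
- by apply: (homog_factor (surface_neq0 two0) (surface_homog K)); rewrite -cE.
- by apply: homogM hb (homogX hl (erefl _)) _; lia.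
- exact: nvanM nb (nvanX 4 nl).
rewrite uE -cE; have l0 : tofrac (l ^+ 4) != 0 by exact: nvan_tofrac (nvanX 4 nl).
by rewrite (tofracM (local_num u)) (tofracM (local_den u)) -mulf_div divff ?mulr1.
Qed.

Lemma common_denominator (q : nat -> A) N : exists d (b : {mpoly K[4]}),
  [/\ b \is d.-homog, ~~ vanishes b P & forall i, (i < N)%N -> exists2 c,
    c \is d.-homog & tofrac (phi b) * val (q i) = tofrac (phi c)].
Proof.
elim: N => [|N [d [b [hb nb H]]]].
  by exists 0%N, 1; split; rewrite ?dhomog1 // /vanishes meval1 oner_eq0.
have /asboolP[e [x [y [hx hy ny py aE]]]] := valP (q N).
exists (d + e)%N, (b * y); split; [exact: dhomogM|exact: nvanM|] => i.
rewrite ltnS leq_eqVlt => /orP[/eqP->|/H[c hc cE]].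
  exists (b * x); first exact: dhomogM.
  rewrite [phi (_ * _)]rmorphM [phi (b * x)]rmorphM /= (tofracM (phi b)) aE.
  rewrite (tofracM (phi b)) -mulrA [X in _ * X]mulrCA divff ?mulr1 //.
  by rewrite tofrac_eq0.
exists (c * y); first exact: dhomogM.
rewrite [phi (b * _)]rmorphM [phi (c * _)]rmorphM /= (tofracM (phi b)) (tofracM (phi c)).
by rewrite mulrAC cE.
Qed.

Definition graded_image (k : nat) (x : L) : Prop :=
  exists2 h : {mpoly K[4]}, h \is k.-homog & x = tofrac (phi h).

(** The common denominator is squared, after multiplication by a linear form,
    so as to have a positive even degree, as almost_integral_form demands. *)
Lemma image_integrally_closed : integrally_closed A.
Proof.
move=> u uI; have [x [y [y0 uE]]] := fraction_quotient u.
pose iota : {rmorphism A -> L} := val.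
have iota_inj : injective iota by apply: val_inj.
have [N [q eN]] := integral_equation iota_inj y0 uE uI.
suff [z zE] : exists z : A, val x / val y = val z.
  by exists z; apply: (fraction_in_image iota_inj y0 uE zE).
have y0' : val y != 0 := injective_neq0 iota_inj y0.
have [d [b0 [hb0 nb0 Hq]]] := common_denominator q N.
have [l hl nl] := nonvanishing_linear P.
pose b := (b0 * l) ^+ 2; have hb : b \is (2 * d.+1).-homog.
  by apply: homogX (dhomogM hb0 hl) _; rewrite addn1 mulnC.
have nb : ~~ vanishes b P by apply/nvanX/nvanM.
have pb := phi_neq0 two0 FP hb nb.
have {Hq} Hq i : (i < N)%N -> graded_image (2 * d.+1) (tofrac (phi b) * val (q i)).
  move=> /Hq[c hc cE]; exists (c * (b0 * l ^+ 2)).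
    have h2 : b0 * l ^+ 2 \is (d + 2).-homog := dhomogM hb0 (dhomogMn 2 hl).
    have -> : (2 * d.+1 = d + (d + 2))%N by rewrite mul2n -addnn addSn addn2 !addnS.
    exact: dhomogM hc h2.
  have -> : b = b0 * (b0 * l ^+ 2) by rewrite /b; ring.
  rewrite [phi (b0 * _)]rmorphM [phi (c * _)]rmorphM /= (tofracM (phi b0)) (tofracM (phi c)).
  by rewrite mulrAC cE.
have /asboolP[d1 [a1 [b1 [ha1 hb1 nb1 pb1 xE]]]] := valP x.
have /asboolP[d2 [a2 [b2 [ha2 hb2 nb2 pb2 yE]]]] := valP y.
have pa2 : phi a2 != 0.
  by apply: contraNneq y0' => z; rewrite yE z tofrac0 mul0r.
set e := val x / val y in eN *.
pose m := a2 * b1; pose n := a1 * b2.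
have hm : m \is (d1 + d2).-homog by rewrite addnC; apply: dhomogM.
have hn : n \is (d1 + d2).-homog by exact: dhomogM.
have pm : phi m != 0 by rewrite rmorphM mulf_neq0.
have tm : tofrac (phi m) != 0 by rewrite tofrac_eq0.
have mE : tofrac (phi m) * e = tofrac (phi n).
  rewrite /e xE yE [phi m]rmorphM [phi n]rmorphM /= (tofracM (phi a2)) (tofracM (phi a1)).
  by apply: quotient_cross; rewrite tofrac_eq0.
have [f0 fD f1 fM] : [/\ forall k, graded_image k 0,
    forall k x y, graded_image k x -> graded_image k y -> graded_image k (x + y),
    graded_image 0%N 1 &
    forall k l x y, graded_image k x -> graded_image l y -> graded_image (k + l)%N (x * y)].
  split=> [k|k _ _ [h hh ->] [h' hh' ->]||k k' _ _ [h hh ->] [h' hh' ->]].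
  - by exists 0; rewrite ?dhomog0 // comp_mpoly0 tofrac0.
  - by exists (h + h'); rewrite ?rpredD // [phi (_ + _)]rmorphD /= tofracD.
  - by exists 1; rewrite ?dhomog1 // rmorph1 tofrac1.
  by exists (h * h'); rewrite ?dhomogM // [phi (_ * _)]rmorphM /= (tofracM (phi h)).
have almost := graded_almost_integral f0 fD f1 fM eN (ex_intro2 _ _ m hm (erefl _))
  (ex_intro2 _ _ n hn mE) (ex_intro2 _ _ b hb (erefl _)) Hq.
have hbn : b * n \is (2 * d.+1 + (d1 + d2)).-homog := dhomogM hb hn.
have [|h hh hE] := almost_integral_form two0 (ltn0Sn d) hm hbn pm.
  exists (m ^+ N); first by rewrite rmorphXn expf_neq0.
  exists (N * (d1 + d2))%N; first by rewrite mulnC; apply: dhomogMn.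
  move=> k; have [h hh hE] := almost k; exists h => //.
  apply: tofrac_inj; rewrite (tofracM (phi m ^+ k)) -hE (tofracXn k (phi m)) power_regroup mE.
  rewrite (tofracM (phi (m ^+ N))) [phi (m ^+ N)]rmorphXn [phi (b * n)]rmorphM /=.
  by rewrite (tofracXn N (phi m)) tofracXn (tofracM (phi b)).
have eE : e = tofrac (phi h) / tofrac (phi b).
  have tb : tofrac (phi b) != 0 by rewrite tofrac_eq0.
  apply: (canRL (mulfK tb)); apply: (mulfI tm).
  rewrite mulrA mE -(tofracM (phi n)) -(tofracM (phi m)) -hE [phi (b * n)]rmorphM /=.
  by rewrite mulrC.
have reg : regular_image P e.
  by apply/asboolP; exists (2 * d.+1)%N, h, b; split.
by exists (Sub e reg); rewrite SubK.
Qed.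

Theorem surface_normal_at : normal_at 4 (surface K) P.
Proof.
exists A, pi; split; [exact: local_pi_surj|exact: local_pi_kernel|].
exact: image_integrally_closed.
Qed.
End Normality.

(** * The fourteen singular points *)

Section Singular.
Variables (K : closedFieldType) (two0 : 2%:R = 0 :> K).
Local Notation F := (surface K).
Let f0 := two0_mpoly two0 4.
Let p0 := two0_poly two0.
Local Notation i0 := (0 : 'I_4).
Local Notation i1 := (1 : 'I_4).
Local Notation i2 := (2%:R : 'I_4).
Local Notation i3 := (ord_max : 'I_4).
Local Notation xx i := ('X_(i : 'I_4) : {mpoly K[4]}).

(** Products are spelled out because the rules for derivatives and values
    apply to products, not to powers. *)
Lemma surface_expand : F = xx i3 * xx i3 * (xx i0 * xx i1 + xx i2 * xx i2) +
  (xx i0 * (xx i2 * (xx i2 * xx i2)) + xx i1 * (xx i1 * xx i1) * xx i2 +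
   xx i0 * (xx i0 * (xx i0 * xx i0))).
Proof.
have w (i : 'I_3) j : widen_ord (leqnSn 3) i = j -> mwiden ('X_i : {mpoly K[3]}) = xx j.
  by move=> <-; rewrite mwidenX mnmwiden1.
have w0 : mwiden ('X_0 : {mpoly K[3]}) = xx i0 by apply: w; apply: val_inj.
have w1 : mwiden ('X_1 : {mpoly K[3]}) = xx i1 by apply: w; apply: val_inj.
have w2 : mwiden ('X_(2%:R) : {mpoly K[3]}) = xx i2 by apply: w; apply: val_inj.
rewrite /surface /conic /branch !exprS !expr0 !mulr1 !mwidenD !mwidenM w0 w1 w2.
by [].
Qed.

Let dX (i j : 'I_4) : ('X_j)^`M(i) = (i == j)%:R :> {mpoly K[4]}.
Proof.
rewrite mderivX mnm1E eq_sym; case: eqVneq => [->|_]; last by rewrite scale0r.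
rewrite scale1r (_ : (_ - _)%MM = 0%MM) ?mpolyX0 //.
by apply/mnmP => k; rewrite mnmBE subnn mnm0E.
Qed.

Definition singular_equations (x y z w : K) :=
  [/\ w ^+ 2 * (x * y + z ^+ 2) + x * z ^+ 3 + y ^+ 3 * z + x ^+ 4 = 0,
      w ^+ 2 * y + z ^+ 3 = 0, w ^+ 2 * x + y ^+ 2 * z = 0 & x * z ^+ 2 + y ^+ 3 = 0].

Lemma singular_pointE (P : proj_space K 3) (v := coords P 0) :
  singular_point F P <-> singular_equations (v i0) (v i1) (v i2) (v i3).
Proof.
have eF : F.@[v] = v i3 ^+ 2 * (v i0 * v i1 + v i2 ^+ 2) + v i0 * v i2 ^+ 3 +
    v i1 ^+ 3 * v i2 + v i0 ^+ 4.
  rewrite surface_expand !(mevalD, mevalM) !mevalXU; ring.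
have e0 : F^`M(i0).@[v] = v i3 ^+ 2 * v i1 + v i2 ^+ 3.
  rewrite surface_expand !(mderivD, mderivM, dX) /= !(mevalD, mevalM) !mevalXU !meval0 !meval1.
  ring: two0.
have e1 : F^`M(i1).@[v] = v i3 ^+ 2 * v i0 + v i1 ^+ 2 * v i2.
  rewrite surface_expand !(mderivD, mderivM, dX) /= !(mevalD, mevalM) !mevalXU !meval0 !meval1.
  ring: two0.
have e2 : F^`M(i2).@[v] = v i0 * v i2 ^+ 2 + v i1 ^+ 3.
  rewrite surface_expand !(mderivD, mderivM, dX) /= !(mevalD, mevalM) !mevalXU !meval0 !meval1.
  ring: two0.
have e3 : F^`M(i3).@[v] = 0.
  rewrite surface_expand !(mderivD, mderivM, dX) /= !(mevalD, mevalM) !mevalXU !meval0 !meval1.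
  ring: two0.
split=> [/andP[/eqP hF /forallP hd]|[h hd0 hd1 hd2]].
  have d (i : 'I_4) : F^`M(i).@[v] = 0 by apply/eqP/hd.
  by split; rewrite -?eF -?e0 -?e1 -?e2.
apply/andP; split; first by rewrite /vanishes eF h.
apply/forallP => i; rewrite /vanishes.
have [->|->|->|->] : [\/ i = i0, i = i1, i = i2 | i = i3].
  case: i => -[|[|[|[|//]]]] h4; [apply: Or41|apply: Or42|apply: Or43|apply: Or44]; exact: val_inj.
- by rewrite e0 hd0.
- by rewrite e1 hd1.
- by rewrite e2 hd2.
- by rewrite e3.
Qed.

(** The condition on s for (1 : s^2 : s^3 : sqrt (s^7)) to lie on the surface. *)
Definition node_poly : {poly K} := 'X^13 + 'X^9 + 1.

Lemma node_polyE s : node_poly.[s] = s ^+ 13 + s ^+ 9 + 1.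
Proof. by rewrite /node_poly !hornerE. Qed.

Lemma size_node_poly : size node_poly = 14%N.
Proof.
by rewrite /node_poly -addrA size_polyDl size_polyXn // size_polyDl ?size_polyXn ?size_poly1.
Qed.

(** The derivative is s^8 (s + 1)^4, and the polynomial has value 1 at 0 and 1. *)
Lemma node_roots : exists r : seq K,
  [/\ uniq r, size r = 13%N & forall s, (s \in r) = (node_poly.[s] == 0)].
Proof.
have [r rE] := closed_field_poly_normal node_poly.
have p_neq0 : node_poly != 0 by rewrite -size_poly_eq0 size_node_poly.
have l0 : lead_coef node_poly != 0 by rewrite lead_coef_eq0.
exists r; split.
- have : separable_poly node_poly.
    rewrite unlock; apply/Pdiv.ClosedField.coprimepP => s; rewrite /root node_polyE => /eqP e.
    have -> : node_poly^`() = 'X^8 * ('X + 1) ^+ 4.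
      rewrite /node_poly !derivE /=; ring: p0.
    rewrite hornerM hornerXn horner_exp hornerD hornerX hornerC mulf_neq0 //.
      apply: expf_neq0; apply: contra_eq_neq e => ->.
      by rewrite !expr0n /= !add0r oner_eq0.
    apply: expf_neq0; apply: contra_eq_neq e => /eqP; rewrite add2_eq0 // => /eqP->.
    rewrite !expr1n (_ : 1 + 1 + 1 = 1) ?oner_eq0 //; ring: two0.
  by rewrite rE (eqp_separable (eqp_scale _ l0)) separable_prod_XsubC.
- have := size_node_poly; rewrite {1}rE size_scale // size_prod_XsubC => -[].
  by [].
move=> s; rewrite rE hornerZ mulf_eq0 (negbTE l0) /=.
by rewrite -[RHS]/(root _ _) root_prod_XsubC.
Qed.

Definition node_vector (s : K) : 'rV[K]_4 :=
  \row_i [tuple 1; s ^+ 2; s ^+ 3; sq (s ^+ 7)]`_i.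

Let vertex : 'rV[K]_4 := row ord_max 1%:M.

Lemma vertexE i : vertex 0 i = (i == ord_max)%:R.
Proof. by rewrite /vertex !mxE eq_sym. Qed.

Lemma point_line (P : proj_space K 3) c v : c != 0 -> coords P = c *: v -> val P = <[v]>%VS.
Proof.
move=> c0 e; rewrite val_coords e; apply/eqP; rewrite eqEsubv -!memvE; apply/andP; split.
  exact/memvZ/memv_line.
by rewrite -[X in X \in _](scalerK c0) memvZ ?memv_line.
Qed.

Lemma vertex_singular (P : proj_space K 3) c : coords P = c *: vertex -> singular_point F P.
Proof.
move=> e; apply/singular_pointE; rewrite e !mxE /=.
by split; ring: two0.
Qed.

Lemma node_singular (P : proj_space K 3) c s : coords P = c *: node_vector s ->
  node_poly.[s] = 0 -> singular_point F P.
Proof.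
rewrite node_polyE => e h; apply/singular_pointE; rewrite e !mxE /=.
rewrite /singular_equations [(c * sq _) ^+ 2]exprMn sqK.
split; try ring: two0.
transitivity (c ^+ 4 * (s ^+ 13 + s ^+ 9 + 1)); first ring: two0.
by rewrite h mulr0.
Qed.

(** If x1 = 0, the derivatives along x3 and x1 give x2 = x3 = 0.  Otherwise
    scale to x1 = 1 and take s^2 = x2; the derivatives give x3 = s^3 and
    z^2 = s^7. *)
Lemma singular_points (P : proj_space K 3) : singular_point F P ->
  coords P = coords P 0 ord_max *: vertex \/
  exists s, [/\ coords P 0 0 != 0, node_poly.[s] = 0 & coords P = coords P 0 0 *: node_vector s].
Proof.
move/singular_pointE; set v := coords P; set x := v 0 i0; set y := v 0 i1.
set z := v 0 i2; set w := v 0 i3 => -[h h0 h1 h2].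
have ordE (i : 'I_4) : [\/ i = i0, i = i1, i = i2 | i = i3].
  case: i => -[|[|[|[|//]]]] h4; [apply: Or41|apply: Or42|apply: Or43|apply: Or44]; exact: val_inj.
have [x0|x0] := eqVneq x 0.
  have y0 : y = 0.
    by move: h2; rewrite x0 mul0r add0r => /eqP; rewrite expf_eq0 /= => /eqP.
  have z0 : z = 0.
    by move: h0; rewrite y0 mulr0 add0r => /eqP; rewrite expf_eq0 /= => /eqP.
  left; apply/rowP => i; rewrite mxE vertexE.
  by have [->|->|->|->] := ordE i; rewrite /= ?mulr0 ?mulr1.
right; pose s := sq (y / x).
have yE : y = x * s ^+ 2 by rewrite sqK mulrC divfK.
have zE : z = x * s ^+ 3.
  apply: (sqr_inj2 two0); apply: (mulfI x0); rewrite /=.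
  by apply/eqP; rewrite -(add2_eq0 two0) -[X in _ == X]h2 yE; apply/eqP; ring: two0.
have wE : w = x * sq (s ^+ 7).
  apply: (sqr_inj2 two0); apply: (mulfI x0); rewrite /= exprMn sqK.
  by apply/eqP; rewrite -(add2_eq0 two0) -[X in _ == X]h1 yE zE; apply/eqP; ring: two0.
exists s; split=> //.
  apply: (mulfI (expf_neq0 4 x0)); rewrite mulr0 node_polyE -h yE zE.
  by rewrite wE exprMn sqK; ring: two0.
apply/rowP => i; rewrite !mxE.
by have [->|->|->|->] := ordE i; rewrite /= ?mulr1.
Qed.

Lemma singular_card : has_card (singular_point F) 14.
Proof.
have node0 s : node_vector s != 0.
  by apply/eqP => /rowP/(_ i0)/eqP; rewrite !mxE /= oner_eq0.
have [f fE] := choice (fun s => point_exists (node0 s)).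
have vertex0 : vertex != 0.
  by apply/eqP => /rowP/(_ ord_max)/eqP; rewrite vertexE mxE eqxx oner_eq0.
have [P0 [c0 c0n P0E]] := point_exists vertex0.
have [r [ur sr rE]] := node_roots.
have f_inj : injective f.
  move=> s t e; have [c cn cE] := fE s; have [c' cn' cE'] := fE t.
  have := cE; rewrite e cE' => /rowP E.
  have := E i0; rewrite !mxE /= !mulr1 => cc.
  have := E i1; rewrite !mxE /= cc => /(mulfI cn) /(sqr_inj2 two0).
  by move=> /esym.
exists (P0 :: map f r); split.
- rewrite /= map_inj_uniq // ur andbT; apply/mapP => -[s _ e].
  have [c cn cE] := fE s; have := cE; rewrite -e P0E => /rowP/(_ i0).
  by rewrite !mxE /= mulr0 mulr1 => /esym/eqP; rewrite (negbTE cn).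
- by rewrite /= size_map sr.
move=> P; rewrite inE; apply/idP/idP => [/orP[/eqP->|/mapP[s sr' ->]]|/singular_points].
- exact: vertex_singular P0E.
- have [c _ cE] := fE s; apply: (node_singular cE); apply/eqP; by rewrite -rE.
case=> [e|[s [xn ps e]]].
  have wn : coords P 0 ord_max != 0.
    by apply: contraNneq (coords_neq0 P) => w0; rewrite e w0 scale0r.
  apply/orP; left; apply/eqP; apply: (eq_point (c := coords P 0 ord_max / c0)).
    by rewrite mulf_neq0 ?invr_neq0.
  by rewrite P0E scalerA divfK.
have [c cn cE] := fE s; apply/orP; right; apply/mapP; exists s; first by rewrite rE ps.
apply: (eq_point (c := coords P 0 0 / c)); first by rewrite mulf_neq0 ?invr_neq0.
by rewrite cE scalerA divfK.
Qed.

Lemma surface_double_inseparable :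
  exists P : proj_space K 3, double_point F P /\ inseparable_projection F P.
Proof.
have vertex0 : vertex != 0.
  by apply/eqP => /rowP/(_ ord_max)/eqP; rewrite vertexE mxE eqxx oner_eq0.
have [P [c c0 PE]] := point_exists vertex0.
have cP : centred P 1%:M by split; [exact: unitmx1|exact: point_line c0 PE].
have FE : change_coords 1%:M F = F.
  rewrite /change_coords -[RHS]comp_mpoly_id; congr (_ \mPo _).
  apply: eq_from_tnth => i; rewrite !tnth_mktuple (bigD1 i) //= mxE eqxx scale1r.
  by rewrite big1 ?addr0 // => j ji; rewrite mxE (negbTE ji) scale0r.
have Q0 : conic K != 0 := conic_neq0 two0.
exists P; split; last first.
  exists (conic K), (branch K); split; rewrite ?dhomog0 ?conic_homog ?branch_homog //.
  by exists 1%:M; split=> //; rewrite FE mwiden0 mulr0 addr0.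
exists 1%:M; split=> //; rewrite FE.
have -> : dehomogenize F = conic K + branch K.
  rewrite /dehomogenize /surface [LHS]rmorphD [X in X + _ = _]rmorphM /=.
  rewrite [X in X * _ + _ = _]rmorphXn /= comp_mpolyXU -tnth_nth tnth_mktuple unlift_none.
  rewrite expr1n mul1r !mwiden_comp -[in RHS](comp_mpoly_id (conic K)).
  rewrite -[in RHS](comp_mpoly_id (branch K)).
  have -> // : [tuple tnth [tuple (if unlift ord_max i is Some j then 'X_j else 1) | i < 4]
      (widen_ord (leqnSn 3) i) | i < 3] = [tuple 'X_i | i < 3] :> 3.-tuple {mpoly K[3]}.
  apply: eq_from_tnth => i; rewrite !tnth_mktuple.
  rewrite (_ : widen_ord _ i = lift ord_max i) ?liftK //.
  by apply: val_inj; rewrite /= /bump leqNgt ltn_ord.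
have /dhomogP hQ := conic_homog K; have /dhomogP hB := branch_homog K.
split=> [|t /msuppD_le]; last first.
  by rewrite mem_cat => /orP[/hQ ->|/hB ->].
have [t tQ] : exists t, t \in msupp (conic K).
  case E: (msupp (conic K)) => [|t l]; last by exists t; rewrite mem_head.
  by move/eqP: E; rewrite msupp_eq0 (negbTE Q0).
exists t; last exact: hQ.
rewrite mcoeff_msupp mcoeffD (dhomog_nemf_coeff (branch_homog K)) ?addr0; last first.
  by rewrite (hQ _ tQ).
by rewrite -mcoeff_msupp.
Qed.

Lemma surface_normal : normal_hypersurface 4 F.
Proof.
split; first by split; [exact: surface_neq0|exact: surface_homog].
move=> P FP; exact: surface_normal_at two0 FP.
Qed.
End Singular.

Theorem proposition3 (K : closedFieldType) (charK : 2%N \in [pchar K]) :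
  (forall F : {mpoly K[4]},
     normal_hypersurface 4 F ->
     (exists P : proj_space K 3,
        double_point F P /\ inseparable_projection F P) ->
     exists2 m : nat, has_card (singular_point F) m & (m <= 16)%N)
  /\
  (exists F : {mpoly K[4]},
     [/\ normal_hypersurface 4 F,
         exists P : proj_space K 3,
           double_point F P /\ inseparable_projection F P &
         has_card (singular_point F) 14]).
Proof.
have two0 : 2%:R = 0 :> K := pcharf0 charK.
split=> [F nF [P [_ iP]]|].
  have [m card_m le_m] := upper_bound charK nF (ex_intro _ P iP).
  by exists m => //; apply: leq_trans le_m _.
exists (surface K); split; [exact: surface_normal| |exact: singular_card].
exact: surface_double_inseparable.
Qed.
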